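(* Let $(M,\omega)$ be a symplectic manifold admitting a homogeneous compatible almost complex structure $J$ whose Chern-Ricci form satisfies $\rho=\lambda\omega$ for some real $\lambda\neq 0$. Then $M$ is a covering space of a co-adjoint orbit, and $\omega$ is the pull-back via the covering map of the canonical symplectic form of the co-adjoint orbit.
   Context: A compatible almost complex structure $J$ on a symplectic manifold $(M,\omega)$ is a section of $\mathrm{End}(TM)$ with $J^2=-\mathrm{id}$, $\omega(JX,JY)=\omega(X,Y)$ and $\omega(X,JX)>0$ for all nonzero $X$. It defines a Riemannian metric $g(X,Y)=\omega(X,JY)$. The Nijenhuis tensor $N$ is defined by $4N(X,Y)=[JX,JY]-J[JX,Y]-J[X,JY]-[X,Y]$. The Chern connection $\nabla$ is the unique connection preserving $g$ whose torsion equals $N$; explicitly $\nabla_X=D_X-\tfrac12 J(D_XJ)$ with $D$ the Levi-Civita connection of $g$. With $R(X,Y)=\nabla_X\nabla_Y-\nabla_Y\nabla_X-\nabla_{[X,Y]}$, the Chern-Ricci form is $\rho(X,Y)=\mathrm{tr}(JR(X,Y))$ (real trace). $J$ is called homogeneous on $(M,\omega)$ if $M$ is connected and there is a connected Lie group $G$ acting transitively on $M$ by diffeomorphisms preserving both $\omega$ and $J$; the action is assumed to be almost effective, i.e. no non-discrete normal subgroup of $G$ acts trivially on $M$. A co-adjoint orbit is an orbit in $\mathfrak g^*$ (with $\mathfrak g$ the Lie algebra of a connected Lie group $G$) of the action $\mathrm{Ad}_g^*\theta=\theta\circ\mathrm{Ad}_g^{-1}$. Its canonical (Kirillov-Kostant-Souriau)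 symplectic form is the $G$-invariant form which at a point $\theta$, under the identification of the tangent space with $\mathfrak g/\mathfrak g_\theta$ ($\mathfrak g_\theta$ the Lie algebra of the stabilizer of $\theta$), is induced by $(X,Y)\mapsto\theta([X,Y])$. *)

(* Defs.v *)
From HB Require Import structures.
From mathcomp Require Import all_boot all_order all_algebra.
From mathcomp Require Import all_classical all_reals all_analysis.

Set Implicit Arguments.
Unset Strict Implicit.
Unset Printing Implicit Defensive.

Import Order.TTheory GRing.Theory Num.Theory.
Import numFieldNormedType.Exports.

Local Open Scope classical_set_scope.
Local Open Scope ring_scope.

(* Meant for U open (and V finite-dimensional): every notion below is local,
   so the values of f outside U are irrelevant. *)
Fixpoint Ck (R : realType) (V W : normedModType R) (k : nat)
    (U : set V) (f : V -> W) : Prop :=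
  match k with
  | 0%N => forall x, U x -> {for x, continuous f}
  | k'.+1 => (forall x, U x -> differentiable f x) /\
             (forall v, Ck k' U (fun x => 'D_v f x))
  end.

Definition Cinfty (R : realType) (V W : normedModType R)
    (U : set V) (f : V -> W) : Prop := forall k, Ck k U f.

(* [chart_map] is only meaningful on [chart_dom], [chart_inv] on the image. *)
Record chart (R : realType) (V : normedModType R) (T : topologicalType) :=
  Chart { chart_dom : set T; chart_map : T -> V; chart_inv : V -> T }.

(* Topological space with a set of charts, no axiom being imposed: products
   and the real line are then plain definitions. *)
Record charted (R : realType) (V : normedModType R) := Charted {
  space :> topologicalType;
  charts : set (chart V space) }.

Definition chart_laws (R : realType) (V : normedModType R)
    (T : topologicalType) (c : chart V T) : Prop :=
  [/\ open (chart_dom c),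
      open (chart_map c @` chart_dom c),
      forall x, chart_dom c x -> chart_inv c (chart_map c x) = x,
      forall x, chart_dom c x -> {for x, continuous (chart_map c)} &
      forall x, chart_dom c x ->
        {for chart_map c x, continuous (chart_inv c)}].

(* Smoothness of F on U (meant for U open). *)
Definition smooth_on (R : realType) (V W : normedModType R)
    (M : charted V) (N : charted W) (U : set M) (F : M -> N) : Prop :=
  (forall x, U x -> {for x, continuous F}) /\
  (forall c d, charts c -> charts d ->
    Cinfty (chart_map c @` (chart_dom c `&` U `&` F @^-1` chart_dom d))
           (chart_map d \o F \o chart_inv c)).

Definition smooth (R : realType) (V W : normedModType R)
    (M : charted V) (N : charted W) (F : M -> N) : Prop :=
  smooth_on setT F.

Definition is_manifold (R : realType) (V : normedModType R)
    (M : charted V) : Prop :=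
  [/\ hausdorff_space M,
      @second_countable M,
      forall x : M, exists2 c, charts c & chart_dom c x,
      forall c : chart V M, charts c -> chart_laws c &
      forall c d : chart V M, charts c -> charts d ->
        Cinfty (chart_map c @` (chart_dom c `&` chart_dom d))
               (chart_map d \o chart_inv c)].

Record manifold (R : realType) (n : nat) := Manifold {
  manifold_charted :> charted 'rV[R]_n;
  manifoldP : is_manifold manifold_charted }.

Definition prod_chart (R : realType) (V W : normedModType R)
    (S T : topologicalType) (c : chart V S) (d : chart W T)
    : chart (V * W)%type (S * T)%type :=
  Chart (chart_dom c `*` chart_dom d)
        (fun p => (chart_map c p.1, chart_map d p.2))
        (fun q => (chart_inv c q.1, chart_inv d q.2)).

Definition prod_charted (R : realType) (V W : normedModType R)
    (M : charted V) (N : charted W) : charted (V * W)%type :=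
  @Charted R (V * W)%type (M * N)%type
    [set e | exists c d, [/\ charts c, charts d & e = prod_chart c d]].

Definition real_line (R : realType) : charted R^o :=
  @Charted R R^o R^o [set Chart setT id id].

Definition smooth_fun (R : realType) (n : nat) (M : manifold R n)
    (f : M -> R) : Prop :=
  @smooth R _ _ M (real_line R) f.

(* Tangent vectors at p are the derivations at p of the algebra of smooth
   functions.  They are represented by functionals on all functions, with
   value 0 on the functions that are not smooth, so that two tangent vectors
   are equal iff they are the same derivation. *)
Definition vec (R : realType) (n : nat) (M : manifold R n) : Type :=
  (M -> R) -> R.

Definition tangent (R : realType) (n : nat) (M : manifold R n) (p : M)
    : set (vec M) :=
  [set v | [/\ forall f, ~ smooth_fun f -> v f = 0,
    forall (a : R) f g, smooth_fun f -> smooth_fun g ->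
      v (fun x => a * f x + g x) = a * v f + v g &
    forall f g, smooth_fun f -> smooth_fun g ->
      v (fun x => f x * g x) = v f * g p + f p * v g]].

Definition differential (R : realType) (n m : nat) (M : manifold R n)
    (N : manifold R m) (F : M -> N) (v : vec M) : vec N :=
  fun f => if `[< smooth_fun f >] then v (f \o F) else 0.

Definition field (R : realType) (n : nat) (M : manifold R n) : Type :=
  M -> vec M.

Definition vector_field (R : realType) (n : nat) (M : manifold R n)
    : set (field M) :=
  [set X | (forall p, tangent p (X p)) /\
           (forall f, smooth_fun f -> smooth_fun (fun p => X p f))].

Definition bracket (R : realType) (n : nat) (M : manifold R n)
    (X Y : field M) : field M :=
  fun p f => X p (fun q => Y q f) - Y p (fun q => X q f).

Definition two_form (R : realType) (n : nat) (M : manifold R n)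
    (w : M -> vec M -> vec M -> R) : Prop :=
  [/\ forall p (a : R) u v z, tangent p u -> tangent p v -> tangent p z ->
        w p (fun f => a * u f + v f) z = a * w p u z + w p v z,
      forall p u v, tangent p u -> tangent p v -> w p u v = - w p v u &
      forall X Y, vector_field X -> vector_field Y ->
        smooth_fun (fun p => w p (X p) (Y p))].

(* dw = 0, by the invariant formula for the exterior derivative. *)
Definition closed_form (R : realType) (n : nat) (M : manifold R n)
    (w : M -> vec M -> vec M -> R) : Prop :=
  forall X Y Z, vector_field X -> vector_field Y -> vector_field Z ->
  forall p,
    X p (fun q => w q (Y q) (Z q)) - Y p (fun q => w q (X q) (Z q))
    + Z p (fun q => w q (X q) (Y q))
    - w p (bracket X Y p) (Z p) + w p (bracket X Z p) (Y p)
    - w p (bracket Y Z p) (X p) = 0.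

Definition nondegenerate (R : realType) (n : nat) (M : manifold R n)
    (w : M -> vec M -> vec M -> R) : Prop :=
  forall p u, tangent p u -> (forall v, tangent p v -> w p u v = 0) ->
    u = (fun=> 0).

Definition symplectic (R : realType) (n : nat) (M : manifold R n)
    (w : M -> vec M -> vec M -> R) : Prop :=
  [/\ two_form w, closed_form w & nondegenerate w].

Definition endomorphism_field (R : realType) (n : nat) (M : manifold R n)
    (J : M -> vec M -> vec M) : Prop :=
  [/\ forall p v, tangent p v -> tangent p (J p v),
      forall p (a : R) u v, tangent p u -> tangent p v ->
        J p (fun f => a * u f + v f) = (fun f => a * J p u f + J p v f) &
      forall X, vector_field X -> vector_field (fun p => J p (X p))].

Definition compatible_acs (R : realType) (n : nat) (M : manifold R n)
    (w : M -> vec M -> vec M -> R) (J : M -> vec M -> vec M) : Prop :=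
  [/\ endomorphism_field J,
      forall p v, tangent p v -> J p (J p v) = (fun f => - v f),
      forall p u v, tangent p u -> tangent p v ->
        w p (J p u) (J p v) = w p u v &
      forall p v, tangent p v -> v <> (fun=> 0) -> 0 < w p v (J p v)].

Definition connection (R : realType) (n : nat) (M : manifold R n)
    (nabla : field M -> field M -> field M) : Prop :=
  [/\ forall X Y, vector_field X -> vector_field Y ->
        vector_field (nabla X Y),
      forall h X Y Z, smooth_fun h ->
        vector_field X -> vector_field Y -> vector_field Z ->
        nabla (fun p f => h p * X p f + Y p f) Z
        = (fun p f => h p * nabla X Z p f + nabla Y Z p f) &
      forall h X Y Z, smooth_fun h ->
        vector_field X -> vector_field Y -> vector_field Z ->
        nabla X (fun p f => h p * Y p f + Z p f)
        = (fun p f => X p h * Y p f + h p * nabla X Y p f + nabla X Z p f)].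

Definition preserves_metric (R : realType) (n : nat) (M : manifold R n)
    (g : M -> vec M -> vec M -> R) (nabla : field M -> field M -> field M)
    : Prop :=
  forall X Y Z, vector_field X -> vector_field Y -> vector_field Z ->
  forall p, X p (fun q => g q (Y q) (Z q))
            = g p (nabla X Y p) (Z p) + g p (Y p) (nabla X Z p).

Definition torsion (R : realType) (n : nat) (M : manifold R n)
    (nabla : field M -> field M -> field M) (X Y : field M) : field M :=
  fun p f => nabla X Y p f - nabla Y X p f - bracket X Y p f.

Definition nijenhuis (R : realType) (n : nat) (M : manifold R n)
    (J : M -> vec M -> vec M) (X Y : field M) : field M :=
  let JX := fun q => J q (X q) in
  let JY := fun q => J q (Y q) in
  fun p f => 4^-1 * (bracket JX JY p f - J p (bracket JX Y p) f
                     - J p (bracket X JY p) f - bracket X Y p f).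

Definition chern_connection (R : realType) (n : nat) (M : manifold R n)
    (w : M -> vec M -> vec M -> R) (J : M -> vec M -> vec M)
    (nabla : field M -> field M -> field M) : Prop :=
  [/\ connection nabla,
      preserves_metric (fun p u v => w p u (J p v)) nabla &
      forall X Y, vector_field X -> vector_field Y ->
        torsion nabla X Y = nijenhuis J X Y].

Definition curvature (R : realType) (n : nat) (M : manifold R n)
    (nabla : field M -> field M -> field M) (X Y Z : field M) : field M :=
  fun p f => nabla X (nabla Y Z) p f - nabla Y (nabla X Z) p f
             - nabla (bracket X Y) Z p f.

(* For A linear over the smooth functions, t is the trace of the endomorphism
   of the tangent space at p induced by A, computed in a basis given by the
   values at p of vector fields. *)
Definition is_trace_at (R : realType) (n : nat) (M : manifold R n)
    (A : field M -> field M) (p : M) (t : R) : Prop :=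
  exists (E : 'I_n -> field M) (a : 'M[R]_n),
    [/\ forall i, vector_field (E i),
        forall v, tangent p v ->
          exists! c : 'rV[R]_n, forall f, v f = \sum_i c 0 i * E i p f,
        forall j f, A (E j) p f = \sum_i a i j * E i p f &
        t = \tr a].

Definition chern_ricci_form (R : realType) (n : nat) (M : manifold R n)
    (w : M -> vec M -> vec M -> R) (J : M -> vec M -> vec M)
    (rho : M -> vec M -> vec M -> R) : Prop :=
  two_form rho /\
  exists2 nabla, chern_connection w J nabla &
    forall X Y, vector_field X -> vector_field Y -> forall p,
      is_trace_at (fun Z q => J q (curvature nabla X Y Z q)) p
                  (rho p (X p) (Y p)).

Record lie_group (R : realType) (k : nat) := LieGroup {
  lie_manifold :> manifold R k;
  lie_mul : lie_manifold -> lie_manifold -> lie_manifold;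
  lie_one : lie_manifold;
  lie_inv : lie_manifold -> lie_manifold;
  lie_mulA : associative lie_mul;
  lie_mul1 : left_id lie_one lie_mul;
  lie_mulV : left_inverse lie_one lie_inv lie_mul;
  lie_mul_smooth :
    @smooth R _ _ (prod_charted lie_manifold lie_manifold) lie_manifold
      (fun p => lie_mul p.1 p.2);
  lie_inv_smooth : @smooth R _ _ lie_manifold lie_manifold lie_inv }.

Arguments lie_one {R k} _.

Definition lie_action (R : realType) (k n : nat) (G : lie_group R k)
    (M : manifold R n) (act : G -> M -> M) : Prop :=
  [/\ forall x, act (lie_one G) x = x,
      forall g h x, act (lie_mul g h) x = act g (act h x) &
      @smooth R _ _ (prod_charted G M) M (fun p => act p.1 p.2)].

Definition form_invariant (R : realType) (k n : nat) (G : lie_group R k)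
    (M : manifold R n) (act : G -> M -> M) (w : M -> vec M -> vec M -> R)
    : Prop :=
  forall g p u v, tangent p u -> tangent p v ->
    w (act g p) (differential (act g) u) (differential (act g) v) = w p u v.

Definition acs_invariant (R : realType) (k n : nat) (G : lie_group R k)
    (M : manifold R n) (act : G -> M -> M) (J : M -> vec M -> vec M)
    : Prop :=
  forall g p v, tangent p v ->
    J (act g p) (differential (act g) v) = differential (act g) (J p v).

Definition normal_subgroup (R : realType) (k : nat) (G : lie_group R k)
    (K : set G) : Prop :=
  [/\ K (lie_one G),
      forall g h, K g -> K h -> K (lie_mul g h),
      forall g, K g -> K (lie_inv g) &
      forall g h, K h -> K (lie_mul (lie_mul g h) (lie_inv g))].

Definition discrete_subset (T : topologicalType) (K : set T) : Prop :=
  forall x, K x -> exists2 U : set T, open U & U `&` K = [set x].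

Definition almost_effective (R : realType) (k n : nat) (G : lie_group R k)
    (M : manifold R n) (act : G -> M -> M) : Prop :=
  forall K : set G, normal_subgroup K ->
    (forall g x, K g -> act g x = x) -> discrete_subset K.

(* Connectedness includes nonemptiness. *)
Definition homogeneous (R : realType) (n : nat) (M : manifold R n)
    (w : M -> vec M -> vec M -> R) (J : M -> vec M -> vec M) : Prop :=
  [/\ [set: M] !=set0, connected [set: M] &
    exists (k : nat) (G : lie_group R k) (act : G -> M -> M),
      [/\ connected [set: G],
          lie_action act /\ almost_effective act,
          forall x y, exists g, act g x = y,
          form_invariant act w &
          acs_invariant act J]].

(* The Lie algebra is that of left-invariant vector fields. *)
Definition lie_algebra (R : realType) (k : nat) (G : lie_group R k)
    : set (field G) :=
  [set X | vector_field X /\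
           forall g h, differential (lie_mul g) (X h) = X (lie_mul g h)].

(* Push-forward of X by h |-> g h g^-1. *)
Definition Ad (R : realType) (k : nat) (G : lie_group R k) (g : G)
    (X : field G) : field G :=
  fun h => differential (fun h' => lie_mul (lie_mul g h') (lie_inv g))
             (X (lie_mul (lie_mul (lie_inv g) h) g)).

(* As for tangent vectors, functionals on the Lie algebra are extended by 0. *)
Definition lie_dual (R : realType) (k : nat) (G : lie_group R k)
    : set (field G -> R) :=
  [set theta | (forall X, ~ lie_algebra X -> theta X = 0) /\
    (forall (a : R) X Y, lie_algebra X -> lie_algebra Y ->
      theta (fun p f => a * X p f + Y p f) = a * theta X + theta Y)].

Definition coAd (R : realType) (k : nat) (G : lie_group R k) (g : G)
    (theta : field G -> R) : field G -> R :=
  fun X => if `[< lie_algebra X >] then theta (Ad (lie_inv g) X) else 0.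

Definition submersion (R : realType) (n m : nat) (M : manifold R n)
    (N : manifold R m) (F : M -> N) : Prop :=
  @smooth R _ _ M N F /\
  forall p w, tangent (F p) w -> exists2 v, tangent p v & differential F v = w.

(* Through iota, O is the coadjoint orbit of some theta, and act is the
   coadjoint action on it.  The smooth structure on O is the one of the
   quotient of G by the stabilizer, which is characterized by the orbit maps
   being smooth submersions. *)
Definition coadjoint_orbit (R : realType) (k m : nat) (G : lie_group R k)
    (O : manifold R m) (iota : O -> (field G -> R)) (act : G -> O -> O)
    : Prop :=
  [/\ injective iota,
      exists2 theta, lie_dual theta &
        range iota = range (fun g : G => coAd g theta),
      forall g o, iota (act g o) = coAd g (iota o) &
      forall o, submersion (fun g => act g o)].

(* The identification of the tangent space at o with a quotient of the Lie
   algebra is induced by the differential at the unit of g |-> act g o. *)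
Definition kks_form (R : realType) (k m : nat) (G : lie_group R k)
    (O : manifold R m) (iota : O -> (field G -> R)) (act : G -> O -> O)
    (Omega : O -> vec O -> vec O -> R) : Prop :=
  [/\ two_form Omega,
      form_invariant act Omega &
      forall o X Y, lie_algebra X -> lie_algebra Y ->
        Omega o (differential (fun g => act g o) (X (lie_one G)))
                (differential (fun g => act g o) (Y (lie_one G)))
        = iota o (bracket X Y)].

(* Smooth coverings: the sheets V i over U are disjoint open sets, and s i is
   the inverse of the diffeomorphism from V i onto U induced by pi. *)
Definition smooth_covering (R : realType) (n m : nat) (M : manifold R n)
    (N : manifold R m) (pi : M -> N) : Prop :=
  [/\ @smooth R _ _ M N pi,
      range pi = setT &
      forall y : N, exists U : set N, [/\ open U, U y &
        exists (I : Type) (V : I -> set M) (s : I -> N -> M),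
          [/\ trivIset setT V,
              pi @^-1` U = \bigcup_i V i,
              forall i, open (V i),
              forall i, @smooth_on R _ _ N M U (s i) &
              forall i, (forall x, V i x -> s i (pi x) = x) /\
                        (forall z, U z -> V i (s i z) /\ pi (s i z) = z)]]].

(* Main.v *)
(* Let A_V = nabla_V - L_V for V an infinitesimal automorphism of (w, J).  The
   defining properties of the Chern connection give nabla J = 0 and L_V nabla = 0,
   so A_V is a J-linear endomorphism field and R(V, W) = [A_V, A_W] + A_[V,W].
   Taking traces, lambda w(V, W) = tr (J A_[V,W]).  Hence
   theta_p(X) = - lambda^-1 tr_p (J A_{X_M}), with X_M the fundamental vector field of
   X, is a G-equivariant map from M to the dual of the Lie algebra such that
   w(X_M, Y_M) = theta([X, Y]), as [X_M, Y_M] is minus [X, Y]_M here.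
   Transitivity makes the orbit maps submersions with local sections, so that w is
   determined by its values on fundamental fields and, being nondegenerate, theta is
   an immersion.  The orbit theta(M), with the quotient topology, is then a
   manifold covered by M. *)

Require Import Defs.
From HB Require Import structures.
From mathcomp Require Import all_boot all_order all_algebra.
From mathcomp Require Import all_classical all_reals all_analysis.
From mathcomp Require Import ring lra.

Set Implicit Arguments.
Unset Strict Implicit.
Unset Printing Implicit Defensive.

Import Order.TTheory GRing.Theory Num.Theory.
Import numFieldNormedType.Exports.

Local Open Scope classical_set_scope.
Local Open Scope ring_scope.

(** * Smooth maps between normed spaces *)

(** Uniqueness of the Chern connection enters in one algebraic form, [sym_skew_zero]: an expression
    in three fields that is symmetric in the first two and skew in the last two vanishes. It is
    applied to the defect of each claimed identity, the torsion or dw = 0 giving the symmetry and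
    the metric the skewness; this yields nabla J = 0, L_V nabla = 0 and the invariance of nabla
    under each [act g], hence the equivariance of theta. L_V along a fundamental field is a
    derivative at the unit of a function on G, and [tangent_swap] exchanges it with derivatives on
    M. That orbit maps have full rank is a global fact. Homogeneity makes the rank maximal
    everywhere; if it were smaller than n, a function locally constant along the group would take a
    whole segment of values, against the second countability of G. Tangent vectors are derivations
    of global functions, so every local object (coordinates, frames, Hadamard coefficients) is first
    multiplied by a cutoff. The covering uses homogeneity too: one sheet carrying a local section of
    G is moved by the group to every point of the fibre. *)

Section Ck_theory.
Context {R : realType}.

Lemma shift_cvg0 (V : normedModType R) (z : V) :
  (y + z) @[y --> (0 : V)] --> z.
Proof. by rewrite -{2}[z]add0r; apply: cvgD; [exact: cvg_id|exact: cvg_cst]. Qed.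

(** [g - f] vanishes near [x], so the zero map is its differential with no remainder, and [g] is [f]
    plus this correction. *)
Lemma near_differentiable (V W : normedModType R) (f g : V -> W) x :
  {near x, f =1 g} -> differentiable f x -> differentiable g x.
Proof.
move=> fg df; have -> : g = f + (g - f) by apply/funext => y; rewrite !fctE addrC subrK.
apply: differentiableD => //.
have h0 : forall y, (0 : V -> W) y = 0 by [].
have lin0 : linear (0 : V -> W) by move=> a u v; rewrite !h0 scaler0 addr0.
pose z0 : {linear V -> W} := HB.pack (0 : V -> W) (GRing.isLinear.Build _ _ _ _ _ lin0).
have E : (g - f) \o shift x = cst ((g - f) x) + z0 +o_ (0 : V) id.
  apply/eqaddoP => e e0; near=> y.
  rewrite [X in `|X|](_ : _ = g (y + x) - f (y + x) - (g x - f x + 0)); last by [].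
  rewrite (nbhs_singleton fg) subrr addr0 subr0.
  have -> : f (y + x) = g (y + x).
    by near: y; exact: (shift_cvg0 (z := x)) fg.
  by rewrite subrr normr0 mulr_ge0// ltW.
have c0 : continuous z0 by move=> y; exact: cvg_cst.
apply/diff_locallyP; rewrite (diff_unique c0 E); split => //.
Unshelve. all: by end_near. Qed.

Lemma open_near (T : topologicalType) (U : set T) (P : T -> Prop) x :
  open U -> U x -> (forall y, U y -> P y) -> \forall y \near x, P y.
Proof. by move=> oU Ux UP; apply: filterS UP _; exact: open_nbhs_nbhs. Qed.

Lemma CkSP k (V W : normedModType R) (U : set V) (f : V -> W) :
  Ck k.+1 U f <-> (forall x, U x -> differentiable f x) /\
                  (forall v, Ck k U ('D_v f)).
Proof. by []. Qed.

Lemma Ck_eq k (V W : normedModType R) (U : set V) (f g : V -> W) :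
  open U -> (forall x, U x -> f x = g x) -> Ck k U f -> Ck k U g.
Proof.
move=> oU; elim: k f g => [|k IH] f g fg /=.
  move=> cf x Ux; have := cf x Ux; rewrite /prop_for /continuous_at (fg _ Ux).
  by apply: cvg_trans; apply: near_eq_cvg; apply: open_near Ux _ => // y /fg ->.
move=> [df Df]; split=> [x Ux|v].
  by apply: near_differentiable (df _ Ux); exact: open_near fg.
apply: IH (Df v) => x Ux; apply: near_eq_derive; exact: open_near fg.
Qed.

Lemma CkW k (V W : normedModType R) (U : set V) (f : V -> W) :
  Ck k.+1 U f -> Ck k U f.
Proof.
elim: k f => [|k IH] f [df Df]; first by move=> x /df/differentiable_continuous.
by split=> // v; apply: IH; exact: Df.
Qed.

Lemma CkS k (V W : normedModType R) (U U' : set V) (f : V -> W) :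
  U' `<=` U -> Ck k U f -> Ck k U' f.
Proof.
move=> sU; elim: k f => [|k IH] f /=; first by move=> h x /sU/h.
by move=> [df Df]; split=> [x /sU/df//|v]; exact: IH.
Qed.

Lemma Ck_local k (V W : normedModType R) (U : set V) (f : V -> W) :
  (forall x, U x -> exists2 U', U' x & Ck k U' f) -> Ck k U f.
Proof.
elim: k f => [|k IH] f H /=.
  by move=> x Ux; have [U' U'x] := H _ Ux; exact.
split=> [x Ux|v]; first by have [U' U'x [+ _]] := H _ Ux; exact.
by apply: IH => x Ux; have [U' U'x [_ h]] := H _ Ux; exists U' => //; exact: h.
Qed.

Lemma Ck_cst k (V W : normedModType R) (U : set V) (a : W) :
  Ck k U (fun _ : V => a).
Proof.
elim: k a => [|k IH] a /=; first by move=> x _; exact: cvg_cst.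
split=> [x _|v]; first exact: differentiable_cst.
have -> : (fun x => 'D_v (fun _ : V => a) x) = (fun _ => 0).
  by apply/funext => x; exact: derive_cst.
exact: IH.
Qed.

Lemma Ck_linear_comp k (V W Z : normedModType R) (U : set V) (f : V -> W)
    (l : {linear W -> Z}) :
  open U -> continuous l -> Ck k U f -> Ck k U (l \o f).
Proof.
move=> oU cl; elim: k f => [|k IH] f /=.
  by move=> cf x /cf cfx; apply: continuous_comp => //; exact: cl.
move=> [df Df]; have dl y : differentiable l y by exact: linear_differentiable.
split=> [x /df dfx|v]; first exact: differentiable_comp.
apply: Ck_eq oU _ (IH _ (Df v)) => x /df dfx /=.
rewrite !deriveE//; last exact: differentiable_comp.
by rewrite [in RHS]diff_comp//= (diff_lin _ cl).
Qed.

Lemma CkD k (V W : normedModType R) (U : set V) (f g : V -> W) :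
  open U -> Ck k U f -> Ck k U g -> Ck k U (fun x => f x + g x).
Proof.
move=> oU; elim: k f g => [|k IH] f g /=.
  by move=> cf cg x Ux; apply: cvgD; [exact: cf|exact: cg].
move=> [df Df] [dg Dg]; split=> [x Ux|v].
  by apply: differentiableD; [exact: df|exact: dg].
apply: Ck_eq oU _ (IH _ _ (Df v) (Dg v)) => x Ux.
by rewrite deriveD//; apply: diff_derivable; [exact: df|exact: dg].
Qed.

Lemma CkZ k (V W : normedModType R) (U : set V) (a : R) (f : V -> W) :
  open U -> Ck k U f -> Ck k U (fun x => a *: f x).
Proof.
move=> oU; elim: k f => [|k IH] f /=.
  by move=> cf x Ux; apply: cvgZ; [exact: cvg_cst|exact: cf].
move=> [df Df]; split=> [x Ux|v]; first by apply: differentiableZ; exact: df.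
apply: Ck_eq oU _ (IH _ (Df v)) => x Ux.
by rewrite deriveZ//; apply: diff_derivable; exact: df.
Qed.

Lemma CkM k (V : normedModType R) (U : set V) (f g : V -> R^o) :
  open U -> Ck k U f -> Ck k U g -> Ck k U (fun x => f x * g x : R^o).
Proof.
move=> oU; elim: k f g => [|k IH] f g.
  by move=> cf cg x Ux; apply: cvgM; [exact: cf|exact: cg].
move=> Cf Cg; have [df Df] := (CkSP _ _ _).1 Cf.
have [dg Dg] := (CkSP _ _ _).1 Cg; split=> [x Ux|v].
  by apply: differentiableM; [exact: df|exact: dg].
have := CkD oU (IH _ _ (CkW Cf) (Dg v)) (IH _ _ (CkW Cg) (Df v)).
apply: Ck_eq => // x Ux.
by rewrite deriveM//; apply: diff_derivable; [exact: df|exact: dg].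
Qed.

Lemma Ck_inv k (V : normedModType R) (U : set V) (f : V -> R^o) :
  open U -> (forall x, U x -> f x != 0) -> Ck k U f ->
  Ck k U (fun x => (f x)^-1 : R^o).
Proof.
move=> oU f0; elim: k => [|k IH] Cf.
  by move=> x Ux; apply: cvgV; [exact: f0|exact: Cf].
have [df Df] := (CkSP _ _ _).1 Cf; split=> [x Ux|v].
  by apply: differentiableV; [exact: df|exact: f0].
have Ci := IH (CkW Cf).
have := CkM oU (CkZ (-1) oU (CkM oU Ci Ci)) (Df v); apply: Ck_eq => // x Ux.
rewrite deriveV ?f0//; last by apply: diff_derivable; exact: df.
by rewrite -[RHS]/(- f x ^- 2 * 'D_v f x) scaleN1r -exprVn expr2.
Qed.

Lemma scale_is_bilinear (W : normedModType R) :
  bilinear_for (GRing.Scale.Law.clone _ _ *:%R _) (GRing.Scale.Law.clone _ _ *:%R _)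
    ( *:%R : R^o -> W -> W).
Proof.
by split=> [u'|u] a x y /=; rewrite ?scalerDl ?scalerDr !scalerA// mulrC.
Qed.

(** Scaling is a continuous bilinear map composed with the pair of [a] and [f], so this is an
    instance of the differential of a bilinear map. *)
Lemma differentiable_scale (V W : normedModType R) (a : V -> R^o) (f : V -> W) x :
  differentiable a x -> differentiable f x ->
  differentiable (fun y => a y *: f y) x /\
  forall v, 'D_v (fun y => a y *: f y) x = a x *: 'D_v f x + 'D_v a x *: f x.
Proof.
move=> da df.
pose B : {bilinear R^o -> W -> W} := HB.pack ( *:%R : R^o -> W -> W)
  (bilinear_isBilinear.Build _ _ _ _ _ _ _ (scale_is_bilinear W)).
have cB : continuous (fun p => B p.1 p.2) by exact: scale_continuous.
have dB p : differentiable (fun p => B p.1 p.2) p by exact: differentiable_bilin.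
have dp := differentiable_pair da df.
have E : (fun y => a y *: f y) = (fun p => B p.1 p.2) \o (fun y => (a y, f y)) by [].
rewrite E; split; first exact: differentiable_comp.
move=> v; rewrite deriveE; last exact: differentiable_comp.
by rewrite (diff_comp dp (dB _)) /= (diff_bilin _ cB) /= (diff_pair da df) /= !deriveE.
Qed.

Lemma CkZf k (V W : normedModType R) (U : set V) (a : V -> R^o) (f : V -> W) :
  open U -> Ck k U a -> Ck k U f -> Ck k U (fun x => a x *: f x).
Proof.
move=> oU; elim: k a f => [|k IH] a f.
  by move=> ca cf x Ux; apply: cvgZ; [exact: ca|exact: cf].
move=> Ca Cf; have [da Da] := (CkSP _ _ _).1 Ca.
have [df Df] := (CkSP _ _ _).1 Cf; split=> [x Ux|v].
  by have [] := differentiable_scale (da x Ux) (df x Ux).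
have := CkD oU (IH _ _ (CkW Ca) (Df v)) (IH _ _ (Da v) (CkW Cf)).
apply: Ck_eq => // x Ux.
by have [_ ->] := differentiable_scale (da x Ux) (df x Ux).
Qed.

Lemma Ck_scale k (V W : normedModType R) (U : set V) (f : V -> R^o) (w : W) :
  open U -> Ck k U f -> Ck k U (fun x => f x *: w).
Proof.
move=> oU Cf.
have lin : linear ( *:%R ^~ w : R^o -> W) by move=> a u v; rewrite scalerDl scalerA.
pose l : {linear R^o -> W} :=
  HB.pack ( *:%R ^~ w : R^o -> W) (GRing.isLinear.Build _ _ _ _ _ lin).
apply: (Ck_linear_comp (l := l)) => //; exact: scalel_continuous.
Qed.

Lemma Ck_sum k (V W : normedModType R) (U : set V) (I : Type) (r : seq I)
    (F : I -> V -> W) :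
  open U -> (forall i, Ck k U (F i)) -> Ck k U (fun x => \sum_(i <- r) F i x).
Proof.
move=> oU CF; elim: r => [|i r IH].
  by apply: Ck_eq oU _ (Ck_cst k U 0) => x _; rewrite big_nil.
by apply: Ck_eq oU _ (CkD oU (CF i) IH) => x _; rewrite big_cons.
Qed.

Lemma Ck_pair k (V W Z : normedModType R) (U : set V) (f : V -> W) (g : V -> Z) :
  open U -> Ck k U f -> Ck k U g -> Ck k U (fun x => (f x, g x)).
Proof.
move=> oU; elim: k f g => [|k IH] f g /=.
  by move=> cf cg x Ux; apply: cvg_pair; [exact: cf|exact: cg].
move=> [df Df] [dg Dg]; split=> [x Ux|v].
  by apply: differentiable_pair; [exact: df|exact: dg].
apply: Ck_eq oU _ (IH _ _ (Df v) (Dg v)) => x Ux.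
have [dfx dgx] := (df x Ux, dg x Ux).
by rewrite !deriveE//; [rewrite diff_pair|exact: differentiable_pair].
Qed.

(** Finite dimension in the form that is used: every vector is expanded, with continuous linear
    coefficients, along a finite family, which need not be free. *)
Definition findim (V : normedModType R) : Prop :=
  exists (m : nat) (b : 'I_m -> V) (l : 'I_m -> {linear V -> R^o}),
    (forall i, continuous (l i)) /\ forall v, v = \sum_i l i v *: b i.

(** [Ck] differentiates in fixed directions, whereas the derivative of [f \o g] is that of [f] in
    the moving direction ['D_v g x]. Expanding this direction along a finite family leaves
    derivatives of [f] in fixed directions, to which the induction hypothesis applies. *)
Lemma Ck_comp k (V W Z : normedModType R) (U : set V) (U' : set W)
    (f : W -> Z) (g : V -> W) :
  findim W -> open U -> open U' -> (forall x, U x -> U' (g x)) ->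
  Ck k U' f -> Ck k U g -> Ck k U (f \o g).
Proof.
move=> [m [b [l [cl lE]]]] oU oU' gU.
elim: k f => [|k IH] f.
  by move=> cf cg x Ux; apply: continuous_comp; [exact: cg|apply: cf; exact: gU].
move=> [df Df] Cg; have [dg Dg] := (CkSP _ _ _).1 Cg; split=> [x Ux|v].
  by apply: differentiable_comp; [exact: dg|apply: df; exact: gU].
apply: (@Ck_eq _ _ _ _
  (fun x => \sum_i (l i ('D_v g x) : R^o) *: ('D_(b i) f (g x)))) => //.
  move=> x Ux; have [dgx dfx] := (dg x Ux, df _ (gU _ Ux)).
  rewrite [RHS]deriveE; last exact: differentiable_comp.
  rewrite diff_comp//= -!deriveE// {2}(lE ('D_v g x)) !deriveE// linear_sum/=.
  by apply: eq_bigr => i _; rewrite linearZ/= deriveE.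
apply: Ck_sum => // i; apply: CkZf => //.
  by apply: (Ck_linear_comp (l := l i) (f := 'D_v g)) => //; exact: Dg.
by apply: (IH (fun y => 'D_(b i) f y)); [exact: Df|exact: CkW].
Qed.

End Ck_theory.

(** * Smoothness at a point; finite-dimensional spaces *)

Section Cinf_theory.
Context {R : realType}.
Implicit Types V W Z : normedModType R.

(** One neighbourhood serves all orders, so that smoothness at a point passes to the nearby
    points. *)
Definition Cinf_at V W (x : V) (f : V -> W) : Prop :=
  exists2 U, open_nbhs x U & Cinfty U f.

Lemma Cinf_atP V W (U : set V) (f : V -> W) : open U ->
  Cinfty U f <-> forall x, U x -> Cinf_at x f.
Proof.
move=> oU; split=> [Uf x Ux|Uf k]; first by exists U.
by apply: Ck_local => x /Uf[U' [_ U'x] /(_ k)]; exists U'.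
Qed.

Lemma Cinf_at_near V W (x : V) (f : V -> W) :
  Cinf_at x f -> \forall y \near x, Cinf_at y f.
Proof.
by move=> [U [oU Ux] Uf]; apply: (open_near oU Ux) => y Uy; exists U.
Qed.

Lemma Cinf_at_eq V W (x : V) (f g : V -> W) :
  {near x, f =1 g} -> Cinf_at x f -> Cinf_at x g.
Proof.
move=> fg; move: (fg : nbhs x [set y | f y = g y]); rewrite nbhsE.
move=> -[B [oB Bx] {}fg] [U [oU Ux] Uf].
exists (B `&` U); first by split; [exact: openI|].
move=> k; apply: (@Ck_eq _ _ _ _ _ f); first exact: openI.
  by move=> y [/fg].
by apply: CkS (Uf k) => y [].
Qed.

Lemma Cinf_at_ext V W (x : V) (f g : V -> W) :
  (forall y, f y = g y) -> Cinf_at x f -> Cinf_at x g.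
Proof. by move=> /funext ->. Qed.

Lemma Cinf_at_diff V W (x : V) (f : V -> W) : Cinf_at x f -> differentiable f x.
Proof. by move=> [U [_ Ux] Uf]; have [df _] := Uf 1%N; exact: df. Qed.

Lemma Cinf_at_derivable V W (x v : V) (f : V -> W) :
  Cinf_at x f -> derivable f x v.
Proof. by move=> /Cinf_at_diff/diff_derivable. Qed.

Lemma Cinf_at_continuous V W (x : V) (f : V -> W) :
  Cinf_at x f -> {for x, continuous f}.
Proof. by move=> /Cinf_at_diff/differentiable_continuous. Qed.

Lemma Cinf_at_derive V W (x v : V) (f : V -> W) :
  Cinf_at x f -> Cinf_at x ('D_v f).
Proof. by move=> [U Ux Uf]; exists U => // k; have [_] := Uf k.+1; exact. Qed.

Lemma Cinf_at_cst V W (x : V) (a : W) : Cinf_at x (fun _ : V => a).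
Proof. by exists setT => [|k]; [split=> //; exact: openT|exact: Ck_cst]. Qed.

Lemma Cinf_at_id V (x : V) : Cinf_at x id.
Proof.
exists setT => [|k]; first by split=> //; exact: openT.
case: k => [|k]; first by move=> y _; exact: cvg_id.
split=> [y _|v]; first exact: (ex_diff (df := id)).
by have -> : 'D_v id = fun=> v; [apply/funext => y; exact: derive_id|exact: Ck_cst].
Qed.

Lemma findim_R : findim R^o.
Proof.
exists 1%N, (fun=> 1), (fun=> @idfun R^o); split=> [i|v]; first by move=> x; exact: cvg_id.
by rewrite big_ord1 /= /GRing.scale/= mulr1.
Qed.

Lemma Cinf_at_comp V W Z (x : V) (f : W -> Z) (g : V -> W) :
  findim W -> Cinf_at (g x) f -> Cinf_at x g -> Cinf_at x (f \o g).
Proof.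
move=> fdW [U' [oU' U'x] U'f] [U [oU Ux] Ug].
have oUg : open (U `&` g @^-1` U').
  rewrite openE => y [Uy U'gy]; apply: filterI; first exact: open_nbhs_nbhs.
  have cg : {for y, continuous g} by exact: (Ug 0%N).
  by apply: cg; exact: open_nbhs_nbhs.
exists (U `&` g @^-1` U') => // k.
by apply: (Ck_comp fdW oUg oU' _ (U'f k)) => [y []//|]; apply: CkS (Ug k) => y [].
Qed.

Lemma Cinf_at_compR V W (x : V) (f : R^o -> W) (g : V -> R^o) :
  Cinf_at (g x) f -> Cinf_at x g -> Cinf_at x (fun y => f (g y)).
Proof. exact: (Cinf_at_comp findim_R). Qed.

Lemma Cinf_at2 V W W1 W2 (x : V) (f : V -> W1) (g : V -> W2) (h : V -> W) :
  (forall k U, open U -> Ck k U f -> Ck k U g -> Ck k U h) ->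
  Cinf_at x f -> Cinf_at x g -> Cinf_at x h.
Proof.
move=> H [U [oU Ux] Uf] [U' [oU' U'x] U'g].
exists (U `&` U'); first by split; [exact: openI|].
move=> k; apply: H; first exact: openI.
  by apply: CkS (Uf k) => y [].
by apply: CkS (U'g k) => y [].
Qed.

Lemma Cinf_atD V W (x : V) (f g : V -> W) :
  Cinf_at x f -> Cinf_at x g -> Cinf_at x (fun y => f y + g y).
Proof. by apply: Cinf_at2 => k U; exact: CkD. Qed.

Lemma Cinf_atM V (x : V) (f g : V -> R^o) :
  Cinf_at x f -> Cinf_at x g -> Cinf_at x (fun y => f y * g y : R^o).
Proof. by apply: Cinf_at2 => k U; exact: CkM. Qed.

Lemma Cinf_atZ V W (x : V) (a : R) (f : V -> W) :
  Cinf_at x f -> Cinf_at x (fun y => a *: f y).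
Proof.
by move=> Cf; apply: (Cinf_at2 _ Cf Cf) => k U oU Uf _; exact: CkZ.
Qed.

Lemma Cinf_atN V W (x : V) (f : V -> W) :
  Cinf_at x f -> Cinf_at x (fun y => - f y).
Proof.
move=> /(Cinf_atZ (-1)); apply: Cinf_at_eq.
by apply: nearW => y; rewrite scaleN1r.
Qed.

Lemma Cinf_atB V W (x : V) (f g : V -> W) :
  Cinf_at x f -> Cinf_at x g -> Cinf_at x (fun y => f y - g y).
Proof. by move=> Cf Cg; apply: Cinf_atD => //; exact: Cinf_atN. Qed.

Lemma Cinf_at_scale V W (x : V) (f : V -> R^o) (w : W) :
  Cinf_at x f -> Cinf_at x (fun y => f y *: w).
Proof.
by move=> Cf; apply: (Cinf_at2 _ Cf Cf) => k U oU Uf _; exact: Ck_scale.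
Qed.

Lemma Cinf_at_pair V W Z (x : V) (f : V -> W) (g : V -> Z) :
  Cinf_at x f -> Cinf_at x g -> Cinf_at x (fun y => (f y, g y)).
Proof. by apply: Cinf_at2 => k U; exact: Ck_pair. Qed.

Lemma Cinf_at_sum V W (x : V) (I : Type) (r : seq I) (F : I -> V -> W) :
  (forall i, Cinf_at x (F i)) -> Cinf_at x (fun y => \sum_(i <- r) F i y).
Proof.
move=> CF; elim: r => [|i r IH].
  by apply: Cinf_at_eq (Cinf_at_cst x 0); apply: nearW => y; rewrite big_nil.
apply: Cinf_at_eq (Cinf_atD (CF i) IH).
by apply: nearW => y; rewrite big_cons.
Qed.

Lemma Cinf_at_prod V (x : V) (I : Type) (r : seq I) (F : I -> V -> R^o) :
  (forall i, Cinf_at x (F i)) ->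
  Cinf_at x (fun y => \prod_(i <- r) F i y : R^o).
Proof.
move=> CF; elim: r => [|i r IH].
  by apply: Cinf_at_eq (Cinf_at_cst x (1 : R^o)); apply: nearW => y; rewrite big_nil.
apply: Cinf_at_eq (Cinf_atM (CF i) IH).
by apply: nearW => y; rewrite big_cons.
Qed.

Lemma Cinf_at_inv V (x : V) (f : V -> R^o) :
  f x != 0 -> Cinf_at x f -> Cinf_at x (fun y => (f y)^-1 : R^o).
Proof.
move=> fx0 [U [oU Ux] Uf].
have oU' : open (U `&` [set y | f y != 0]).
  rewrite openE => y [Uy fy0]; apply: filterI; first exact: open_nbhs_nbhs.
  have cf : {for y, continuous f} by exact: (Uf 0%N).
  apply: (cf [set t : R^o | t != 0]); apply: open_nbhs_nbhs; split => //.
exists (U `&` [set y | f y != 0]) => // k.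
by apply: Ck_inv => // [y []//|]; apply: CkS (Uf k) => y [].
Qed.

Lemma linear_pack V W (f : V -> W) : linear f ->
  exists l : {linear V -> W}, (l : V -> W) = f.
Proof.
move=> lf.
pose l : {linear V -> W} := HB.pack f (GRing.isLinear.Build _ _ _ _ _ lf).
by exists l.
Qed.

Lemma Cinf_at_linear V W (x : V) (f : V -> W) :
  linear f -> continuous f -> Cinf_at x f.
Proof.
move=> /linear_pack[l <-] cl; have [U [oU Ux] Uf] := Cinf_at_id x.
by exists U => // k; exact: (Ck_linear_comp (l := l) oU cl (Uf k)).
Qed.

Lemma derive_linear V W (x v : V) (f : V -> W) :
  linear f -> continuous f -> 'D_v f x = f v.
Proof.
move=> /linear_pack[l <-] cl.
by rewrite deriveE ?(diff_lin _ cl)//; exact: linear_differentiable.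
Qed.

Lemma findimE V W (f : V -> W) : findim V -> linear f -> continuous f.
Proof.
move=> [m [b [l [cl lE]]]] /linear_pack[g <-].
have -> : (g : V -> W) = fun x => \sum_i l i x *: g (b i).
  by apply/funext => x; rewrite {1}(lE x) linear_sum; apply: eq_bigr => i _; rewrite linearZ.
move=> x; apply: Cinf_at_continuous; apply: Cinf_at_sum => i.
apply: Cinf_at_scale; apply: Cinf_at_linear; last exact: cl.
by move=> a u v; rewrite linearP.
Qed.

Lemma coord_linear m n i j : linear (fun M : 'M[R]_(m, n) => M i j : R^o).
Proof. by move=> a u v; rewrite !mxE. Qed.

Lemma findim_rV n : findim 'rV[R]_n.
Proof.
exists n, (fun i => delta_mx 0 i).
pose l i : {linear 'rV[R]_n -> R^o} :=
  HB.pack (fun M : 'rV[R]_n => M 0 i : R^o) (GRing.isLinear.Build _ _ _ _ _ (coord_linear 0 i)).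
exists l; split=> [i|v]; first exact: coord_continuous.
by rewrite {1}(row_sum_delta v).
Qed.

Lemma findim_prod V W : findim V -> findim W -> findim (V * W)%type.
Proof.
move=> [m [b [l [cl lE]]]] [m' [b' [l' [cl' lE']]]].
pose B (i : 'I_(m + m')) : V * W :=
  match fintype.split i with inl j => (b j, 0) | inr j => (0, b' j) end.
pose L (i : 'I_(m + m')) (p : V * W) : R^o :=
  match fintype.split i with inl j => l j p.1 | inr j => l' j p.2 end.
have Ll i : linear (L i).
  by move=> a u v; rewrite /L; case: (fintype.split i) => j; rewrite /= linearP.
pose l0 i : {linear (V * W)%type -> R^o} :=
  HB.pack (L i) (GRing.isLinear.Build _ _ _ _ _ (Ll i)).
exists (m + m')%N, B, l0.
split=> [i p|[v w]] /=.
  rewrite /L; case: (fintype.split i) => j.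
    by apply: continuous_comp; [exact: cvg_fst|exact: cl].
  by apply: continuous_comp; [exact: cvg_snd|exact: cl'].
rewrite big_split_ord/= /L /B.
under eq_bigr do rewrite (unsplitK (inl _ : _ + _)) /=.
under [X in _ = _ + X]eq_bigr do rewrite (unsplitK (inr _ : _ + _)) /=.
rewrite {1}(lE v) {1}(lE' w).
have Ev (F : 'I_m -> V) : \sum_i (F i, 0 : W) = (\sum_i F i, 0).
  by elim/big_rec2 : _ => // i x y _ ->; rewrite /GRing.add/= /add_pair/= addr0.
have Ew (F : 'I_m' -> W) : \sum_i (0 : V, F i) = (0, \sum_i F i).
  by elim/big_rec2 : _ => // i x y _ ->; rewrite /GRing.add/= /add_pair/= addr0.
under [X in _ = X + _]eq_bigr => i _.
  rewrite (_ : _ *: _ = (l i v *: b i, 0)); last by rewrite /GRing.scale/= /scale_pair/= scaler0.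
  over.
under [X in _ = _ + X]eq_bigr => i _.
  rewrite (_ : _ *: _ = (0, l' i w *: b' i)); last by rewrite /GRing.scale/= /scale_pair/= scaler0.
  over.
by rewrite Ev Ew /GRing.add/= /add_pair/= addr0 add0r.
Qed.

Lemma Cinf_at_coord V m n (x : V) (f : V -> 'M[R]_(m, n)) i j :
  Cinf_at x f -> Cinf_at x (fun y => f y i j : R^o).
Proof.
move=> [U [oU Ux] Uf].
pose l : {linear 'M[R]_(m, n) -> R^o} :=
  HB.pack (fun M : 'M[R]_(m, n) => M i j : R^o)
    (GRing.isLinear.Build _ _ _ _ _ (coord_linear i j)).
exists U => // k; apply: (Ck_linear_comp (l := l) oU _ (Uf k)).
exact: coord_continuous.
Qed.

Lemma derive_coord V m n (x v : V) (f : V -> 'M[R]_(m, n)) i j :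
  Cinf_at x f -> 'D_v (fun y => f y i j : R^o) x = ('D_v f x) i j.
Proof. by move=> /Cinf_at_derivable/derive_mx->; rewrite mxE. Qed.

Lemma Cinf_at_row V n (x : V) (F : V -> 'rV[R]_n) :
  (forall i, Cinf_at x (fun y => F y 0 i : R^o)) -> Cinf_at x F.
Proof.
move=> CF; have -> : F = fun y => \sum_i F y 0 i *: delta_mx 0 i.
  by apply/funext => y; rewrite {1}(row_sum_delta (F y)).
by apply: Cinf_at_sum => i; exact: Cinf_at_scale.
Qed.

Lemma derive_comp V W Z (x v : V) (f : W -> Z) (g : V -> W) :
  Cinf_at (g x) f -> Cinf_at x g ->
  'D_v (f \o g) x = 'D_('D_v g x) f (g x).
Proof.
move=> /Cinf_at_diff df /Cinf_at_diff dg.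
by rewrite !deriveE//; [rewrite diff_comp|exact: differentiable_comp].
Qed.

Lemma derive_linearv V W (x : V) (f : V -> W) : Cinf_at x f ->
  linear (fun v => 'D_v f x).
Proof. by move=> /Cinf_at_diff df a u v; rewrite !deriveE// linearP. Qed.

Lemma derive_row_sum W n (x v : 'rV[R]_n) (f : 'rV[R]_n -> W) : Cinf_at x f ->
  'D_v f x = \sum_i v 0 i *: 'D_(delta_mx 0 i) f x.
Proof.
move=> /Cinf_at_diff df; rewrite deriveE// {1}(row_sum_delta v) linear_sum.
by apply: eq_bigr => i _; rewrite linearZ/= deriveE.
Qed.

End Cinf_theory.

(** * Inverse function theorem *)

Section inverse_function.
Context {R : realType}.
Implicit Types V W : normedModType R.

Lemma coord_le_norm m n (v : 'M[R]_(m, n)) i j : `|v i j| <= `|v|.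
Proof.
rewrite [leRHS]/Num.Def.normr/= mx_normrE.
by apply: le_trans (le_bigmax _ _ (i, j)).
Qed.

Lemma rV_norm_le n (v : 'rV[R]_n) (c : R) :
  0 <= c -> (forall i, `|v 0 i| <= c) -> `|v| <= c.
Proof.
move=> c0 vc; rewrite /Num.Def.normr/= mx_normrE.
by apply: bigmax_le => // -[i j] _ /=; rewrite ord1.
Qed.

Lemma nbhs_ballE V (x : V) (P : set V) : nbhs x P ->
  \forall d \near (0 : R)^'+, ball x d `<=` P.
Proof.
move=> /nbhs_ballP[e /= e0 eP]; near=> d.
apply: subset_trans eP; apply: le_ball; apply: ltW; near: d.
exact: nbhs_right_lt.
Unshelve. all: by end_near. Qed.

Lemma derive_near n W (x : 'rV[R]_n) (f : 'rV[R]_n -> W) (e : R) : 0 < e ->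
  Cinf_at x f ->
  \forall y \near x, forall v, `|'D_v f y - 'D_v f x| <= e * `|v|.
Proof.
(* The denominator [n.+1] exceeds the number [n] of coordinates and is nonzero even for [n = 0]. *)
move=> e0 Cf; have e'0 : 0 < e / n.+1%:R by rewrite divr_gt0.
have H : \forall y \near x, forall i : 'I_n,
    `|'D_(delta_mx 0 i) f y - 'D_(delta_mx 0 i) f x| <= e / n.+1%:R.
  pose P (i : 'I_n) (y : 'rV[R]_n) : Prop :=
    `|'D_(delta_mx 0 i) f y - 'D_(delta_mx 0 i) f x| <= e / n.+1%:R.
  apply: (@filter_forall _ _ P (nbhs x) _) => i; rewrite /P.
  have /Cinf_at_continuous/cvgrPdist_le/(_ _ e'0) := Cinf_at_derive (delta_mx 0 i) Cf.
  by apply: filterS => y; rewrite distrC.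
have CN := Cinf_at_near Cf.
near=> y => v.
have Cy : Cinf_at y f by near: y; exact: CN.
rewrite (derive_row_sum _ Cf) (derive_row_sum _ Cy) -sumrB.
apply: le_trans (ler_norm_sum _ _ _) _.
apply: (@le_trans _ _ (\sum_(i < n) `|v| * (e / n.+1%:R))).
  apply: ler_sum => i _; rewrite -scalerBr normrZ; apply: ler_pM => //.
    exact: coord_le_norm.
  by move: i; near: y.
rewrite sumr_const card_ord -mulrnAr mulrC ler_wpM2r//.
rewrite -mulr_natr -mulrA ler_piMr ?(ltW e0)// mulrC ler_pdivrMr//.
by rewrite mul1r ler_nat.
Unshelve. all: by end_near. Qed.

Lemma is_derive_line V W (x v : V) (t : R) (f : V -> W) :
  Cinf_at (x + t *: v) f ->
  is_derive (t : R^o) 1 (fun s : R^o => f (x + s *: v)) ('D_v f (x + t *: v)).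
Proof.
move=> Cf; pose g (s : R^o) : V := x + s *: v.
have Cg : Cinf_at (t : R^o) g.
  apply: Cinf_atD; first exact: Cinf_at_cst.
  by apply: Cinf_at_scale; exact: Cinf_at_id.
have Dg : 'D_1 g (t : R^o) = v.
  rewrite deriveD/=; [|exact/derivable_cst|]; last first.
    by apply: Cinf_at_derivable; apply: Cinf_at_scale; exact: Cinf_at_id.
  rewrite derive_cst add0r (@derive_linear _ _ _ _ _ ( *:%R ^~ v : R^o -> V)).
  - by rewrite scale1r.
  - by move=> a b c; rewrite scalerDl scalerA.
  - exact: scalel_continuous.
have dgt : differentiable g (t : R^o) by exact: Cinf_at_diff.
have dfg : differentiable f (g t) by exact: Cinf_at_diff.
have := derivableP (@diff_derivable _ _ _ _ _ (1 : R^o) (differentiable_comp dgt dfg)).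
by rewrite (@derive_comp _ _ _ _ _ _ f g Cf Cg) Dg.
Qed.

Lemma ball_segment V (x a b : V) (d t : R) : 0 <= t <= 1 ->
  ball x d a -> ball x d b -> ball x d (b + t *: (a - b)).
Proof.
move=> /andP[t0 t1]; rewrite -!ball_normE /= => xa xb.
have -> : x - (b + t *: (a - b)) = t *: (x - a) + (1 - t) *: (x - b).
  rewrite scalerBl scale1r addrCA -scalerBr opprB [x - a + _]addrC subrKA.
  by rewrite opprD addrA -scalerN opprB.
have [->|tn0] := eqVneq t 0; first by rewrite scale0r add0r subr0 scale1r.
apply: le_lt_trans (ler_normD _ _) _.
rewrite !normrZ !ger0_norm ?subr_ge0//.
have : t * `|x - a| < t * d by rewrite ltr_pM2l// lt_neqAle eq_sym tn0.
have : (1 - t) * `|x - b| <= (1 - t) * d by rewrite ler_wpM2l ?subr_ge0// ltW.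
by lra.
Qed.

Lemma near_right_ball V (x : V) (P : V -> Prop) : (\forall y \near x, P y) ->
  \forall d \near (0 : R)^'+, forall y, ball x d y -> P y.
Proof. exact: nbhs_ballE. Qed.

(** Strict differentiability: both end points vary. The mean value theorem on the segment from [b]
    to [a] reduces it to the continuity of the derivative, [derive_near]. *)
Lemma strict_derive n (x : 'rV[R]_n) (f : 'rV[R]_n -> R^o) (e : R) : 0 < e ->
  Cinf_at x f ->
  \forall d \near (0 : R)^'+, forall a b, ball x d a -> ball x d b ->
    `|f a - f b - 'D_(a - b) f x| <= e * `|a - b|.
Proof.
move=> e0 Cf; near=> d => a b da db.
have near_d t : 0 <= t <= 1 -> ball x d (b + t *: (a - b)).
  by move=> t01; exact: ball_segment.
have dC y : ball x d y -> Cinf_at y f.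
  by move: y; near: d; apply: near_right_ball; exact: Cinf_at_near.
have dD y : ball x d y -> forall v, `|'D_v f y - 'D_v f x| <= e * `|v|.
  by move: y; near: d; apply: near_right_ball; exact: derive_near.
pose g (s : R) := f (b + s *: (a - b)).
have g' (t : R) : 0 <= t <= 1 ->
    is_derive (t : R^o) 1 g ('D_(a - b) f (b + t *: (a - b))).
  by move=> t01; apply: is_derive_line; apply: dC; exact: near_d.
have [||c] := @MVT_segment R g (fun t => 'D_(a - b) f (b + t *: (a - b))) 0 1 ler01.
- by move=> t; rewrite in_itv/= => /andP[t0 t1]; apply: g'; rewrite !ltW.
- apply: derivable_within_continuous => t; rewrite in_itv/= => t01.
  by have [] := g' _ t01.
- rewrite in_itv/= subr0 mulr1 /g scale1r scale0r addr0 => c01.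
  rewrite addrCA subrr addr0 => ->.
  by apply: dD; exact: near_d.
Unshelve. all: by end_near. Qed.

Lemma strict_derive_rV m n (x : 'rV[R]_n) (f : 'rV[R]_n -> 'rV[R]_m) (e : R) :
  0 < e -> Cinf_at x f ->
  \forall d \near (0 : R)^'+, forall a b, ball x d a -> ball x d b ->
    `|f a - f b - 'D_(a - b) f x| <= e * `|a - b|.
Proof.
move=> e0 Cf.
pose P (i : 'I_m) (d : R) := forall a b, ball x d a -> ball x d b ->
    `|f a 0 i - f b 0 i - 'D_(a - b) (fun y => f y 0 i : R^o) x| <= e * `|a - b|.
have : \forall d \near (0 : R)^'+, forall i, P i d.
  apply: (@filter_forall _ _ P) => i.
  by apply: (@strict_derive n x (fun y => f y 0 i)) => //; exact: Cinf_at_coord.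
apply: filterS => d Pd a b da db; apply: rV_norm_le.
  by rewrite mulr_ge0// ltW.
move=> i; have := Pd i a b da db.
by rewrite (derive_coord _ _ _ Cf) !mxE.
Qed.

Lemma differentiable_by V W (f : V -> W) (x : V) (l : V -> W) :
  linear l -> continuous l ->
  (forall e : R, 0 < e -> \forall y \near (0 : V),
     `|f (y + x) - (f x + l y)| <= e * `|y|) ->
  differentiable f x /\ forall v, 'D_v f x = l v.
Proof.
move=> /linear_pack[{}l <-] cl H.
have E : f \o shift x = cst (f x) + l +o_ (0 : V) id.
  by apply/eqaddoP => e e0; exact: H.
have lE := diff_unique cl E.
have df : differentiable f x by apply/diff_locallyP; rewrite lE.
by split=> // v; rewrite deriveE// lE.
Qed.

Lemma Cinf_at_det V n (x : V) (F : V -> 'M[R]_n) :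
  (forall i j, Cinf_at x (fun y => F y i j : R^o)) ->
  Cinf_at x (fun y => \det (F y) : R^o).
Proof.
move=> CF; rewrite /determinant; apply: Cinf_at_sum => s.
apply: Cinf_atM; first exact: Cinf_at_cst.
by apply: Cinf_at_prod => i; exact: CF.
Qed.

Lemma Cinf_at_invmx V n (x : V) (F : V -> 'M[R]_n) i j :
  F x \in unitmx -> (forall i j, Cinf_at x (fun y => F y i j : R^o)) ->
  Cinf_at x (fun y => invmx (F y) i j : R^o).
Proof.
move=> Fx CF; have Cd := Cinf_at_det CF.
have d0 : \det (F x) != 0 by rewrite -unitfE -unitmxE.
apply: (@Cinf_at_eq _ _ _ _
    (fun y => (\det (F y))^-1 * ((-1) ^+ (j + i) * \det (row' j (col' i (F y)))))).
  have : \forall y \near x, \det (F y) != 0.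
    have /Cinf_at_continuous := Cd; rewrite /prop_for /continuous_at => cd.
    apply: (cd [set t : R^o | t != 0]); by apply: open_nbhs_nbhs.
  apply: filterS => y dy; rewrite /invmx unitmxE unitfE dy.
  by rewrite !mxE /cofactor.
apply: Cinf_atM; first exact: Cinf_at_inv.
apply: Cinf_atM; first exact: Cinf_at_cst.
apply: Cinf_at_det => k l.
apply: Cinf_at_eq (CF (lift j k) (lift i l)); apply: nearW => y.
by rewrite !mxE.
Qed.

Lemma compact_norm_ball n (x : 'rV[R]_n) (r : R) : 0 < r ->
  compact [set a | `|a - x| <= r].
Proof.
move=> r0; set A := [set a | _].
have AE : A = closed_ball x r.
  by rewrite closed_ballE//; apply/seteqP; split=> a; rewrite /A /closed_ball_/= distrC.
apply: bounded_closed_compact; last by rewrite AE; exact: closed_ball_closed.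
exists (`|x| + r); split; first exact: num_real.
move=> K Kr a Aa; apply/ltW; apply: le_lt_trans Kr.
rewrite -(subrK x a) addrC; apply: le_trans (ler_normD _ _) _.
by rewrite lerD2l.
Qed.

(* A minimum of |f - z| on a closed ball is a zero, since a - (f a - z) would
   do strictly better otherwise. *)
Lemma near_id_onto n (f : 'rV[R]_n -> 'rV[R]_n) (x z : 'rV[R]_n) (r : R) :
  0 < r -> (forall a, `|a - x| <= r -> {for a, continuous f}) ->
  (forall a b, `|a - x| <= r -> `|b - x| <= r ->
     `|f a - f b - (a - b)| <= 2^-1 * `|a - b|) ->
  5 * `|z - f x| < r -> exists2 a, `|a - x| <= 2 * `|z - f x| & f a = z.
Proof.
move=> r0 cf sf zr.
have dist2 a b : `|a - x| <= r -> `|b - x| <= r -> `|a - b| <= 2 * `|f a - f b|.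
  move=> ar br; have := sf _ _ ar br; rewrite distrC.
  have := lerB_dist (a - b) (f a - f b); lra.
pose A := [set a : 'rV[R]_n | `|a - x| <= r].
have cA : compact A by exact: compact_norm_ball.
have xA : A x by rewrite /A/= subrr normr0 ltW.
have [] := @EVT_min_rV R n (fun a => `|f a - z|) A _ cA.
- by exists x.
- apply: continuous_in_subspaceT => a; rewrite inE => Aa.
  apply: continuous_comp; last exact: norm_continuous.
  by apply: (@cvgB _ _ _ (nbhs a) _ f (cst z) (f a) z); [exact: cf|exact: cvg_cst].
- move=> a; rewrite inE => Aa amin.
  have ax := amin _ (mem_set xA).
  (* By minimality [f a] is no farther from [z] than [f x] is, and [dist2] doubles the resulting
     distance. This 4, plus the length at most [|z - f x|] of the step [f a - z], accounts for the 5
     of the hypothesis. *)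
  have a2 : `|a - x| <= 4 * `|z - f x|.
    apply: le_trans (dist2 _ _ Aa xA) _.
    have := ler_distD z (f a) (f x); rewrite (distrC (f x) z) in ax; lra.
  pose b := a - (f a - z).
  have ba : b - a = - (f a - z) by rewrite /b addrAC subrr add0r.
  have Ab : A b.
    rewrite /A/= -(subrKA a); apply: le_trans (ler_normD _ _) _.
    rewrite ba normrN; rewrite (distrC (f x) z) in ax; lra.
  have := amin _ (mem_set Ab).
  have -> : f b - z = f b - f a - (b - a).
    by rewrite ba opprK addrA subrK.
  have := sf _ _ Ab Aa; rewrite {2}ba normrN => h1 h2.
  have fa0 : `|f a - z| <= 0.
    by have := le_trans h2 h1; lra.
  have faz : f a = z by apply/eqP; rewrite -subr_eq0 -normr_le0.
  by exists a => //; rewrite -faz; exact: dist2.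
Qed.

Definition jac m n (f : 'rV[R]_m -> 'rV[R]_n) (y : 'rV[R]_m) : 'M[R]_(m, n) :=
  \matrix_(i, j) ('D_(delta_mx 0 i) f y) 0 j.

Lemma jacE m n (f : 'rV[R]_m -> 'rV[R]_n) (y v : 'rV[R]_m) :
  Cinf_at y f -> 'D_v f y = v *m jac f y.
Proof.
move=> Cf; rewrite (derive_row_sum _ Cf) mulmx_sum_row.
by apply: eq_bigr => i _; congr (_ *: _); apply/rowP => j; rewrite !mxE.
Qed.

Lemma Cinf_at_jac m n (f : 'rV[R]_m -> 'rV[R]_n) (y : 'rV[R]_m) i j :
  Cinf_at y f -> Cinf_at y (fun y => jac f y i j : R^o).
Proof.
move=> Cf; have := Cinf_at_coord 0 j (Cinf_at_derive (delta_mx 0 i) Cf).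
by apply: Cinf_at_ext => z; rewrite mxE.
Qed.

Lemma jac_comp l m n (f : 'rV[R]_m -> 'rV[R]_n) (g : 'rV[R]_l -> 'rV[R]_m) y :
  Cinf_at (g y) f -> Cinf_at y g -> jac (f \o g) y = jac g y *m jac f (g y).
Proof.
move=> Cf Cg; have Cfg := Cinf_at_comp (findim_rV m) Cf Cg.
apply/row_matrixP => i; rewrite !rowE mulmxA -!jacE//.
exact: derive_comp.
Qed.

Lemma jac_near m n (f g : 'rV[R]_m -> 'rV[R]_n) y :
  {near y, f =1 g} -> jac f y = jac g y.
Proof.
by move=> fg; apply/matrixP => i j; rewrite !mxE (near_eq_derive _ fg).
Qed.

Lemma jac_id n (y : 'rV[R]_n) : jac id y = 1%:M.
Proof.
apply/row_matrixP => i; rewrite !rowE mulmx1 -jacE ?derive_id//.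
exact: Cinf_at_id.
Qed.

Lemma derive0_cst n (f : 'rV[R]_n -> R^o) (x : 'rV[R]_n) (d : R) :
  (forall y, ball x d y -> Cinf_at y f /\ forall v, 'D_v f y = 0) ->
  forall a b, ball x d a -> ball x d b -> f a = f b.
Proof.
move=> H a b da db; pose g (s : R) := f (b + s *: (a - b)).
have nd t : 0 <= t <= 1 -> ball x d (b + t *: (a - b)).
  by move=> t01; exact: ball_segment.
have g' (t : R) : 0 <= t <= 1 -> is_derive (t : R^o) 1 g 0.
  move=> t01; have [C /(_ (a - b)) <-] := H _ (nd _ t01); exact: is_derive_line.
have [||c] := @MVT_segment R g (fun t => 0) 0 1 ler01.
- by move=> t; rewrite in_itv/= => /andP[t0 t1]; apply: g'; rewrite !ltW.
- apply: derivable_within_continuous => t; rewrite in_itv/= => t01.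
  by have [] := g' _ t01.
- rewrite in_itv/= mul0r /g scale1r scale0r addr0 => c01.
  by rewrite addrCA subrr addr0 => /eqP; rewrite subr_eq0 => /eqP.
Qed.

(** With [k] the increment of [h], the error [k - l y] equals [- l (y - k *m jac f a)]: the inverse
    derivative is applied to the error made by the derivative of [f], which strict differentiability
    controls. *)
Lemma inverse_derive n (f h : 'rV[R]_n -> 'rV[R]_n) (a z : 'rV[R]_n) :
  Cinf_at a f -> jac f a \in unitmx -> h z = a -> f a = z ->
  (\forall y \near z, f (h y) = y /\ `|h y - a| <= 2 * `|y - z|) ->
  differentiable h z /\ forall v, 'D_v h z = v *m invmx (jac f a).
Proof.
move=> Cf uJ hz fa H; pose l (v : 'rV[R]_n) := v *m invmx (jac f a).
have ll : linear l by move=> k u v; rewrite /l mulmxDl scalemxAl.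
have cl : continuous l by apply: findimE => //; exact: findim_rV.
apply: differentiable_by => // e e0.
have [L LE] := linear_pack ll.
have [K K0 HK] : exists2 K, K > 0 & forall x, `|l x| <= K * `|x|.
  by rewrite -LE; apply: linear_lipschitz; rewrite LE.
(* [K] compensates the norm of [l], and 2 the factor by which [h] may expand distances to [z]. *)
have e'0 : 0 < e / (2 * K) by rewrite divr_gt0// mulr_gt0.
have [d [d0 Hd]] : exists d : R, 0 < d /\ forall a1 b1, ball a d a1 -> ball a d b1 ->
    `|f a1 - f b1 - 'D_(a1 - b1) f a| <= e / (2 * K) * `|a1 - b1|.
  apply: (@filter_ex _ (0 : R)^'+); near=> d; split.
    by near: d; exact: nbhs_right_gt.
  by near: d; exact: strict_derive_rV.
have H0 := @shift_cvg0 _ _ z _ H.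
have d2 : \forall y \near (0 : 'rV[R]_n), `|y| < d / 2.
  have d20 : 0 < d / 2 by rewrite divr_gt0.
  have := @nbhsx_ballx _ _ (0 : 'rV[R]_n) (d / 2) d20.
  by rewrite -ball_normE; apply: filterS => y /=; rewrite sub0r normrN.
near=> y; rewrite hz.
have [fhy] : f (h (y + z)) = y + z /\ `|h (y + z) - a| <= 2 * `|y + z - z|.
  by near: y; exact: H0.
rewrite addrK => hya.
have yd : `|y| < d / 2 by near: y; exact: d2.
pose k := h (y + z) - a.
have hd : ball a d (h (y + z)).
  by rewrite -ball_normE /= distrC; apply: le_lt_trans hya _; lra.
have := Hd _ _ hd (ballxx _ d0); rewrite fhy fa addrK (jacE _ Cf).
rewrite -/k => Hk.
have -> : h (y + z) - (a + l y) = - l (y - k *m jac f a).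
  rewrite /l mulmxBl mulmxK// opprB opprD addrA -/(l y).
  by rewrite -/k.
rewrite normrN; apply: le_trans (HK _) _.
apply: (@le_trans _ _ (K * (e / (2 * K) * (2 * `|y|)))).
  rewrite ler_wpM2l ?(ltW K0)//; apply: le_trans Hk _.
  by rewrite ler_wpM2l ?(ltW e'0).
rewrite le_eqVlt; apply/orP; left; apply/eqP; field.
by rewrite gt_eqF.
Unshelve. all: by end_near. Qed.

(** The derivative at [x] is normalised to the identity, so that near [x] the difference between [f]
    and the identity is Lipschitz with constant 1/2. Then [f] shrinks distances by a factor at most
    2, which gives injectivity, and [near_id_onto] gives surjectivity. The applications reach the
    normal form by a choice of coordinates or by composing with an inverse matrix. *)
Lemma inverse_function n (f : 'rV[R]_n -> 'rV[R]_n) (x : 'rV[R]_n)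
    (N : set 'rV[R]_n) :
  nbhs x N -> Cinf_at x f -> (forall v, 'D_v f x = v) ->
  exists U h, [/\ open_nbhs x U, U `<=` N, open (f @` U),
    forall a, U a -> [/\ h (f a) = a, Cinf_at a f & jac f a \in unitmx] &
    forall z, (f @` U) z -> Cinf_at z h].
Proof.
move=> Nx Cf Df.
have [d [d0 [dN dC dS dD]]] : exists d : R, 0 < d /\ [/\ ball x d `<=` N,
    forall y, ball x d y -> Cinf_at y f,
    forall a b, ball x d a -> ball x d b ->
      `|f a - f b - 'D_(a - b) f x| <= 2^-1 * `|a - b| &
    forall y, ball x d y -> forall v, `|'D_v f y - 'D_v f x| <= 2^-1 * `|v| ].
  have h0 : 0 < 2^-1 :> R by [].
  have N1 := near_right_ball (Cinf_at_near Cf).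
  have N2 := near_right_ball (derive_near h0 Cf).
  have N3 := strict_derive_rV h0 Cf.
  have N4 := nbhs_ballE Nx.
  apply: (@filter_ex _ (0 : R)^'+); near=> d; split.
    by near: d; exact: nbhs_right_gt.
  by split; near: d.
pose r := d / 2; have r0 : 0 < r by rewrite divr_gt0.
have rd a : `|a - x| <= r -> ball x d a.
  by rewrite -ball_normE /= distrC /r => ar; lra.
have sf a b : `|a - x| <= r -> `|b - x| <= r ->
    `|f a - f b - (a - b)| <= 2^-1 * `|a - b|.
  by move=> /rd ar /rd br; have := dS _ _ ar br; rewrite Df.
have dist2 a b : `|a - x| <= r -> `|b - x| <= r -> `|a - b| <= 2 * `|f a - f b|.
  move=> ar br; have := sf _ _ ar br; rewrite distrC.
  have := lerB_dist (a - b) (f a - f b); lra.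
have cf a : `|a - x| <= r -> {for a, continuous f}.
  by move=> /rd/dC/Cinf_at_continuous.
(* For targets in this ball [near_id_onto] finds preimages; cutting [U] down to the preimage of [B]
   makes its image exactly the open set [B]. *)
pose B := ball (f x) (r / 5).
pose U := ball x r `&` f @^-1` B.
have Ur a : U a -> `|a - x| <= r.
  by rewrite /U -!ball_normE /= distrC => -[/ltW].
pose h z := get [set a | U a /\ f a = z].
have hP z : B z -> U (h z) /\ f (h z) = z.
  move=> Bz; have := Bz; rewrite /B -ball_normE /= distrC => zr.
  have [] := @near_id_onto n f x z r r0 cf sf; first by lra.
  move=> a ax faz; apply: (@getPex _ [set a | U a /\ f a = z]); exists a.
  split => //; split; last by rewrite /= faz.
  by rewrite -ball_normE /= distrC; apply: le_lt_trans ax _; lra.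
have hK a : U a -> h (f a) = a.
  move=> Ua; have [Uh fh] := hP _ Ua.2.
  apply/eqP; rewrite -subr_eq0 -normr_le0.
  by have := dist2 _ _ (Ur _ Uh) (Ur _ Ua); rewrite fh subrr normr0 mulr0.
have fU : f @` U = B.
  apply/seteqP; split=> [_ [a [_ Ba] <-]//|z Bz].
  by have [Uh fh] := hP _ Bz; exists (h z).
have oB : open B by exact: ball_open.
have oU : open U.
  rewrite openE => a Ua; apply: filterI.
    by apply: open_nbhs_nbhs; split; [exact: ball_open|exact: Ua.1].
  by apply: (cf a (Ur _ Ua)); apply: open_nbhs_nbhs; split => //; exact: Ua.2.
have uJ a : U a -> jac f a \in unitmx.
  move=> Ua; have ad := rd _ (Ur _ Ua).
  rewrite -row_free_unit -kermx_eq0; apply/rowV0P => v.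
  rewrite sub_kermx => /eqP vJ; have := dD _ ad v.
  rewrite (jacE _ (dC _ ad)) vJ Df sub0r normrN => vv.
  by apply/eqP; rewrite -normr_le0; lra.
have Dh z : B z -> differentiable h z /\ forall v, 'D_v h z = v *m invmx (jac f (h z)).
  move=> Bz; have [Uh fh] := hP _ Bz; apply: inverse_derive => //.
  - exact/dC/rd/Ur.
  - exact: uJ.
  - have := open_nbhs_nbhs (conj oB Bz : open_nbhs z B); apply: filterS => y By.
    have [Uy fy] := hP _ By; split=> //.
    by rewrite -{2}fy -{2}fh; apply: dist2; exact: Ur.
exists U, h; split => //.
- by split=> //; split; [exact: ballxx|apply: ballxx; rewrite divr_gt0].
- by move=> a Ua; exact/dN/rd/Ur.
- by rewrite fU.
- by move=> a Ua; split; [exact: hK|exact/dC/rd/Ur|exact: uJ].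
- rewrite fU => z Bz; exists B => // k.
  (* Bootstrap: ['D_v h] is [G \o h] with [G] smooth, so if [h] is of class C^k, so are its
     derivatives. *)
  elim: k => [|k IH]; first by move=> y /Dh[/differentiable_continuous].
  split=> [y /Dh[]//|v].
  pose G a := v *m invmx (jac f a).
  have CG : Ck k U G.
    apply: (Cinf_atP _ oU).2 => a Ua; apply: Cinf_at_row => j.
    apply: (@Cinf_at_ext _ _ _ _ (fun y => \sum_i v 0 i * invmx (jac f y) i j)).
      by move=> y; rewrite mxE.
    apply: Cinf_at_sum => i; apply: Cinf_atM; first exact: Cinf_at_cst.
    apply: Cinf_at_invmx; first exact: uJ.
    by move=> i' j'; apply: Cinf_at_jac; exact/dC/rd/Ur.
  have := Ck_comp (findim_rV n) oB oU (fun z Bz => (hP z Bz).1) CG IH.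
  by apply: Ck_eq => // y By; rewrite (Dh _ By).2.
Unshelve. all: by end_near. Qed.

(** The second difference is the increment of [p] between 0 and [h]. The mean value theorem turns it
    into a difference of ['D_u f] at two points [h *: v] apart, where strict differentiability of
    ['D_u f] applies. As the second difference is symmetric in [u] and [v], Schwarz's theorem
    follows. *)
Lemma mixed_difference n (f : 'rV[R]_n -> R^o) (x u v : 'rV[R]_n) (e : R) :
  0 < e -> Cinf_at x f ->
  \forall h \near (0 : R)^'+,
    `|f (x + h *: u + h *: v) - f (x + h *: u) - (f (x + h *: v) - f x)
      - h ^+ 2 * 'D_v ('D_u f) x| <= e * h ^+ 2 * `|v|.
Proof.
move=> e0 Cf; have CF := Cinf_at_derive u Cf.
have [d [d0 dC dS]] : exists d : R, [/\ 0 < d,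
    forall y, ball x d y -> Cinf_at y f &
    forall a b, ball x d a -> ball x d b ->
      `|'D_u f a - 'D_u f b - 'D_(a - b) ('D_u f) x| <= e * `|a - b| ].
  have N1 := near_right_ball (Cinf_at_near Cf).
  have N2 := strict_derive e0 CF.
  apply: (@filter_ex _ (0 : R)^'+); near=> d; split; try by near: d.
  by near: d; exact: nbhs_right_gt.
have uv0 : 0 < `|u| + `|v| + 1 by rewrite ltr_wpDl// addr_ge0.
near=> h.
have h0 : 0 < h by near: h; exact: nbhs_right_gt.
have hd : h * (`|u| + `|v| + 1) < d.
  rewrite -ltr_pdivlMr//; near: h; apply: nbhs_right_lt.
  by rewrite divr_gt0.
have small s t : 0 <= s <= h -> 0 <= t <= h -> ball x d (x + s *: u + t *: v).
  move=> /andP[s0 sh] /andP[t0 th]; rewrite -ball_normE /=.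
  rewrite -addrA opprD addrA subrr sub0r normrN.
  apply: le_lt_trans hd; apply: le_trans (ler_normD _ _) _.
  rewrite !normrZ !ger0_norm// !mulrDr mulr1.
  have : s * `|u| <= h * `|u| by rewrite ler_wpM2r.
  have : t * `|v| <= h * `|v| by rewrite ler_wpM2r.
  by lra.
pose p (s : R) : R := f (x + h *: v + s *: u) - f (x + s *: u).
pose p' (s : R) : R := 'D_u f (x + h *: v + s *: u) - 'D_u f (x + s *: u).
have Dp (s : R) : 0 <= s <= h -> is_derive (s : R^o) 1 (p : R^o -> R^o) (p' s).
  move=> s0h; apply: is_deriveB; apply: is_derive_line; apply: dC.
    by rewrite addrAC; apply: small; rewrite ?lexx ?(ltW h0).
  have := small s 0; rewrite scale0r addr0; apply => //.
  by rewrite lexx ltW.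
have [||c] := @MVT_segment R p p' 0 h (ltW h0).
- by move=> t; rewrite in_itv/= => /andP[t0 t1]; apply: Dp; rewrite !ltW.
- apply: derivable_within_continuous => t; rewrite in_itv/= => t01.
  by have [] := Dp _ t01.
- rewrite in_itv/= subr0 {1 2}/p !scale0r !addr0 => c0h E.
  rewrite (addrAC x) E.
  have b1 : ball x d (x + h *: v + c *: u).
    by rewrite addrAC; apply: small; rewrite ?lexx ?(ltW h0).
  have b2 : ball x d (x + c *: u).
    have := small c 0; rewrite scale0r addr0; apply => //.
    by rewrite lexx ltW.
  have := dS _ _ b1 b2.
  have -> : x + h *: v + c *: u - (x + c *: u) = h *: v.
    by apply/rowP => i; rewrite !mxE; ring.
  have -> : 'D_(h *: v) ('D_u f) x = h * 'D_v ('D_u f) x.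
    have := derive_linearv CF h v 0; rewrite !addr0 derive0 addr0; exact.
  rewrite -/(p' c) normrZ gtr0_norm// => H.
  have -> : p' c * h - h ^+ 2 * 'D_v ('D_u f) x =
            h * (p' c - h * 'D_v ('D_u f) x) by ring.
  rewrite normrM gtr0_norm//.
  have -> : e * h ^+ 2 * `|v| = h * (e * (h * `|v|)) by ring.
  by rewrite ler_pM2l.
Unshelve. all: by end_near. Qed.

Lemma schwarz_rV n (f : 'rV[R]_n -> R^o) (x u v : 'rV[R]_n) :
  Cinf_at x f -> 'D_v ('D_u f) x = 'D_u ('D_v f) x.
Proof.
move=> Cf; apply/eqP; rewrite -subr_eq0 -normr_le0; apply/ler_addgt0Pr => e e0; rewrite add0r.
have uv0 : 0 < `|u| + `|v| + 1 by rewrite ltr_wpDl// addr_ge0.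
have e'0 : 0 < e / (`|u| + `|v| + 1) by rewrite divr_gt0.
have [h [h0 H1 H2]] : exists h : R, [/\ 0 < h,
    `|f (x + h *: u + h *: v) - f (x + h *: u) - (f (x + h *: v) - f x)
      - h ^+ 2 * 'D_v ('D_u f) x| <= e / (`|u| + `|v| + 1) * h ^+ 2 * `|v| &
    `|f (x + h *: v + h *: u) - f (x + h *: v) - (f (x + h *: u) - f x)
      - h ^+ 2 * 'D_u ('D_v f) x| <= e / (`|u| + `|v| + 1) * h ^+ 2 * `|u| ].
  have N1 := mixed_difference u v e'0 Cf.
  have N2 := mixed_difference v u e'0 Cf.
  apply: (@filter_ex _ (0 : R)^'+); near=> h; split; try by near: h.
  by near: h; exact: nbhs_right_gt.
rewrite -(ler_pM2l (exprn_gt0 2 h0)).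
rewrite -[leLHS](ger0_norm (mulr_ge0 (ltW (exprn_gt0 2 h0)) (normr_ge0 _))).
rewrite normrM normr_id -normrM.
set A := 'D_v ('D_u f) x in H1 *; set B := 'D_u ('D_v f) x in H2 *.
rewrite (addrAC x (h *: v)) in H2.
set D := f (x + h *: u + h *: v) in H1 H2.
set P := f (x + h *: u) in H1 H2; set Q := f (x + h *: v) in H1 H2.
have -> : h ^+ 2 * (A - B) = (D - Q - (P - f x) - h ^+ 2 * B) - (D - P - (Q - f x) - h ^+ 2 * A).
  by ring.
apply: le_trans (ler_normB _ _) _; apply: le_trans (lerD H2 H1) _.
rewrite -mulrDr [e / _ * _]mulrC -mulrA ler_pM2l ?exprn_gt0//.
by rewrite mulrAC ler_pdivrMr// ler_wpM2l ?(ltW e0)// lerDl.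
Unshelve. all: by end_near. Qed.

(** Only the plane of [u] and [v] matters: [f] is pulled back along the affine map [g] from
    ['rV_2]. *)
Lemma schwarz V (f : V -> R^o) (x u v : V) :
  findim V -> Cinf_at x f -> 'D_v ('D_u f) x = 'D_u ('D_v f) x.
Proof.
move=> fdV Cf; pose i0 : 'I_2 := 0; pose i1 : 'I_2 := 1.
pose l (y : 'rV[R]_2) : V := y 0 i0 *: u + y 0 i1 *: v.
have ll : linear l.
  move=> a y z; rewrite /l !mxE !scalerDl !scalerDr !scalerA.
  by rewrite addrACA.
have cl : continuous l by apply: findimE => //; exact: findim_rV.
pose g y := x + l y.
have Cg y : Cinf_at y g.
  by apply: Cinf_atD; [exact: Cinf_at_cst|exact: Cinf_at_linear].
have Dg w y : 'D_w g y = l w.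
  rewrite deriveD; [|exact/derivable_cst|exact/Cinf_at_derivable/Cinf_at_linear].
  by rewrite derive_cst add0r derive_linear.
have g0 : g 0 = x by rewrite /g /l !mxE !scale0r !addr0.
have C0 : Cinf_at (g 0) f by rewrite g0.
have DD (w w' : 'rV[R]_2) : 'D_w ('D_w' (f \o g)) 0 = 'D_(l w) ('D_(l w') f) x.
  have CD := Cinf_at_derive (l w') C0.
  have -> : 'D_w ('D_w' (f \o g)) 0 = 'D_w ('D_(l w') f \o g) 0.
    apply: near_eq_derive.
    have cg := Cinf_at_continuous (Cg 0).
    have : \forall y \near (0 : 'rV[R]_2), Cinf_at (g y) f.
      exact: (cg [set z | Cinf_at z f] (Cinf_at_near C0)).
    by apply: filterS => y Cy; rewrite (derive_comp _ Cy (Cg y)) Dg.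
  by rewrite (derive_comp _ CD (Cg 0)) Dg g0.
have lu : l (delta_mx 0 i0) = u by rewrite /l !mxE /= scale1r scale0r addr0.
have lv : l (delta_mx 0 i1) = v by rewrite /l !mxE /= scale1r scale0r add0r.
rewrite -lu -lv -!DD; apply: schwarz_rV.
by apply: Cinf_at_comp.
Qed.

End inverse_function.

(** * Bump functions and Hadamard's lemma *)

Section bump.
Context {R : realType}.

(** Each monomial is dominated by a term of the exponential series, that of degree [i.+1], which for
    [s > 1] is larger than the one of degree [i]. *)
Lemma poly_expR_bounded (p : {poly R}) :
  exists2 C : R, 0 <= C & forall s : R, 0 <= s -> `|p.[s]| * expR (- s) <= C.
Proof.
exists (\sum_(i < size p) `|p`_i| * (i.+1)`!%:R * 2).
  by apply: sumr_ge0 => i _; rewrite !mulr_ge0.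
move=> s s0; rewrite horner_coef.
apply: (@le_trans _ _ ((\sum_(i < size p) `|p`_i * s ^+ i|) * expR (- s))).
  by rewrite ler_wpM2r ?expR_ge0// ler_norm_sum.
rewrite mulr_suml; apply: ler_sum => i _.
rewrite normrM -!mulrA ler_wpM2l// ger0_norm ?exprn_ge0//.
rewrite expRN ler_pdivrMr ?expR_gt0//.
have e1 : 1 <= expR s.
  by apply: le_trans (expR_ge1Dx s); rewrite lerDl.
have e2 := expR_ge1Dxn i s0.
have f1 : 1 <= (i.+1)`!%:R :> R by rewrite ler1n fact_gt0.
have f0 : 0 < (i.+1)`!%:R :> R by apply: lt_le_trans f1.
have [s1|s1] := leP s 1.
  apply: (@le_trans _ _ 1); first by rewrite exprn_ile1.
  by rewrite -[leLHS]mulr1; apply: ler_pM => //; lra.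
apply: (@le_trans _ _ (s ^+ i.+1)); first by rewrite exprS ler_peMl ?exprn_ge0// ltW.
have : s ^+ i.+1 / (i.+1)`!%:R <= expR s by apply: le_trans e2; rewrite lerDr.
rewrite ler_pdivrMr// => /le_trans; apply.
rewrite mulrC -mulrA ler_wpM2l ?(ltW f0)// ler_peMl ?expR_ge0//; lra.
Qed.

Lemma is_derive_compR (f g : R -> R) (t df dg : R) :
  is_derive t 1 f df -> is_derive (f t) 1 g dg -> is_derive t 1 (g \o f) (dg * df).
Proof.
move=> [f1 <-] [g1 <-]; apply: DeriveDef.
  by apply/derivable1_diffP/differentiable_comp; exact/derivable1_diffP.
by rewrite -!derive1E derive1_comp.
Qed.

(** The functions p(1/t) exp(-1/t) form a family stable under differentiation, [p] becoming X^2 (p -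
    p'). Hence one computation of a first derivative, for all [p] at once, proves smoothness;
    [p = 1] is the classical flat function. *)
Definition pexp (p : {poly R}) (t : R^o) : R^o :=
  if 0 < t then p.[t^-1] * expR (- t^-1) else 0.

Lemma pexp_derive (p : {poly R}) (t : R^o) :
  differentiable (pexp p) t /\
  forall v, 'D_v (pexp p) t = v *: pexp ('X^2 * (p - p^`())) t.
Proof.
suff [h1 h2] : differentiable (pexp p) t /\ 'D_1 (pexp p) t = pexp ('X^2 * (p - p^`())) t.
  split=> // v; rewrite -h2 !deriveE// -{1}[v]mulr1.
  by rewrite -[v * 1]/(v *: (1 : R^o)) linearZ.
have [t0|t0|t0] := ltgtP t 0.
- have nz : \forall s \near t, (cst 0 : R^o -> R^o) s = pexp p s.
    near=> s; rewrite /pexp ltNge.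
    suff -> : s <= 0 by [].
    by apply: ltW; near: s; exact: lt_nbhsl.
  split; first by apply: near_differentiable nz _; exact: differentiable_cst.
  by rewrite -(near_eq_derive _ nz) derive_cst /pexp ltNge ltW.
- pose g (s : R) : R := p.[s^-1] * expR (- s^-1).
  have nz : \forall s \near t, (g : R^o -> R^o) s = pexp p s.
    near=> s; rewrite /pexp /g.
    suff -> : 0 < s by [].
    by near: s; exact: lt_nbhsr.
  have tn0 : t != 0 by rewrite gt_eqF.
  have di : is_derive t 1 (fun s : R => s^-1) (- t ^- 2 *: 1 : R).
    by apply: is_deriveV => //; exact: is_derive_id.
  have E2 : (- t ^- 2 *: 1 : R) = - (t^-1 ^+ 2).
    by rewrite -[LHS]/(- t ^- 2 * 1) mulr1 exprVn.
  rewrite E2 in di.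
  have dg : is_derive t 1 g (('X^2 * (p - p^`())).[t^-1] * expR (- t^-1)).
    have d1 := is_derive_compR di (is_derive_poly p t^-1).
    have d2 := is_derive_compR (is_deriveN di) (is_derive_expR (- t^-1)).
    apply: (is_derive_eq (is_deriveM d1 d2)).
    rewrite /= hornerM hornerXn hornerD hornerN.
    rewrite -![_ *: _]/(_ * _) /=; ring.
  have [dg1 dg2] := dg.
  split; first by apply: near_differentiable nz _; exact/derivable1_diffP.
  by rewrite -(near_eq_derive _ nz) dg2 /pexp t0.
(* For [y > 0] the bound for ['X^2 * p] at [y^-1] says that [pexp p y] is at most [C * y ^+ 2] in
   absolute value, whence a zero derivative at 0. *)
- have [C C0 HC] := poly_expR_bounded ('X^2 * p).
  have l0 : linear (fun _ : R^o => 0 : R^o) by move=> a u v; rewrite scaler0 addr0.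
  have c0 : continuous (fun _ : R^o => 0 : R^o) by move=> ?; exact: cvg_cst.
  have [e e0|d D] := @differentiable_by R R^o R^o (pexp p) t _ l0 c0.
    rewrite t0; near=> y; rewrite addr0 {2}/pexp ltxx !addr0 subr0.
    rewrite /pexp; case: ltP => y0; last by rewrite normr0 mulr_ge0// ltW.
    have := HC y^-1; rewrite invr_ge0 (ltW y0) => /(_ isT).
    rewrite hornerM hornerXn !normrM !(ger0_norm (expR_ge0 _)).
    rewrite ger0_norm ?exprn_ge0 ?invr_ge0 ?(ltW y0)// => H.
    have : `|p.[y^-1]| * expR (- y^-1) <= C * y ^+ 2.
      by rewrite -ler_pdivrMr ?exprn_gt0// mulrC mulrA -exprVn.
    move=> /le_trans; apply; rewrite gtr0_norm// expr2 mulrA ler_wpM2r ?(ltW y0)//.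
    apply: (@le_trans _ _ ((C + 1) * y)); first by rewrite ler_wpM2r ?(ltW y0)// lerDl.
    rewrite mulrC -ler_pdivlMr ?ltr_wpDl//.
    rewrite -[y]gtr0_norm//; near: y.
    have ee : 0 < e / (C + 1) by rewrite divr_gt0// ltr_wpDl.
    have := @nbhsx_ballx _ _ (0 : R^o) _ ee; rewrite -ball_normE.
    by apply: filterS => y /=; rewrite sub0r normrN => /ltW.
  by split=> //; rewrite D /pexp t0 ltxx.
Unshelve. all: by end_near. Qed.

Lemma Cinf_pexp p (t : R^o) : Cinf_at t (pexp p).
Proof.
exists setT; first by split=> //; exact: openT.
move=> k; elim: k p => [|k IH] p.
  by move=> x _; apply: differentiable_continuous; have [] := pexp_derive p x.
split=> [x _|v]; first by have [] := pexp_derive p x.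
apply: Ck_eq openT _ (CkZ v openT (IH ('X^2 * (p - p^`())))) => x _.
by have [_ ->] := pexp_derive p x.
Qed.

Definition step (t : R^o) : R^o := pexp 1 t / (pexp 1 t + pexp 1 (1 - t)).

Lemma pexp1_gt0 (t : R) : 0 < t -> 0 < pexp 1 t.
Proof. by move=> t0; rewrite /pexp t0 hornerC mul1r expR_gt0. Qed.

Lemma pexp1_le0 (t : R) : t <= 0 -> pexp 1 t = 0.
Proof. by rewrite /pexp leNgt => /negbTE->. Qed.

Lemma pexp1_ge0 (t : R) : 0 <= pexp 1 t.
Proof.
by have [/pexp1_le0->//|/pexp1_gt0/ltW] := leP t 0.
Qed.

Lemma step_eq1 (t : R) : 1 <= t -> step t = 1.
Proof.
move=> t1; rewrite /step (@pexp1_le0 (1 - t)) ?subr_le0// addr0 divff//.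
by rewrite gt_eqF// pexp1_gt0// (lt_le_trans _ t1).
Qed.

Lemma step_eq0 (t : R) : t <= 0 -> step t = 0.
Proof. by move=> t0; rewrite /step (pexp1_le0 t0) mul0r. Qed.

Lemma Cinf_step (t : R^o) : Cinf_at t step.
Proof.
have C1 : Cinf_at t (fun t => pexp 1 (1 - t)).
  apply: (@Cinf_at_compR _ _ _ _ (pexp 1) (fun t : R^o => 1 - t : R^o)).
    exact: Cinf_pexp.
  by apply: Cinf_atB; [exact: Cinf_at_cst|exact: Cinf_at_id].
apply: Cinf_atM; first exact: Cinf_pexp.
apply: Cinf_at_inv; last by apply: Cinf_atD => //; exact: Cinf_pexp.
rewrite gt_eqF//; have [t0|t0] := leP t 0.
  by rewrite ltr_wpDl ?pexp1_ge0// pexp1_gt0//; lra.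
by rewrite ltr_pwDl ?pexp1_ge0// pexp1_gt0.
Qed.

Definition bump1 (t : R^o) : R^o := step (2 - t) * step (2 + t).

Lemma Cinf_bump1 (t : R^o) : Cinf_at t bump1.
Proof.
apply: Cinf_atM.
  apply: (@Cinf_at_compR _ _ _ _ step (fun t : R^o => 2 - t : R^o)).
    exact: Cinf_step.
  by apply: Cinf_atB; [exact: Cinf_at_cst|exact: Cinf_at_id].
apply: (@Cinf_at_compR _ _ _ _ step (fun t : R^o => 2 + t : R^o)).
  exact: Cinf_step.
by apply: Cinf_atD; [exact: Cinf_at_cst|exact: Cinf_at_id].
Qed.

(** The norm of a row vector is its largest coordinate, so a product over the coordinates carries
    the cutoff from dimension one to balls. *)
Definition bump n (a : 'rV[R]_n) (r : R) (y : 'rV[R]_n) : R^o :=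
  \prod_i bump1 ((y 0 i - a 0 i) / r).

Lemma Cinf_bump n (a y : 'rV[R]_n) r : Cinf_at y (bump a r).
Proof.
apply: Cinf_at_prod => i.
apply: (@Cinf_at_compR _ _ _ _ bump1 (fun y : 'rV[R]_n => (y 0 i - a 0 i) / r : R^o)).
  exact: Cinf_bump1.
apply: Cinf_atM; last exact: Cinf_at_cst.
apply: Cinf_atB; last exact: Cinf_at_cst.
by apply: Cinf_at_coord; exact: Cinf_at_id.
Qed.

Lemma bump_eq1 n (a y : 'rV[R]_n) r : 0 < r -> `|y - a| <= r -> bump a r y = 1.
Proof.
move=> r0 yr; rewrite /bump big1// => i _.
have : `|(y 0 i - a 0 i) / r| <= 1.
  rewrite normrM normfV (gtr0_norm r0) ler_pdivrMr// mul1r.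
  by apply: le_trans yr; have := coord_le_norm (y - a) 0 i; rewrite !mxE.
rewrite ler_norml => /andP[h1 h2].
by rewrite /bump1 !step_eq1 ?mulr1//; lra.
Qed.

Lemma bump_eq0 n (a y : 'rV[R]_n) r : 0 < r -> 2 * r <= `|y - a| -> bump a r y = 0.
Proof.
move=> r0 yr; have [i iy] : exists i, 2 * r <= `|y 0 i - a 0 i|.
  apply/existsP; apply: contraTT yr => /existsPn H.
  have H' i : `|y 0 i - a 0 i| < 2 * r by rewrite ltNge; exact: H.
  have r2 : 0 < 2 * r by rewrite mulr_gt0.
  rewrite -ltNge [ltLHS]/Num.Def.normr/= mx_normrE.
  by apply/bigmax_ltP; split=> // -[j i] _ /=; rewrite !ord1 !mxE.
rewrite /bump (bigD1 i)//= /bump1.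
have [h|h] := leP 0 (y 0 i - a 0 i).
  rewrite ger0_norm// in iy; rewrite step_eq0 ?mul0r//.
  by rewrite subr_le0 ler_pdivlMr.
rewrite ltr0_norm// in iy.
have iy' : (y 0 i - a 0 i) / r <= - 2 by rewrite ler_pdivrMr//; lra.
rewrite (_ : step (2 + (y 0 i - a 0 i) / r) = 0) ?mulr0 ?mul0r//.
by apply: step_eq0; lra.
Qed.

End bump.

Section hadamard.
Context {R : realType}.
Notation mu := (@lebesgue_measure R).

Definition int01 (f : R -> R) : R := \int[mu]_(t in `[0, 1]) f t.

Definition cont01 (f : R -> R) : Prop :=
  forall t : R, 0 <= t <= 1 -> {for t, continuous (f : R^o -> R^o)}.

Lemma cont01_within f : cont01 f -> {within `[0, 1], continuous (f : R^o -> R^o)}.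
Proof.
move=> cf; apply: continuous_in_subspaceT => t; rewrite inE/= in_itv/=.
exact: cf.
Qed.

Lemma cont01_integrable f : cont01 f -> mu.-integrable `[0, 1] (EFin \o f).
Proof.
by move=> /cont01_within; apply: continuous_compact_integrable; exact: segment_compact.
Qed.

Lemma int01_linear a f g : cont01 f -> cont01 g ->
  int01 (fun t => a * f t + g t) = a * int01 f + int01 g.
Proof.
move=> cf cg; have [If Ig] := (cont01_integrable cf, cont01_integrable cg).
have Iaf : mu.-integrable `[0, 1] (EFin \o (fun t => a * f t)).
  apply: cont01_integrable => t t01; apply: cvgM; first exact: cvg_cst.
  exact: cf.
by rewrite /int01 RintegralD// RintegralZl.
Qed.

Lemma int01_cst a : int01 (fun=> a) = a.
Proof.
rewrite /int01 Rintegral_cst//.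
transitivity (a * fine (@lebesgue_measure R [set` `[0 : R, 1]%R])) => //.
by rewrite lebesgue_measure_itv/= lte_fin ltr01 -EFinB/= subr0 mulr1.
Qed.

Lemma int01_le f M : cont01 f -> (forall t, 0 <= t <= 1 -> `|f t| <= M) ->
  `|int01 f| <= M.
Proof.
move=> cf fM; have If := cont01_integrable cf.
have cM : cont01 (fun=> M) by move=> t _; exact: cvg_cst.
have cnf : cont01 (fun t => `|f t|).
  by move=> t /cf cft; exact: (continuous_comp cft (@norm_continuous _ R^o (f t))).
apply: (le_trans (le_normr_Rintegral _ If)) => //.
rewrite -[leRHS]int01_cst; apply: le_Rintegral => //.
- exact: cont01_integrable.
- exact: cont01_integrable.
Qed.

Lemma int01_FTC (f F : R -> R) : cont01 f ->
  (forall t, 0 <= t <= 1 -> is_derive (t : R^o) 1 (F : R^o -> R^o) (f t)) ->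
  int01 f = F 1 - F 0.
Proof.
move=> cf dF; rewrite /int01 /Rintegral (@continuous_FTC2 _ f F 0 1)//.
- exact: cont01_within.
- have cF t : 0 <= t <= 1 -> {for t, continuous (F : R^o -> R^o)}.
    move=> /dF[dFt _]; apply: differentiable_continuous.
    exact/derivable1_diffP.
  split.
  + by move=> t; rewrite in_itv/= => /andP[t0 t1]; have [] := dF t _; rewrite ?(ltW t0) ?(ltW t1).
  + by apply: cvg_at_right_filter; apply: cF; rewrite lexx ler01.
  + by apply: cvg_at_left_filter; apply: cF; rewrite lexx ler01.
- move=> t; rewrite in_itv/= => /andP[t0 t1].
  have t01 : 0 <= t <= 1 by rewrite !ltW.
  by have [_ <-] := dF t t01; rewrite derive1E.
Qed.

Variables (n : nat) (a : 'rV[R]_n) (d : R).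
Implicit Type f : 'rV[R]_n -> R^o.
Let good f := forall y, ball a d y -> Cinf_at y f.

(** The weight [t ^+ m] makes the family stable under differentiation: each derivative falls on [f]
    and raises [m] by one. Hadamard's coefficients have [m = 0]. *)
Definition ray (m : nat) f (x : 'rV[R]_n) : R^o :=
  int01 (fun t => t ^+ m * f (a + t *: (x - a))).

Lemma good_derive f v : good f -> good ('D_v f).
Proof. by move=> gf y /gf; exact: Cinf_at_derive. Qed.

Lemma ball_ray x t : ball a d x -> 0 <= t <= 1 -> ball a d (a + t *: (x - a)).
Proof.
move=> dx t01; apply: ball_segment => //; apply: ballxx.
by move: dx; rewrite -ball_normE /=; apply: le_lt_trans.
Qed.

Lemma cont01_ray m f x : good f -> ball a d x ->
  cont01 (fun t => t ^+ m * f (a + t *: (x - a))).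
Proof.
move=> gf dx t t01; apply: cvgM; first exact: exprn_continuous.
have Cf := gf _ (ball_ray dx t01).
have [+ _] := is_derive_line Cf.
by move=> /derivable1_diffP/differentiable_continuous.
Qed.

(** Differentiating under the integral takes an estimate uniform in [t]. Strict differentiability
    gives it near each [t0], and the compactness of the unit interval provides one neighbourhood of
    0 for all [t]. *)
Lemma ray_estimate f x (e : R) : good f -> ball a d x -> 0 < e ->
  \forall y \near (0 : 'rV[R]_n), forall t, `[0, 1]%classic t ->
   `|f (a + t *: (y + x - a)) - f (a + t *: (x - a))
      - t * 'D_y f (a + t *: (x - a))| <= e * `|y|.
Proof.
move=> gf dx e0.
pose P (y : 'rV[R]_n) (t : R) :=
   `|f (a + t *: (y + x - a)) - f (a + t *: (x - a))
      - t * 'D_y f (a + t *: (x - a))| <= e * `|y|.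
have cov := (near_covering_withinP _).2
  ((compact_near_coveringP _).1 (@segment_compact R 0 1)).
apply: (cov _ (nbhs (0 : 'rV[R]_n)) P) => t0; rewrite /= in_itv/= => t01.
pose z := a + t0 *: (x - a).
have Cz : Cinf_at z f by apply: gf; exact: ball_ray.
have e2 : 0 < e / 2 by rewrite divr_gt0.
have [r [r0 rS rD]] : exists r : R, [/\ 0 < r,
    forall p q, ball z r p -> ball z r q ->
      `|f p - f q - 'D_(p - q) f z| <= e / 2 * `|p - q| &
    forall p, ball z r p -> forall v, `|'D_v f p - 'D_v f z| <= e / 2 * `|v| ].
  have N1 := near_right_ball (derive_near e2 Cz).
  have N2 := strict_derive e2 Cz.
  apply: (@filter_ex _ (0 : R)^'+); near=> r; split; try by near: r.
  by near: r; exact: nbhs_right_gt.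
have N1 : \forall p \near (t0, (0 : 'rV[R]_n)), ball z r (a + p.1 *: (p.2 + x - a)).
  have : (a + p.1 *: (p.2 + x - a)) @[p --> (t0, (0 : 'rV[R]_n))] --> z.
    rewrite /z -{2}[x]add0r; apply: cvgD; first exact: cvg_cst.
    apply: cvgZ; first exact: cvg_fst.
    apply: cvgB; last exact: cvg_cst.
    by apply: cvgD; [exact: cvg_snd|exact: cvg_cst].
  by apply; exact: nbhsx_ballx.
have N2 : \forall p \near (t0, (0 : 'rV[R]_n)), ball z r (a + p.1 *: (x - a)).
  have : (a + p.1 *: (x - a)) @[p --> (t0, (0 : 'rV[R]_n))] --> z.
    apply: cvgD; first exact: cvg_cst.
    by apply: cvgZ; [exact: cvg_fst|exact: cvg_cst].
  by apply; exact: nbhsx_ballx.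
suff : \forall p \near (t0, (0 : 'rV[R]_n)), `[0, 1]%classic p.1 -> P p.2 p.1 by [].
apply: filterS2 N1 N2 => -[t y] /= dp dq; rewrite in_itv/= => /andP[s0 s1].
rewrite /P; set p := a + t *: (y + x - a) in dp *.
set q := a + t *: (x - a) in dq *.
have pq : p - q = t *: y.
  by rewrite /p /q; apply/rowP => i; rewrite !mxE; ring.
have H1 := rS _ _ dp dq; have H2 := rD _ dq (t *: y).
rewrite pq in H1.
have Dq : 'D_(t *: y) f q = t * 'D_y f q.
  have Cq : Cinf_at q f by apply: gf; apply: ball_ray => //; rewrite s0.
  have := derive_linearv Cq t y 0; rewrite !addr0 derive0 addr0; exact.
rewrite Dq in H2.
have -> : f p - f q - t * 'D_y f q =
   (f p - f q - 'D_(t *: y) f z) - (t * 'D_y f q - 'D_(t *: y) f z) by ring.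
apply: (le_trans (ler_normB _ _)).
have yt : `|t *: y| <= `|y| by rewrite normrZ ger0_norm// ler_piMl.
have : e / 2 * `|t *: y| <= e / 2 * `|y| by rewrite ler_wpM2l// ltW.
move: H1 H2; lra.
Unshelve. all: by end_near. Qed.

Lemma ray_derive m f x : good f -> ball a d x ->
  differentiable (ray m f) x /\ forall v, 'D_v (ray m f) x = ray m.+1 ('D_v f) x.
Proof.
move=> gf dx; pose l v := ray m.+1 ('D_v f) x.
have ll : linear l.
  move=> k u v; rewrite /l /ray -[k *: int01 _]/(k * int01 _).
  rewrite -int01_linear; last 2 first.
  - exact: cont01_ray (good_derive u gf) dx.
  - exact: cont01_ray (good_derive v gf) dx.
  apply: eq_Rintegral => t; rewrite inE/= in_itv/= => t01.
  rewrite (derive_linearv (gf _ (ball_ray dx t01))) -[k *: 'D_u f _]/(k * 'D_u f _).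
  by ring.
apply: (@differentiable_by _ _ _ (ray m f) x l) => //.
  by apply: findimE => //; exact: findim_rV.
move=> e e0.
have N1 := ray_estimate gf dx e0.
have N2 : \forall y \near (0 : 'rV[R]_n), ball a d (y + x).
  apply: (@shift_cvg0 _ _ x); apply: open_nbhs_nbhs; split => //.
  exact: ball_open.
near=> y.
have dyx : ball a d (y + x) by near: y; exact: N2.
have Hy t : 0 <= t <= 1 -> `|f (a + t *: (y + x - a)) - f (a + t *: (x - a))
      - t * 'D_y f (a + t *: (x - a))| <= e * `|y|.
  by move=> t01; move: t t01; near: y; apply: filterS N1 => y Hy t t01; apply: Hy; rewrite /= in_itv.
have c1 := cont01_ray (m := m) gf dyx.
have c2 := cont01_ray (m := m) gf dx.
have c3 := cont01_ray (m := m.+1) (good_derive (y) gf) dx.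
have c23 : cont01 (fun t => 1 * (t ^+ m * f (a + t *: (x - a)))
    + t ^+ m.+1 * 'D_y f (a + t *: (x - a))).
  by move=> t t01; apply: cvgD; [apply: cvgM; [exact: cvg_cst|exact: c2]|exact: c3].
have -> : ray m f (y + x) - (ray m f x + l y) = int01 (fun t =>
    -1 * (1 * (t ^+ m * f (a + t *: (x - a)))
    + t ^+ m.+1 * 'D_y f (a + t *: (x - a))) + t ^+ m * f (a + t *: (y + x - a))).
  rewrite int01_linear// int01_linear// /l /ray; ring.
apply: int01_le.
  move=> t t01; apply: cvgD; last exact: c1.
  by apply: cvgM; [exact: cvg_cst|exact: c23].
move=> t t01; rewrite exprS.
have -> : -1 * (1 * (t ^+ m * f (a + t *: (x - a))) +
   t * t ^+ m * 'D_y f (a + t *: (x - a))) + t ^+ m * f (a + t *: (y + x - a)) =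
   t ^+ m * (f (a + t *: (y + x - a)) - f (a + t *: (x - a))
      - t * 'D_y f (a + t *: (x - a))) by ring.
have /andP[t0 t1] := t01.
rewrite normrM ger0_norm ?exprn_ge0//; apply: le_trans (Hy t t01).
by rewrite ler_piMl// exprn_ile1.
Unshelve. all: by end_near. Qed.

Lemma good_ray m f : good f -> good (ray m f).
Proof.
move=> gf y dy; exists (ball a d); first by split=> //; exact: ball_open.
move=> k; elim: k m f gf => [|k IH] m f gf.
  move=> x dx; apply: differentiable_continuous.
  by have [] := ray_derive m gf dx.
split=> [x dx|v]; first by have [] := ray_derive m gf dx.
apply: Ck_eq (ball_open _ _) _ (IH m.+1 _ (good_derive (v) gf)) => x dx.
by have [_ ->] := ray_derive m gf dx.
Qed.

(** The fundamental theorem of calculus along the ray from [a] to [y], with ['D_(y - a) f] expanded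
    in coordinates. It will show that a derivation is determined by its values on coordinate
    functions. *)
Lemma hadamard f : good f -> exists g : 'I_n -> 'rV[R]_n -> R^o,
  [/\ forall i, good (g i),
      forall y, ball a d y -> f y = f a + \sum_i (y 0 i - a 0 i) * g i y &
      forall i, g i a = 'D_(delta_mx 0 i) f a].
Proof.
move=> gf; exists (fun i => ray 0 ('D_(delta_mx 0 i) f)); split.
- by move=> i; apply: good_ray; exact: good_derive.
- move=> y dy.
  have := @int01_FTC (fun t => 'D_(y - a) f (a + t *: (y - a)))
    (fun t => f (a + t *: (y - a))).
  rewrite scale1r scale0r addr0 (addrC a) subrK => FTC.
  have c0 : cont01 (fun t => 'D_(y - a) f (a + t *: (y - a))).
    have := cont01_ray (m := 0) (good_derive (y - a) gf) dy.
    rewrite (_ : (fun _ => _) = (fun t => 'D_(y - a) f (a + t *: (y - a))))//.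
    by apply/funext => s; rewrite mul1r.
  have {}FTC : int01 (fun t => 'D_(y - a) f (a + t *: (y - a))) = f y - f a.
    by apply: FTC c0 _ => t t01; apply: is_derive_line; apply: gf; exact: ball_ray.
  apply/eqP; rewrite addrC -subr_eq -FTC.
  have E : forall (r : seq 'I_n), int01 (fun t => \sum_(i <- r) (y 0 i - a 0 i) *
      (t ^+ 0 * 'D_(delta_mx 0 i) f (a + t *: (y - a)))) =
      \sum_(i <- r) (y 0 i - a 0 i) * ray 0 ('D_(delta_mx 0 i) f) y /\
      cont01 (fun t => \sum_(i <- r) (y 0 i - a 0 i) *
      (t ^+ 0 * 'D_(delta_mx 0 i) f (a + t *: (y - a)))).
    elim=> [|i r [IH1 IH2]].
      rewrite big_nil -[RHS]int01_cst; split.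
        by apply: eq_Rintegral => t _; rewrite big_nil.
      rewrite (_ : (fun _ => _) = fun=> 0); first by move=> t _; exact: cvg_cst.
      by apply/funext => t; rewrite big_nil.
    have ci := cont01_ray (m := 0) (good_derive (delta_mx 0 i) gf) dy.
    rewrite big_cons -IH1 /ray -int01_linear//; split.
      by apply: eq_Rintegral => t _; rewrite big_cons.
    rewrite (_ : (fun _ => _) = fun t => (y 0 i - a 0 i) *
      (t ^+ 0 * 'D_(delta_mx 0 i) f (a + t *: (y - a))) + \sum_(i <- r) (y 0 i - a 0 i) *
      (t ^+ 0 * 'D_(delta_mx 0 i) f (a + t *: (y - a)))).
      move=> t t01; apply: cvgD; last exact: IH2.
      by apply: cvgM; [exact: cvg_cst|exact: ci].
    by apply/funext => t; rewrite big_cons.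
  rewrite -(E _).1; apply/eqP; apply: eq_Rintegral => t.
  rewrite inE/= in_itv/= => t01.
  rewrite (derive_row_sum _ (gf _ (ball_ray dy t01))).
  by apply: eq_bigr => i _; rewrite !mxE mul1r.
- move=> i; rewrite /ray -[RHS]int01_cst; apply: eq_Rintegral => t _.
  by rewrite subrr scaler0 addr0 mul1r.
Qed.

End hadamard.

(** * Smooth maps between manifolds *)

Section smooth_maps.
Context {R : realType}.

(** The axioms shared by manifolds, their products and finite-dimensional normed spaces. A product
    is modelled on a product of row spaces, so it is not a [manifold], yet group actions are smooth
    maps on it. *)
Definition premanifold (V : normedModType R) (M : charted V) : Prop :=
  [/\ findim V, forall x : M, exists2 c, charts c & chart_dom c x,
      forall c : chart V M, charts c -> chart_laws c &
      forall c d : chart V M, charts c -> charts d ->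
        Cinfty (chart_map c @` (chart_dom c `&` chart_dom d))
               (chart_map d \o chart_inv c)].

(** Continuity is a separate condition because [chart_map d] is arbitrary outside its domain: the
    coordinate expression alone does not prevent [F] from leaving the chart. *)
Definition smooth_at (V W : normedModType R) (M : charted V) (N : charted W)
    (F : M -> N) (x : M) : Prop :=
  {for x, continuous F} /\
  forall c d, charts c -> charts d -> chart_dom c x -> chart_dom d (F x) ->
    Cinf_at (chart_map c x) (chart_map d \o F \o chart_inv c).

Lemma openX (S T : topologicalType) (A : set S) (B : set T) :
  open A -> open B -> open (A `*` B).
Proof.
move=> oA oB; rewrite openE => -[x y] [/= Ax By].
by exists (A, B) => //; split; exact: open_nbhs_nbhs.
Qed.

Section chart.
Variables (V : normedModType R) (T : topologicalType) (c : chart V T).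
Hypothesis lc : chart_laws c.

Lemma chart_nbhs (x : T) (P : T -> Prop) : chart_dom c x ->
  (\forall y \near x, P y) -> \forall z \near chart_map c x, P (chart_inv c z).
Proof.
have [_ _ cK _ cinv] := lc; move=> dx Px; apply: (cinv _ dx).
by rewrite /= cK.
Qed.

Lemma chart_dom_near (x : T) : chart_dom c x -> \forall y \near x, chart_dom c y.
Proof. by have [oc _ _ _ _] := lc => dx; apply: open_nbhs_nbhs. Qed.

Lemma chart_image_near (x : T) : chart_dom c x ->
  \forall z \near chart_map c x,
    chart_dom c (chart_inv c z) /\ chart_map c (chart_inv c z) = z.
Proof.
have [_ oc cK _ _] := lc => dx.
have : nbhs (chart_map c x) (chart_map c @` chart_dom c).
  by apply: open_nbhs_nbhs; split => //; exists x.
by apply: filterS => _ [y dy <-]; rewrite cK.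
Qed.

Lemma chart_image_open (A : set T) : A `<=` chart_dom c -> open A ->
  open (chart_map c @` A).
Proof.
have [_ oc cK _ _] := lc => Ac oA; rewrite openE => _ [x Ax <-].
have dx := Ac _ Ax.
have N1 := chart_nbhs dx (open_nbhs_nbhs (conj oA Ax : open_nbhs x A)).
have N2 := chart_image_near dx.
by apply: filterS2 N1 N2 => z Az [_ zE]; exists (chart_inv c z).
Qed.

End chart.

Section smooth_at_theory.
Variables (V W : normedModType R) (M : charted V) (N : charted W).
Hypotheses (pM : premanifold M) (pN : premanifold N).
Implicit Type F : M -> N.

Lemma smooth_onP (U : set M) F : open U ->
  smooth_on U F <-> forall x, U x -> smooth_at F x.
Proof.
have [_ covM lM _] := pM; have [_ covN lN _] := pN.
move=> oU.
have oS F' c d : (forall x, U x -> {for x, continuous F'}) -> charts c -> charts d ->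
    open (chart_map c @` (chart_dom c `&` U `&` F' @^-1` chart_dom d)).
  move=> cF cc cd; have [oc _ _ _ _] := lM _ cc; have [od _ _ _ _] := lN _ cd.
  apply: (chart_image_open (lM _ cc)); first by move=> x [[]].
  rewrite openE => x [[dx Ux] dFx].
  apply: filterI; first by apply: open_nbhs_nbhs; split => //; exact: openI.
  by apply: (cF _ Ux); exact: open_nbhs_nbhs.
split=> [[cF SF] x Ux|SF].
  split; first exact: cF.
  move=> c d cc cd dx dFx.
  by apply: (Cinf_atP _ (oS F c d cF cc cd)).1; [exact: SF|exists x].
have cF x : U x -> {for x, continuous F} by move=> /SF[].
split=> // c d cc cd; apply: (Cinf_atP _ (oS F c d cF cc cd)).2.
by move=> _ [x [[dx Ux] dFx] <-]; have [_] := SF _ Ux; exact.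
Qed.

Lemma smoothP F : smooth F <-> forall x, smooth_at F x.
Proof.
split=> [/(smooth_onP _ openT) h x|h]; first exact: h.
by apply/(smooth_onP _ openT) => x _; exact: h.
Qed.

Lemma smooth_at_eq F G x : {near x, F =1 G} -> smooth_at F x -> smooth_at G x.
Proof.
have [_ _ lM _] := pM; move=> FG [cF SF]; split.
  rewrite /prop_for /continuous_at -(nbhs_singleton FG).
  by apply: cvg_trans cF; apply: near_eq_cvg; apply: filterS FG => y ->.
move=> c d cc cd dx; rewrite -(nbhs_singleton FG) => dFx.
apply: Cinf_at_eq (SF c d cc cd dx dFx).
have := chart_nbhs (lM _ cc) dx FG.
by apply: filterS => z /= ->.
Qed.

Lemma smooth_at_continuous F x : smooth_at F x -> {for x, continuous F}.
Proof. by case. Qed.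

(** A single pair of charts suffices: the expressions in other charts differ by transition maps, and
    continuity of [F] makes this factorisation valid near [x]. *)
Lemma smooth_at_chart F x c d : charts c -> charts d -> chart_dom c x ->
  chart_dom d (F x) -> {for x, continuous F} ->
  Cinf_at (chart_map c x) (chart_map d \o F \o chart_inv c) -> smooth_at F x.
Proof.
have [fV _ lM kM] := pM; have [fW _ lN kN] := pN.
move=> cc cd dx dFx cF CF; split => // c' d' cc' cd' dx' dFx'.
have [_ _ cK _ _] := lM _ cc; have [_ _ cK' _ _] := lM _ cc'.
have [oc _ _ _ _] := lM _ cc; have [oc' _ _ _ _] := lM _ cc'.
have [od _ dK _ _] := lN _ cd; have [od' _ dK' _ _] := lN _ cd'.
have C1 : Cinf_at (chart_map c' x) (chart_map c \o chart_inv c').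
  apply: (Cinf_atP _ _).1 (kM _ _ cc' cc) _ _; last by exists x.
  by apply: (chart_image_open (lM _ cc')); [move=> y []|exact: openI].
have C2 : Cinf_at (chart_map d (F x)) (chart_map d' \o chart_inv d).
  apply: (Cinf_atP _ _).1 (kN _ _ cd cd') _ _; last by exists (F x).
  by apply: (chart_image_open (lN _ cd)); [move=> y []|exact: openI].
have E1 : (chart_map c \o chart_inv c') (chart_map c' x) = chart_map c x.
  by rewrite /= cK'.
have E2 : (chart_map d \o F \o chart_inv c) (chart_map c x) = chart_map d (F x).
  by rewrite /= cK.
have C3 : Cinf_at (chart_map c x) ((chart_map d' \o chart_inv d) \o
    (chart_map d \o F \o chart_inv c)).
  by apply: Cinf_at_comp => //; rewrite E2.
have C4 : Cinf_at (chart_map c' x) (((chart_map d' \o chart_inv d) \o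
    (chart_map d \o F \o chart_inv c)) \o (chart_map c \o chart_inv c')).
  by apply: Cinf_at_comp => //; rewrite E1.
apply: Cinf_at_eq C4.
have N1 : \forall y \near x, chart_dom c y /\ chart_dom d (F y).
  apply: filterI; first exact: open_nbhs_nbhs.
  by apply: cF; exact: open_nbhs_nbhs.
have := chart_nbhs (lM _ cc') dx' N1.
by apply: filterS => z /= [h1 h2]; rewrite cK// dK.
Qed.

Lemma smooth_at_cst (q : N) (x : M) : smooth_at (fun=> q) x.
Proof.
split=> [|c d cc cd dx dq]; first exact: cvg_cst.
exact: Cinf_at_cst.
Qed.

End smooth_at_theory.

Lemma smooth_at_id (V : normedModType R) (M : charted V) (x : M) :
  premanifold M -> smooth_at id x.
Proof.
move=> pM; have [fV cov lM kM] := pM; have [c cc dx] := cov x.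
apply: (@smooth_at_chart _ _ M M pM pM id x c c) => //.
have := Cinf_at_id (chart_map c x); apply: Cinf_at_eq.
by have := chart_image_near (lM _ cc) dx; apply: filterS => z [_ /= ->].
Qed.

Lemma smooth_at_comp (V W Z : normedModType R) (M : charted V) (N : charted W)
    (P : charted Z) (F : M -> N) (G : N -> P) (x : M) :
  premanifold M -> premanifold N -> smooth_at G (F x) -> smooth_at F x ->
  smooth_at (G \o F) x.
Proof.
move=> [fV _ lM kM] [fW cN lN kN] [cG SG] [cF SF]; split.
  by apply: continuous_comp.
move=> c e cc ce dx dGFx; have [d cd dFx] := cN (F x).
have [_ _ cK _ _] := lM _ cc; have [od _ dK _ _] := lN _ cd.
have C := Cinf_at_comp fW _ (SF c d cc cd dx dFx).
have : Cinf_at ((chart_map d \o F \o chart_inv c) (chart_map c x))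
    (chart_map e \o G \o chart_inv d).
  by rewrite /= cK//; exact: SG.
move=> /C; apply: Cinf_at_eq.
have N1 : \forall y \near x, chart_dom d (F y) by apply: cF; exact: open_nbhs_nbhs.
have := chart_nbhs (lM _ cc) dx N1.
by apply: filterS => z /= dz; rewrite dK.
Qed.

Lemma premanifold_prod (V W : normedModType R) (M : charted V) (N : charted W) :
  premanifold M -> premanifold N -> premanifold (prod_charted M N).
Proof.
move=> [fV cM lM kM] [fW cN lN kN]; split.
- exact: findim_prod.
- move=> [x y]; have [c cc dx] := cM x; have [d cd dy] := cN y.
  by exists (prod_chart c d) => //; exists c, d.
- move=> _ [c [d [cc cd ->]]].
  have [oc oc' cK mc ic] := lM _ cc; have [od od' dK md id] := lN _ cd.
  have img : chart_map (prod_chart c d) @` chart_dom (prod_chart c d) =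
      (chart_map c @` chart_dom c) `*` (chart_map d @` chart_dom d).
    apply/seteqP; split=> [_ [[x y] [/= dx dy] <-]|[x y] [/= [u du <-] [v dv <-]]].
      by split; [exists x|exists y].
    by exists (u, v).
  split.
  + exact: openX.
  + by rewrite img; exact: openX.
  + by move=> [x y] [/= dx dy]; rewrite cK// dK.
  + move=> [x y] [/= dx dy]; apply: (@cvg_pair _ _ _ _ (nbhs (chart_map c x)) (nbhs (chart_map d y))).
      by apply: (cvg_comp _ _ cvg_fst); exact: mc.
    by apply: (cvg_comp _ _ cvg_snd); exact: md.
  + move=> [x y] [/= dx dy]; apply: (@cvg_pair _ _ _ _ (nbhs (chart_inv c (chart_map c x))) (nbhs (chart_inv d (chart_map d y)))).
      by apply: (cvg_comp _ _ cvg_fst); exact: ic.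
    by apply: (cvg_comp _ _ cvg_snd); exact: id.
- move=> _ _ [c [d [cc cd ->]]] [c' [d' [cc' cd' ->]]].
  have [oc _ _ _ _] := lM _ cc; have [od _ _ _ _] := lN _ cd.
  have [oc' _ _ _ _] := lM _ cc'; have [od' _ _ _ _] := lN _ cd'.
  have oc2 : open (chart_map c @` (chart_dom c `&` chart_dom c')).
    by apply: (chart_image_open (lM _ cc)); [move=> y []|exact: openI].
  have od2 : open (chart_map d @` (chart_dom d `&` chart_dom d')).
    by apply: (chart_image_open (lN _ cd)); [move=> y []|exact: openI].
  set A := chart_map c @` _ in oc2; set B := chart_map d @` _ in od2.
  have -> : chart_map (prod_chart c d) @` (chart_dom (prod_chart c d) `&`
      chart_dom (prod_chart c' d')) = A `*` B.
    apply/seteqP; split=> [_ [[x y] [[/= dx dy] [/= dx' dy']] <-]|].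
      by split; [exists x|exists y].
    by move=> [x y] [/= [u [du du'] <-] [v [dv dv'] <-]]; exists (u, v).
  apply: (Cinf_atP _ _).2; first exact: openX.
  move=> [x y] [/= Ax By].
  apply: Cinf_at_pair.
    apply: (@Cinf_at_comp _ _ _ _ _ (chart_map c' \o chart_inv c) fst) => //.
      by apply: (Cinf_atP _ oc2).1; [exact: kM|].
    apply: Cinf_at_linear; last by move=> z; exact: cvg_fst.
    by move=> a u v.
  apply: (@Cinf_at_comp _ _ _ _ _ (chart_map d' \o chart_inv d) snd) => //.
    by apply: (Cinf_atP _ od2).1; [exact: kN|].
  apply: Cinf_at_linear; last by move=> z; exact: cvg_snd.
  by move=> a u v.
Qed.

Lemma smooth_at_pair (V W Z : normedModType R) (M : charted V) (N : charted W)
    (P : charted Z) (F : M -> N) (G : M -> P) (x : M) :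
  smooth_at F x -> smooth_at G x ->
  smooth_at (N := prod_charted N P) (fun y => (F y, G y)) x.
Proof.
move=> [cF SF] [cG SG]; split.
  by apply: (@cvg_pair _ _ _ _ (nbhs (F x)) (nbhs (G x))); [exact: cF|exact: cG].
move=> c _ cc [d [e [cd ce ->]]] dx [/= dFx dGx].
by apply: Cinf_at_pair; [exact: SF|exact: SG].
Qed.

Lemma smooth_at_fst (V W : normedModType R) (M : charted V) (N : charted W)
    (p : prod_charted M N) : premanifold M -> premanifold N ->
  smooth_at (M := prod_charted M N) (N := M) fst p.
Proof.
move=> pM pN; have [fV cM lM kM] := pM; have [fW cN lN kN] := pN.
case: p => x y; have [c cc dx] := cM x; have [d cd dy] := cN y.
have ccd : charts (prod_chart c d : chart _ (prod_charted M N)) by exists c, d.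
apply: (@smooth_at_chart _ _ (prod_charted M N) M (premanifold_prod pM pN) pM
  fst (x, y) (prod_chart c d) c) => //.
- exact: cvg_fst.
- have : Cinf_at (chart_map c x, chart_map d y) fst.
    by apply: Cinf_at_linear; [move=> a u v|move=> z; exact: cvg_fst].
  apply: Cinf_at_eq.
  have N1 := chart_image_near (lM _ cc) dx.
  have : \forall z \near (chart_map c x, chart_map d y),
      chart_map c (chart_inv c z.1) = z.1.
    have : fst z @[z --> (chart_map c x, chart_map d y)] --> chart_map c x by exact: cvg_fst.
    by move=> cf; apply: (cf [set u | chart_map c (chart_inv c u) = u]); apply: filterS N1 => z [].
  by apply: filterS => z /= ->.
Qed.

Lemma smooth_at_snd (V W : normedModType R) (M : charted V) (N : charted W)
    (p : prod_charted M N) : premanifold M -> premanifold N ->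
  smooth_at (M := prod_charted M N) (N := N) snd p.
Proof.
move=> pM pN; have [fV cM lM kM] := pM; have [fW cN lN kN] := pN.
case: p => x y; have [c cc dx] := cM x; have [d cd dy] := cN y.
have ccd : charts (prod_chart c d : chart _ (prod_charted M N)) by exists c, d.
apply: (@smooth_at_chart _ _ (prod_charted M N) N (premanifold_prod pM pN) pN
  snd (x, y) (prod_chart c d) d) => //.
- exact: cvg_snd.
- have : Cinf_at (chart_map c x, chart_map d y) snd.
    by apply: Cinf_at_linear; [move=> a u v|move=> z; exact: cvg_snd].
  apply: Cinf_at_eq.
  have N1 := chart_image_near (lN _ cd) dy.
  have : \forall z \near (chart_map c x, chart_map d y),
      chart_map d (chart_inv d z.2) = z.2.
    have : snd z @[z --> (chart_map c x, chart_map d y)] --> chart_map d y by exact: cvg_snd.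
    by move=> cf; apply: (cf [set u | chart_map d (chart_inv d u) = u]); apply: filterS N1 => z [].
  by apply: filterS => z /= ->.
Qed.

(** At [R^o] this is [real_line]. With row spaces on the same footing as manifolds, chart maps and
    their inverses are smooth maps that compose with all others. *)
Definition flat (V : normedModType R) : charted V :=
  @Charted R V V [set Chart setT id id].

Lemma premanifold_flat (V : normedModType R) : findim V -> premanifold (flat V).
Proof.
move=> fV; split => //.
- by move=> x; exists (Chart setT id id).
- move=> _ ->; split => //=.
  + exact: openT.
  + by rewrite image_id; exact: openT.
  + by move=> x _; exact: cvg_id.
  + by move=> x _; exact: cvg_id.
- move=> _ _ -> ->; rewrite /= setIT image_id.
  by apply: (Cinf_atP _ openT).2 => x _; exact: Cinf_at_id.
Qed.

Lemma smooth_at_flat (V W : normedModType R) (f : V -> W) (x : V) :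
  smooth_at (M := flat V) (N := flat W) f x <-> Cinf_at x f.
Proof.
split=> [[_ H]|Cf]; first exact: (H (Chart setT id id) (Chart setT id id)).
by split=> [|_ _ -> -> _ _]; [exact: Cinf_at_continuous|].
Qed.

Lemma premanifold_manifold n (M : manifold R n) : premanifold M.
Proof. by have [_ _ h1 h2 h3] := manifoldP M; split => //; exact: findim_rV. Qed.

Lemma premanifold_real : premanifold (real_line R).
Proof. exact: (premanifold_flat findim_R). Qed.

Lemma smooth_at_chart_map (V : normedModType R) (M : charted V) c (x : M) :
  premanifold M -> charts c -> chart_dom c x ->
  smooth_at (N := flat V) (chart_map c) x.
Proof.
move=> pM cc dx; have [fV cM lM kM] := pM; have [_ _ _ mc _] := lM _ cc.
apply: (@smooth_at_chart _ _ _ (flat V) pM (premanifold_flat fV) _ x c (Chart setT id id)) => //.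
  exact: mc.
have := Cinf_at_id (chart_map c x); apply: Cinf_at_eq.
by have := chart_image_near (lM _ cc) dx; apply: filterS => z [_ /= ->].
Qed.

Lemma smooth_at_chart_inv (V : normedModType R) (M : charted V) c (x : M) :
  premanifold M -> charts c -> chart_dom c x ->
  smooth_at (M := flat V) (chart_inv c) (chart_map c x).
Proof.
move=> pM cc dx; have [fV cM lM kM] := pM; have [_ _ cK _ ic] := lM _ cc.
apply: (@smooth_at_chart _ _ (flat V) _ (premanifold_flat fV) pM _ _ (Chart setT id id) c) => //.
- by rewrite cK.
- exact: ic.
have := Cinf_at_id (chart_map c x); apply: Cinf_at_eq.
by have := chart_image_near (lM _ cc) dx; apply: filterS => z [_ /= ->].
Qed.

End smooth_maps.

(** * Real-valued smooth functions and cutoffs *)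

Section real_functions.
Context {R : realType} (V : normedModType R) (M : charted V).
Hypothesis pM : premanifold M.

Definition rsm (f : M -> R) (x : M) : Prop := smooth_at (N := real_line R) f x.

Lemma rsm_chart f x c : rsm f x -> charts c -> chart_dom c x ->
  Cinf_at (chart_map c x) (f \o chart_inv c : V -> R^o).
Proof. by move=> [_ /(_ c (Chart setT id id))] H cc dx; exact: H. Qed.

Lemma chart_rsm f x c : charts c -> chart_dom c x ->
  Cinf_at (chart_map c x) (f \o chart_inv c : V -> R^o) -> rsm f x.
Proof.
move=> cc dx Cf; have [fV cM lM kM] := pM; have [_ _ cK mc ic] := lM _ cc.
have cf : {for x, continuous ((f \o chart_inv c : V -> R^o) \o chart_map c)}.
  apply: continuous_comp; first exact: mc.
  exact: Cinf_at_continuous.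
apply: (@smooth_at_chart _ _ _ _ _ pM premanifold_real _ x c (Chart setT id id)) => //.
rewrite /prop_for /continuous_at -[X in f X](cK _ dx); apply: cvg_trans cf.
apply: near_eq_cvg; have := chart_dom_near (lM _ cc) dx.
by apply: filterS => y dy /=; rewrite cK.
Qed.

Lemma rsm_eq f g x : {near x, f =1 g} -> rsm f x -> rsm g x.
Proof. by move=> fg Sf; apply: (@smooth_at_eq _ _ _ _ (real_line R) pM f g x fg). Qed.

Lemma rsm_cst a x : rsm (fun=> a) x.
Proof. exact: smooth_at_cst. Qed.

Lemma rsm2 (f g h : M -> R) x :
  (forall (y : V) (i : V -> M), Cinf_at y (f \o i : V -> R^o) ->
     Cinf_at y (g \o i : V -> R^o) -> Cinf_at y (h \o i : V -> R^o)) ->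
  rsm f x -> rsm g x -> rsm h x.
Proof.
move=> H Sf Sg; have [fV cM lM kM] := pM; have [c cc dx] := cM x.
by apply: (chart_rsm cc dx); apply: H; exact: rsm_chart.
Qed.

Lemma rsmD f g x : rsm f x -> rsm g x -> rsm (fun y => f y + g y) x.
Proof. by apply: rsm2 => y i; exact: Cinf_atD. Qed.

Lemma rsmM f g x : rsm f x -> rsm g x -> rsm (fun y => f y * g y) x.
Proof. by apply: rsm2 => y i; exact: Cinf_atM. Qed.

Lemma rsmN f x : rsm f x -> rsm (fun y => - f y) x.
Proof.
move=> Sf; apply: (rsm_eq _ (rsmM (rsm_cst (-1) x) Sf)).
by apply: nearW => y; rewrite mulN1r.
Qed.

Lemma rsm_sum (I : Type) (r : seq I) (F : I -> M -> R) x :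
  (forall i, rsm (F i) x) -> rsm (fun y => \sum_(i <- r) F i y) x.
Proof.
move=> SF; elim: r => [|i r IH].
  by apply: (rsm_eq _ (rsm_cst 0 x)); apply: nearW => y; rewrite big_nil.
by apply: (rsm_eq _ (rsmD (SF i) IH)); apply: nearW => y; rewrite big_cons.
Qed.

Lemma rsm_continuous f x : rsm f x -> {for x, continuous (f : M -> R^o)}.
Proof. by case. Qed.

End real_functions.

Lemma smooth_funP (R : realType) n (M : manifold R n) (f : M -> R) :
  smooth_fun f <-> forall x, rsm f x.
Proof. by apply: smoothP; [exact: premanifold_manifold|exact: premanifold_real]. Qed.

Section smooth_functions.
Context {R : realType} {n : nat} (M : manifold R n).
Let pM := premanifold_manifold M.
Implicit Types f g h : M -> R.

Lemma sf_rsm f x : smooth_fun f -> rsm f x.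
Proof. by move=> /smooth_funP. Qed.

Lemma rsm_sf f : (forall x, rsm f x) -> smooth_fun f.
Proof. by move=> /smooth_funP. Qed.

Lemma sfD f g : smooth_fun f -> smooth_fun g -> smooth_fun (fun x => f x + g x).
Proof. by move=> /smooth_funP Sf /smooth_funP Sg; apply/smooth_funP => x; exact: rsmD. Qed.

Lemma sfM f g : smooth_fun f -> smooth_fun g -> smooth_fun (fun x => f x * g x).
Proof. by move=> /smooth_funP Sf /smooth_funP Sg; apply/smooth_funP => x; exact: rsmM. Qed.

Lemma sf_cst a : smooth_fun (fun _ : M => a).
Proof. by apply/smooth_funP => x; exact: rsm_cst. Qed.

Lemma sfZ a f : smooth_fun f -> smooth_fun (fun x => a * f x).
Proof. by apply: sfM; exact: sf_cst. Qed.

Lemma sfN f : smooth_fun f -> smooth_fun (fun x => - f x).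
Proof. by move=> /smooth_funP Sf; apply/smooth_funP => x; exact: rsmN. Qed.

Lemma sfB f g : smooth_fun f -> smooth_fun g -> smooth_fun (fun x => f x - g x).
Proof. by move=> Sf Sg; apply: sfD => //; exact: sfN. Qed.

Lemma sf_sum (I : Type) (r : seq I) (F : I -> M -> R) :
  (forall i, smooth_fun (F i)) -> smooth_fun (fun x => \sum_(i <- r) F i x).
Proof.
by move=> SF; apply: rsm_sf => x; apply: rsm_sum => // i; exact: sf_rsm.
Qed.

Lemma rsm_coord c x i : charts c -> chart_dom c x ->
  rsm (fun y : M => chart_map c y 0 i) x.
Proof.
move=> cc dx; have [fV cM lM kM] := pM.
apply: (chart_rsm pM cc dx); have := Cinf_at_coord 0 i (Cinf_at_id (chart_map c x)).
apply: Cinf_at_eq; have := chart_image_near (lM _ cc) dx.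
by apply: filterS => z [_ /= ->].
Qed.

(** A point outside [K] has the open complement of [K] as a neighbourhood, where the product is 0.
    This is how functions smooth on a chart become global. *)
Lemma smooth_cutoff (K : set M) f h : closed K -> smooth_fun f ->
  (forall x, ~ K x -> f x = 0) -> (forall x, K x -> rsm h x) ->
  smooth_fun (fun x => f x * h x).
Proof.
move=> cK Sf f0 Sh; apply/smooth_funP => x.
have [Kx|nKx] := pselect (K x).
  by apply: rsmM => //; [exact: sf_rsm|exact: Sh].
apply: (@rsm_eq _ _ M pM (fun=> 0) _ x); last exact: rsm_cst.
have : nbhs x (~` K) by apply: open_nbhs_nbhs; split=> //; exact: closed_openC.
by apply: filterS => y /f0 ->; rewrite mul0r.
Qed.

Section chart_bump.
Variables (c : chart 'rV[R]_n M) (p : M) (s : R).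
Hypotheses (cc : charts c) (dp : chart_dom c p)
  (sball : ball (chart_map c p) s `<=` chart_map c @` chart_dom c).

Definition cball (r : R) : set M :=
  [set x | chart_dom c x /\ `|chart_map c x - chart_map c p| <= r].

(** Here Hausdorff separation enters: a closed coordinate ball is the continuous image of a compact
    set, hence closed in [M], so that extension by zero outside it is smooth. *)
Lemma cball_closed r : 0 < r -> r < s -> closed (cball r).
Proof.
move=> r0 rs; have [fV cM lM kM] := pM; have [_ _ cK mc ic] := lM _ cc.
have -> : cball r = chart_inv c @` [set a | `|a - chart_map c p| <= r].
  apply/seteqP; split=> [x [dx xr]|_ [y yr <-]].
    by exists (chart_map c x) => //; rewrite cK.
  have /sball[x dx xy] : ball (chart_map c p) s y.
    by rewrite -ball_normE /= distrC (le_lt_trans yr).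
  by rewrite -xy cK//; split=> //; rewrite xy.
apply: compact_closed; first by have [] := manifoldP M.
apply: continuous_compact; last exact: compact_norm_ball.
apply: continuous_in_subspaceT => y; rewrite inE /= => yr.
have /sball[x dx <-] : ball (chart_map c p) s y.
  by rewrite -ball_normE /= distrC (le_lt_trans yr).
exact: ic.
Qed.

Definition cbump (r : R) (x : M) : R :=
  if `[< chart_dom c x >] then bump (chart_map c p) r (chart_map c x) else 0.

Lemma cbump_eq1 r x : 0 < r -> chart_dom c x ->
  `|chart_map c x - chart_map c p| <= r -> cbump r x = 1.
Proof. by move=> r0 dx xr; rewrite /cbump asboolT// bump_eq1. Qed.

Lemma cbump_eq0 r x : 0 < r -> ~ cball (2 * r) x -> cbump r x = 0.
Proof.
move=> r0 nx; rewrite /cbump; case: asboolP => // dx.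
rewrite bump_eq0// leNgt; apply/negP => h; apply: nx.
by split => //; exact: ltW.
Qed.

Lemma smooth_cbump r : 0 < r -> 2 * r < s -> smooth_fun (cbump r).
Proof.
move=> r0 rs; have [fV cM lM kM] := pM; apply/smooth_funP => x.
have [dx|ndx] := pselect (chart_dom c x).
  apply: (chart_rsm pM cc dx).
  have := Cinf_bump (chart_map c p) (chart_map c x) r.
  apply: Cinf_at_eq; have := chart_image_near (lM _ cc) dx.
  by apply: filterS => z [dz zE] /=; rewrite /cbump asboolT// zE.
apply: (@rsm_eq _ _ M pM (fun=> 0) _ x); last exact: rsm_cst.
have : nbhs x (~` cball (2 * r)).
  apply: open_nbhs_nbhs; split; last by case.
  by apply: closed_openC; apply: cball_closed => //; rewrite mulr_gt0.
by apply: filterS => y; move/(cbump_eq0 r0).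
Qed.

End chart_bump.

Lemma chart_radius c p (U : set M) : charts c -> chart_dom c p -> nbhs p U ->
  exists2 s : R, 0 < s &
    ball (chart_map c p) s `<=` chart_map c @` (chart_dom c `&` U).
Proof.
move=> cc dp Up; have [fV cM lM kM] := pM.
have [oc _ _ _ _] := lM _ cc.
have : nbhs p (chart_dom c `&` U) by apply: filterI => //; exact: open_nbhs_nbhs.
rewrite nbhsE => -[B [oB Bp] BU].
have : nbhs (chart_map c p) (chart_map c @` B).
  apply: open_nbhs_nbhs; split; last by exists p.
  by apply: (chart_image_open (lM _ cc)) => // x /BU[].
move=> /nbhs_ballP[s /= s0 sB]; exists s => // y /sB[x Bx <-].
by exists x => //; exact: BU.
Qed.

Lemma bump_in (p : M) (U : set M) : nbhs p U -> exists f : M -> R, [/\ smooth_fun f,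
  \forall x \near p, f x = 1 & forall x, ~ U x -> f x = 0].
Proof.
move=> Up; have [fV cM lM kM] := pM; have [c cc dp] := cM p.
have [_ _ cK mc ic] := lM _ cc.
have [s s0 sU] := chart_radius cc dp Up.
have sdom : ball (chart_map c p) s `<=` chart_map c @` chart_dom c.
  by move=> y /sU[x [dx _] <-]; exists x.
(* A bump of radius [s / 4] vanishes outside radius [s / 2], well inside the ball of radius [s] that
   the chart covers. *)
have s40 : 0 < s / 4 by rewrite divr_gt0.
exists (cbump c p (s / 4)); split.
- by apply: (smooth_cbump cc sdom) => //; lra.
- have N1 := chart_dom_near (lM _ cc) dp.
  have N2 : \forall x \near p, ball (chart_map c p) (s / 4) (chart_map c x).
    by apply: (mc _ dp); exact: nbhsx_ballx.
  apply: filterS2 N1 N2 => x dx; rewrite -ball_normE /= => xr.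
  by apply: cbump_eq1 => //; rewrite distrC ltW.
- move=> x nUx; apply: cbump_eq0 => // -[dx xr]; apply: nUx.
  have /sU[y [dy Uy] yx] : ball (chart_map c p) s (chart_map c x).
    by rewrite -ball_normE /= distrC; apply: le_lt_trans xr _; lra.
  by rewrite -(cK x dx) -yx cK.
Qed.

End smooth_functions.

(** * Tangent vectors and vector fields *)

Section tangent_vectors.
Context {R : realType} {n : nat} (M : manifold R n).
Let pM := premanifold_manifold M.
Implicit Types f g h : M -> R.

Section derivation.
Variables (p : M) (v : vec M).
Hypothesis Tv : tangent p v.

Lemma tangent_nonsmooth f : ~ smooth_fun f -> v f = 0.
Proof. by have [h _ _] := Tv; exact: h. Qed.

Lemma tangentP a f g : smooth_fun f -> smooth_fun g ->
  v (fun x => a * f x + g x) = a * v f + v g.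
Proof. by have [_ h _] := Tv; exact: h. Qed.

Lemma tangentD f g : smooth_fun f -> smooth_fun g ->
  v (fun x => f x + g x) = v f + v g.
Proof.
move=> Sf Sg; rewrite -[v f]mul1r -tangentP//; congr v.
by apply/funext => x; rewrite mul1r.
Qed.

Lemma tangentM f g : smooth_fun f -> smooth_fun g ->
  v (fun x => f x * g x) = v f * g p + f p * v g.
Proof. by have [_ _ h] := Tv; exact: h. Qed.

Lemma tangent0 : v (fun=> 0) = 0.
Proof.
have := tangentD (sf_cst M 0) (sf_cst M 0).
rewrite (_ : (fun=> 0 + 0) = fun _ : M => 0); last by apply/funext => x; rewrite addr0.
by move=> /eqP; rewrite -subr_eq subrr eq_sym => /eqP.
Qed.

Lemma tangentZ a f : smooth_fun f -> v (fun x => a * f x) = a * v f.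
Proof.
move=> Sf; rewrite -[RHS]addr0 -tangent0 -tangentP//; last exact: sf_cst.
by congr v; apply/funext => x; rewrite addr0.
Qed.

Lemma tangent_cst a : v (fun=> a) = 0.
Proof.
have v1 : v (fun=> 1) = 0.
  have := tangentM (sf_cst M 1) (sf_cst M 1).
  rewrite (_ : (fun=> 1 * 1) = fun _ : M => 1); last by apply/funext => x; rewrite mulr1.
  by move=> /eqP; rewrite mulr1 mul1r -subr_eq subrr eq_sym => /eqP.
rewrite (_ : (fun=> a) = fun _ : M => a * 1); last by apply/funext => x; rewrite mulr1.
by rewrite tangentZ ?v1 ?mulr0//; exact: sf_cst.
Qed.

Lemma tangentN f : smooth_fun f -> v (fun x => - f x) = - v f.
Proof.
by move=> Sf; rewrite -mulN1r -tangentZ//; congr v; apply/funext => x; rewrite mulN1r.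
Qed.

Lemma tangentB f g : smooth_fun f -> smooth_fun g ->
  v (fun x => f x - g x) = v f - v g.
Proof. by move=> Sf Sg; rewrite tangentD ?tangentN//; exact: sfN. Qed.

Lemma tangent_sum (I : Type) (r : seq I) (F : I -> M -> R) :
  (forall i, smooth_fun (F i)) ->
  v (fun x => \sum_(i <- r) F i x) = \sum_(i <- r) v (F i).
Proof.
move=> SF; elim: r => [|i r IH].
  rewrite big_nil; transitivity (v (fun=> 0)); last exact: tangent0.
  by congr v; apply/funext => x; rewrite big_nil.
rewrite big_cons -IH -tangentD//; last exact: sf_sum.
by congr v; apply/funext => x; rewrite big_cons.
Qed.

(** Take [h] equal to 1 near [p] and 0 wherever [f] and [g] differ. Then [h * (f - g)] is
    identically 0, and the Leibniz rule at [p] leaves [v f - v g]. *)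
Lemma tangent_local f g : smooth_fun f -> smooth_fun g ->
  {near p, f =1 g} -> v f = v g.
Proof.
move=> Sf Sg fg; apply/eqP; rewrite -subr_eq0 -tangentB//; apply/eqP.
have [h [Sh h1 h0]] := bump_in (fg : nbhs p [set x | f x = g x]).
have E : (fun x => h x * (f x - g x)) = fun=> 0.
  apply/funext => x; have [fgx|/h0->] := pselect (f x = g x); last by rewrite mul0r.
  by rewrite fgx subrr mulr0.
have := tangentM Sh (sfB Sf Sg); rewrite E tangent0.
by rewrite (nbhs_singleton h1) (nbhs_singleton fg) subrr mulr0 add0r mul1r.
Qed.

End derivation.

Lemma tangent_zero p : tangent p (fun _ : M -> R => 0).
Proof. by split=> [//|a f g _ _|f g _ _]; rewrite mulr0 ?mul0r addr0. Qed.

Lemma tangent_comb p a u v : tangent p u -> tangent p v ->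
  tangent p (fun f : M -> R => a * u f + v f).
Proof.
move=> Tu Tv; split=> [f nf|b f g Sf Sg|f g Sf Sg].
- by rewrite (tangent_nonsmooth Tu)// (tangent_nonsmooth Tv)// mulr0 addr0.
- by rewrite (tangentP Tu)// (tangentP Tv)//; ring.
- by rewrite (tangentM Tu)// (tangentM Tv)//; ring.
Qed.

Lemma tangent_scale p a u : tangent p u -> tangent p (fun f : M -> R => a * u f).
Proof.
move=> Tu; have := tangent_comb a Tu (tangent_zero p).
by congr (tangent p); apply/funext => f; rewrite addr0.
Qed.

Lemma tangent_lsum p (I : Type) (r : seq I) (a : I -> R) (u : I -> vec M) :
  (forall i, tangent p (u i)) -> tangent p (fun f => \sum_(i <- r) a i * u i f).
Proof.
move=> Tu; elim: r => [|i r IH].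
  by have := tangent_zero p; congr (tangent p); apply/funext => f; rewrite big_nil.
have := tangent_comb (a i) (Tu i) IH.
by congr (tangent p); apply/funext => f; rewrite big_cons.
Qed.

Definition cvec (c : chart 'rV[R]_n M) (p : M) (e : 'rV[R]_n) : vec M :=
  fun f => if `[< smooth_fun f >]
           then 'D_e (f \o chart_inv c : 'rV[R]_n -> R^o) (chart_map c p) else 0.

Lemma cvecE c p e f : smooth_fun f ->
  cvec c p e f = 'D_e (f \o chart_inv c : 'rV[R]_n -> R^o) (chart_map c p).
Proof. by move=> Sf; rewrite /cvec asboolT. Qed.

Lemma sf_chart c p f : charts c -> chart_dom c p -> smooth_fun f ->
  Cinf_at (chart_map c p) (f \o chart_inv c : 'rV[R]_n -> R^o).
Proof. by move=> cc dp /smooth_funP Sf; exact: rsm_chart. Qed.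

Lemma tangent_cvec c p e : charts c -> chart_dom c p -> tangent p (cvec c p e).
Proof.
move=> cc dp; have [fV cM lM kM] := pM; have [_ _ cK mc ic] := lM _ cc.
split=> [f nf|a f g Sf Sg|f g Sf Sg].
- by rewrite /cvec asboolF.
- have [Cf Cg] := (sf_chart cc dp Sf, sf_chart cc dp Sg).
  rewrite !cvecE//; last by apply: sfD => //; exact: sfZ.
  have := @deriveD _ _ _ (fun z => a *: (f (chart_inv c z) : R^o))
    (g \o chart_inv c : 'rV[R]_n -> R^o) (chart_map c p) e.
  move=> -> //; last exact: Cinf_at_derivable.
    by rewrite deriveZ//; exact: Cinf_at_derivable.
  by apply: derivableZ; exact: Cinf_at_derivable.
- have [Cf Cg] := (sf_chart cc dp Sf, sf_chart cc dp Sg).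
  rewrite !cvecE//; last exact: sfM.
  have := @deriveM _ _ (f \o chart_inv c) (g \o chart_inv c) (chart_map c p) e.
  move=> -> //; try exact: Cinf_at_derivable.
  rewrite -![_ *: _]/(_ * _) /= cK//; ring.
Qed.

(** In Hadamard's expansion of [f] at [p] the derivation kills the constant, and in each product
    only the term where it falls on the coordinate survives, since the coordinate increment vanishes
    at [p]. Coordinates and coefficients are local, hence the global functions [x] and the cutoff
    coefficients [G]. *)
Lemma tangent_rep c p (x : 'I_n -> M -> R) : charts c -> chart_dom c p ->
  (forall i, smooth_fun (x i)) ->
  (forall i, \forall q \near p, x i q = chart_map c q 0 i) ->
  forall v f, tangent p v -> v f = \sum_i v (x i) * cvec c p (delta_mx 0 i) f.
Proof.
move=> cc dp Sx xc v f Tv; have [fV cM lM kM] := pM.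
have [_ _ cK mc ic] := lM _ cc.
have [Sf|nSf] := pselect (smooth_fun f); last first.
  rewrite (tangent_nonsmooth Tv)// big1// => i _.
  by rewrite /cvec asboolF// mulr0.
have [d [d0 dC]] : exists d : R, 0 < d /\
    forall y, ball (chart_map c p) d y -> Cinf_at y (f \o chart_inv c : 'rV[R]_n -> R^o).
  have N1 := near_right_ball (Cinf_at_near (sf_chart cc dp Sf)).
  apply: (@filter_ex _ (0 : R)^'+); near=> d; split; last by near: d.
  by near: d; exact: nbhs_right_gt.
have [g [gC gE gD]] := hadamard dC.
have Up : nbhs p (chart_dom c `&` chart_map c @^-1` ball (chart_map c p) d).
  apply: filterI; first exact: chart_dom_near (lM _ cc) _ dp.
  by apply: (mc _ dp); exact: nbhsx_ballx.
have [s s0 sU] := chart_radius cc dp Up.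
have sdom : ball (chart_map c p) s `<=` chart_map c @` chart_dom c.
  by move=> y /sU[q [dq _] <-]; exists q.
have s40 : 0 < s / 4 by rewrite divr_gt0.
have s20 : 0 < 2 * (s / 4) by rewrite mulr_gt0.
have s2s : 2 * (s / 4) < s by lra.
pose K := cball c p (2 * (s / 4)).
have cK' : closed K by exact: (cball_closed cc sdom).
pose h := cbump c p (s / 4).
have Sh : smooth_fun h by exact: (smooth_cbump cc sdom).
have KU q : K q -> chart_dom c q /\ ball (chart_map c p) d (chart_map c q).
  move=> [dq qr]; have /sU[y [dy [_ yd]] yx] : ball (chart_map c p) s (chart_map c q).
    by rewrite -ball_normE /= distrC (le_lt_trans qr).
  by rewrite -yx.
pose G i q := h q * g i (chart_map c q).
have SG i : smooth_fun (G i).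
  apply: (smooth_cutoff cK' Sh) => [q nq|q /KU[dq qd]]; first exact: cbump_eq0.
  apply: (chart_rsm pM cc dq); have := gC i _ qd; apply: Cinf_at_eq.
  by have := chart_image_near (lM _ cc) dq; apply: filterS => z [_ /= ->].
have h1 : \forall q \near p, h q = 1.
  have N1 := chart_dom_near (lM _ cc) dp.
  have N2 : \forall q \near p, ball (chart_map c p) (s / 4) (chart_map c q).
    by apply: (mc _ dp); exact: nbhsx_ballx.
  apply: filterS2 N1 N2 => q dq; rewrite -ball_normE /= => qr.
  by apply: cbump_eq1 => //; rewrite distrC ltW.
have fE : \forall q \near p, f q = f p + \sum_i (x i q - x i p) * G i q.
  have X : \forall q \near p, forall i, x i q = chart_map c q 0 i.
    by apply: (@filter_forall _ _ (fun i q => x i q = chart_map c q 0 i) (nbhs p) _).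
  apply: filterS3 h1 Up X => q hq [dq qd] Xq.
  have := gE _ qd; rewrite /= !cK// => ->; congr (_ + _); apply: eq_bigr => i _.
  by rewrite /G hq mul1r Xq (nbhs_singleton (xc i)).
have SS i : smooth_fun (fun q => (x i q - x i p) * G i q).
  by apply: sfM => //; apply: sfB => //; exact: sf_cst.
rewrite (tangent_local Tv Sf _ fE); last by apply: sfD; [exact: sf_cst|exact: sf_sum].
rewrite (tangentD Tv); [|exact: sf_cst|exact: sf_sum].
rewrite (tangent_cst Tv) add0r (tangent_sum Tv)//; apply: eq_bigr => i _.
rewrite (tangentM Tv)//; last by apply: sfB => //; exact: sf_cst.
rewrite (tangentB Tv) ?(tangent_cst Tv)//; last exact: sf_cst.
rewrite subr0 subrr mul0r addr0 cvecE// -gD /G.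
by rewrite (nbhs_singleton h1) mul1r.
Unshelve. all: by end_near. Qed.

End tangent_vectors.

Section frames.
Context {R : realType} {n : nat} (M : manifold R n).
Let pM := premanifold_manifold M.

Lemma tangent_ext (p : M) (u v : vec M) : tangent p u -> tangent p v ->
  (forall f, smooth_fun f -> u f = v f) -> u = v.
Proof.
move=> Tu Tv uv; apply/funext => f; have [/uv//|nf] := pselect (smooth_fun f).
by rewrite (tangent_nonsmooth Tu)// (tangent_nonsmooth Tv).
Qed.

(* Dividing by [chi] near [p] gives a local frame; multiplied by [chi] the
   expansion holds on all of M, so that no partition of unity is needed. *)
Definition is_frame (I : finType) (chi : M -> R) (x : I -> M -> R)
    (E : I -> field M) : Prop :=
  [/\ smooth_fun chi, forall i, smooth_fun (x i), forall i, vector_field (E i) &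
      forall q v f, tangent q v -> chi q * v f = \sum_i v (x i) * E i q f].

Lemma frame_exists c p : charts c -> chart_dom c p ->
  exists (chi : M -> R) (x : 'I_n -> M -> R) (E : 'I_n -> field M),
  is_frame chi x E /\
  \forall q \near p, [/\ chi q = 1, chart_dom c q,
    forall i, \forall y \near q, x i y = chart_map c y 0 i &
    forall i, E i q = cvec c q (delta_mx 0 i)].
Proof.
move=> cc dp; have [fV cM lM kM] := pM.
have [_ _ cK mc ic] := lM _ cc.
have [s s0 sU] := chart_radius cc dp (@filterT _ (nbhs p) _).
have sdom : ball (chart_map c p) s `<=` chart_map c @` chart_dom c.
  by move=> y /sU[x [dx _] <-]; exists x.
(* [chi] vanishes outside radius [s / 4], inside the region of radius [s / 3] where [chi'] is 1, so
   the [x i] are true coordinates wherever [chi] is nonzero; and [chi'] vanishes outside radius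
   [2 * (s / 3) < s]. *)
have s80 : 0 < s / 8 by rewrite divr_gt0.
have s30 : 0 < s / 3 by rewrite divr_gt0.
pose chi := cbump c p (s / 8); pose chi' := cbump c p (s / 3).
have Schi : smooth_fun chi by apply: (smooth_cbump cc sdom) => //; lra.
have Schi' : smooth_fun chi' by apply: (smooth_cbump cc sdom) => //; lra.
pose x i y := chi' y * chart_map c y 0 i.
pose E i q f := chi q * cvec c q (delta_mx 0 i) f.
have cK1 : closed (cball c p (2 * (s / 8))) by apply: (cball_closed cc sdom); lra.
have cK2 : closed (cball c p (2 * (s / 3))) by apply: (cball_closed cc sdom); lra.
have Sx i : smooth_fun (x i).
  apply: (smooth_cutoff cK2 Schi') => [q nq|q [dq _]]; first exact: cbump_eq0.
  exact: rsm_coord.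
have TE i q : tangent q (E i q).
  have [dq|ndq] := pselect (chart_dom c q).
    by apply: tangent_scale; exact: tangent_cvec.
  have := tangent_zero q; congr (tangent q); apply/funext => f.
  by rewrite /E /chi /cbump asboolF// mul0r.
have near1 q : chart_dom c q -> `|chart_map c q - chart_map c p| < s / 3 ->
    forall i, \forall y \near q, x i y = chart_map c y 0 i.
  move=> dq qr i; have N1 := chart_dom_near (lM _ cc) dq.
  have N2 : \forall y \near q, ball (chart_map c p) (s / 3) (chart_map c y).
    apply: (mc _ dq); apply: open_nbhs_nbhs; split; first exact: ball_open.
    by rewrite -ball_normE /= distrC.
  apply: filterS2 N1 N2 => y dy; rewrite -ball_normE /= => yr.
  by rewrite /x /chi' cbump_eq1 ?mul1r// distrC ltW.
exists chi, x, E; split; first split => //.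
- move=> i; split=> // f Sf.
  apply: (smooth_cutoff cK1 Schi) => [q nq|q [dq _]]; first exact: cbump_eq0.
  apply: (chart_rsm pM cc dq).
  have := Cinf_at_derive (delta_mx 0 i) (sf_chart cc dq Sf); apply: Cinf_at_eq.
  have := chart_image_near (lM _ cc) dq; apply: filterS => z [dz zE] /=.
  by rewrite cvecE// zE.
- move=> q v f Tv; have [[dq qr]|nq] := pselect (cball c p (2 * (s / 8)) q).
    have qs : `|chart_map c q - chart_map c p| < s / 3.
      by apply: le_lt_trans qr _; lra.
    rewrite (tangent_rep cc dq Sx (near1 q dq qs) f Tv) mulr_sumr.
    by apply: eq_bigr => i _; rewrite /E mulrCA.
  have chi0 : chi q = 0 by apply: cbump_eq0.
  by rewrite chi0 mul0r big1// => i _; rewrite /E chi0 mul0r mulr0.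
- have N1 := chart_dom_near (lM _ cc) dp.
  have N2 : \forall y \near p, ball (chart_map c p) (s / 8) (chart_map c y).
    by apply: (mc _ dp); exact: nbhsx_ballx.
  apply: filterS2 N1 N2 => q dq; rewrite -ball_normE /= distrC => qr.
  have chi1 : chi q = 1 by apply: cbump_eq1 => //; exact: ltW.
  split => //; first by apply: near1 => //; lra.
  by move=> i; apply/funext => f; rewrite /E chi1 mul1r.
Qed.

Lemma cvec_sum (c : chart 'rV[R]_n M) p e f : charts c -> chart_dom c p ->
  cvec c p e f = \sum_i e 0 i * cvec c p (delta_mx 0 i) f.
Proof.
move=> cc dp; rewrite /cvec; case: asboolP => Sf.
  exact: (derive_row_sum _ (sf_chart cc dp Sf)).
by rewrite big1// => i _; rewrite mulr0.
Qed.

Lemma cvec_coord c p e i (x : M -> R) : charts c -> chart_dom c p ->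
  smooth_fun x -> (\forall y \near p, x y = chart_map c y 0 i) ->
  cvec c p e x = e 0 i.
Proof.
move=> cc dp Sx xc; have [fV cM lM kM] := pM; rewrite cvecE//.
pose l (z : 'rV[R]_n) : R^o := z 0 i.
have -> : e 0 i = 'D_e l (chart_map c p).
  by rewrite derive_linear//; [exact: coord_linear|exact: coord_continuous].
apply: near_eq_derive.
have N1 := chart_nbhs (lM _ cc) dp xc.
have N2 := chart_image_near (lM _ cc) dp.
by apply: filterS2 N1 N2 => z /= -> [_ ->].
Qed.

Lemma tangent_cvecP (c : chart 'rV[R]_n M) p v : charts c -> chart_dom c p -> tangent p v ->
  exists e, v = cvec c p e.
Proof.
move=> cc dp Tv; have [chi [x [E [[Sc Sx VE FE] near_p]]]] := frame_exists cc dp.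
have [_ _ xc _] := nbhs_singleton near_p.
exists (\row_i v (x i)); apply/funext => f.
rewrite (tangent_rep cc dp Sx xc f Tv) (cvec_sum _ _ cc dp).
by apply: eq_bigr => i _; rewrite !mxE.
Qed.

Lemma vector_field_extend p v : tangent p v -> exists2 X : field M,
  vector_field X & X p = v.
Proof.
move=> Tv; have [fV cM lM kM] := pM; have [c cc dp] := cM p.
have [chi [x [E [[Sc Sx VE FE] near_p]]]] := frame_exists cc dp.
have [c1 _ _ _] := nbhs_singleton near_p.
exists (fun q f => \sum_i v (x i) * E i q f).
  split=> [q|f Sf].
    by apply: (@tangent_lsum _ _ M q _ _ (fun i => v (x i)) (fun i => E i q)) => i; have [] := VE i.
  by apply: sf_sum => i; apply: sfZ; have [_] := VE i; exact.
by apply/funext => f; rewrite -(FE _ _ _ Tv) c1 mul1r.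
Qed.

End frames.

Lemma near_comp (S T : topologicalType) (g : S -> T) (x : S) (A : T -> Prop) :
  {for x, continuous g} -> (\forall y \near g x, A y) -> \forall y \near x, A (g y).
Proof. by move=> cg; exact: cg. Qed.

Section derive_pair.
Context {R : realType} (V W Z : normedModType R).

Lemma derive_pair_l (y e : V) (z : W) (f : V * W -> Z) : Cinf_at (y, z) f ->
  'D_(e, 0) f (y, z) = 'D_e (fun u => f (u, z)) y.
Proof.
move=> C; have Cl : Cinf_at y (fun u => (u, z)).
  by apply: Cinf_at_pair; [exact: Cinf_at_id|exact: Cinf_at_cst].
rewrite -[RHS]/('D_e (f \o (fun u => (u, z))) y) (derive_comp e C Cl).
rewrite (deriveE _ (Cinf_at_diff Cl)) (@diff_pair _ _ _ _ id (cst z))//=.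
by rewrite -!deriveE// ?derive_id ?derive_cst.
Qed.

Lemma derive_pair_r (y : V) (z e : W) (f : V * W -> Z) : Cinf_at (y, z) f ->
  'D_(0, e) f (y, z) = 'D_e (fun u => f (y, u)) z.
Proof.
move=> C; have Cr : Cinf_at z (fun u => (y, u)).
  by apply: Cinf_at_pair; [exact: Cinf_at_cst|exact: Cinf_at_id].
rewrite -[RHS]/('D_e (f \o (fun u => (y, u))) z) (derive_comp e C Cr).
rewrite (deriveE _ (Cinf_at_diff Cr)) (@diff_pair _ _ _ _ (cst y) id)//=.
by rewrite -!deriveE// ?derive_id ?derive_cst.
Qed.

End derive_pair.

(** * Derivations in either variable of a function on a product *)

Section product.
Context {R : realType} {k n : nat} (P : manifold R k) (Q : manifold R n).
Let pP := premanifold_manifold P.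
Let pQ := premanifold_manifold Q.
Variable F : P -> Q -> R.
Hypothesis SF : forall pq, rsm (M := prod_charted P Q) (fun pq => F pq.1 pq.2) pq.

Lemma slice_l q : smooth_fun (fun p => F p q).
Proof.
apply: rsm_sf => p.
apply: (@smooth_at_comp _ _ _ _ P (prod_charted P Q) (real_line R)
  (fun p => (p, q)) (fun pq => F pq.1 pq.2) p pP (premanifold_prod pP pQ)) => //.
  exact: SF.
by apply: smooth_at_pair; [exact: smooth_at_id|exact: smooth_at_cst].
Qed.

Lemma slice_r p : smooth_fun (F p).
Proof.
apply: rsm_sf => q.
apply: (@smooth_at_comp _ _ _ _ Q (prod_charted P Q) (real_line R)
  (fun q => (p, q)) (fun pq => F pq.1 pq.2) q pQ (premanifold_prod pP pQ)) => //.
  exact: SF.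
by apply: smooth_at_pair; [exact: smooth_at_cst|exact: smooth_at_id].
Qed.

Section local.
Variables (c : chart 'rV[R]_k P) (d : chart 'rV[R]_n Q) (p : P) (q : Q).
Hypotheses (cc : charts c) (cd : charts d) (dp : chart_dom c p) (dq : chart_dom d q).

Definition local_rep (yz : 'rV[R]_k * 'rV[R]_n) : R^o :=
  F (chart_inv c yz.1) (chart_inv d yz.2).

Lemma Cinf_local_rep : Cinf_at (chart_map c p, chart_map d q) local_rep.
Proof.
have cp : charts (prod_chart c d : chart _ (prod_charted P Q)) by exists c, d.
exact: (@rsm_chart _ _ (prod_charted P Q) _ (p, q) (prod_chart c d) (SF (p, q)) cp).
Qed.

End local.

Lemma smooth_partial_l (p : P) (v : vec P) : tangent p v ->
  smooth_fun (fun q => v (fun p => F p q)).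
Proof.
move=> Tv; have [_ cP lP _] := pP; have [_ cQ lQ _] := pQ.
have [c cc dp] := cP p; have [e ->] := tangent_cvecP cc dp Tv.
apply: rsm_sf => q; have [d cd dq] := cQ q.
apply: (chart_rsm pQ cd dq); have C := Cinf_local_rep cc cd dp dq.
have C1 : Cinf_at (chart_map d q) (fun z => (chart_map c p, z)).
  by apply: Cinf_at_pair; [exact: Cinf_at_cst|exact: Cinf_at_id].
have := Cinf_at_comp (findim_prod (findim_rV k) (findim_rV n))
  (Cinf_at_derive (e, 0) C) C1.
apply: Cinf_at_eq.
have := near_comp (Cinf_at_continuous C1) (Cinf_at_near C); apply: filterS => z /= Cz.
rewrite cvecE; last exact: slice_l.
by rewrite derive_pair_l.
Qed.

Lemma smooth_partial_r (q : Q) (v : vec Q) : tangent q v ->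
  smooth_fun (fun p => v (F p)).
Proof.
move=> Tv; have [_ cP lP _] := pP; have [_ cQ lQ _] := pQ.
have [d cd dq] := cQ q; have [e ->] := tangent_cvecP cd dq Tv.
apply: rsm_sf => p; have [c cc dp] := cP p.
apply: (chart_rsm pP cc dp); have C := Cinf_local_rep cc cd dp dq.
have C1 : Cinf_at (chart_map c p) (fun z => (z, chart_map d q)).
  by apply: Cinf_at_pair; [exact: Cinf_at_id|exact: Cinf_at_cst].
have := Cinf_at_comp (findim_prod (findim_rV k) (findim_rV n))
  (Cinf_at_derive (0, e) C) C1.
apply: Cinf_at_eq.
have := near_comp (Cinf_at_continuous C1) (Cinf_at_near C); apply: filterS => z /= Cz.
rewrite cvecE; last exact: slice_r.
by rewrite derive_pair_r.
Qed.

(** In a product chart this is Schwarz's theorem for the directions [(e, 0)] and [(0, b)]. Applied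
    to functions on G x M, it lets Lie derivatives along fundamental fields be computed at the unit
    of the group. *)
Lemma tangent_swap (p : P) (q : Q) (u : vec P) (v : vec Q) :
  tangent p u -> tangent q v ->
  u (fun p => v (F p)) = v (fun q => u (fun p => F p q)).
Proof.
move=> Tu Tv; have Su := smooth_partial_l Tu; have Sv := smooth_partial_r Tv.
have [_ cP lP _] := pP; have [_ cQ lQ _] := pQ.
have [c cc dp] := cP p; have [d cd dq] := cQ q.
have C := Cinf_local_rep cc cd dp dq.
have [e uE] := tangent_cvecP cc dp Tu; have [b vE] := tangent_cvecP cd dq Tv.
have C1 : Cinf_at (chart_map c p) (fun z => (z, chart_map d q)).
  by apply: Cinf_at_pair; [exact: Cinf_at_id|exact: Cinf_at_cst].
have C2 : Cinf_at (chart_map d q) (fun z => (chart_map c p, z)).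
  by apply: Cinf_at_pair; [exact: Cinf_at_cst|exact: Cinf_at_id].
rewrite {1}uE cvecE// [in RHS]vE cvecE//.
transitivity ('D_(e, 0) ('D_(0, b) (local_rep c d)) (chart_map c p, chart_map d q)).
  rewrite derive_pair_l; last exact: Cinf_at_derive.
  apply: near_eq_derive.
  have := near_comp (Cinf_at_continuous C1) (Cinf_at_near C); apply: filterS => z /= Cz.
  by rewrite derive_pair_r// vE cvecE//; exact: slice_r.
rewrite schwarz//; last by apply: findim_prod; exact: findim_rV.
rewrite derive_pair_r; last exact: Cinf_at_derive.
apply: near_eq_derive.
have := near_comp (Cinf_at_continuous C2) (Cinf_at_near C); apply: filterS => z /= Cz.
by rewrite derive_pair_l// uE cvecE//; exact: slice_l.
Qed.

End product.

(** Six alternating exchanges run through all orders of the arguments and return to the first with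
    three minus signs. This is the algebra behind Koszul's formula and the uniqueness of a metric
    connection with given torsion. *)
Lemma sym_skew_zero (R : realType) (T : Type) (P : T -> Prop) (t : T -> T -> T -> R) :
  (forall X Y Z, P X -> P Y -> P Z -> t X Y Z = t Y X Z) ->
  (forall X Y Z, P X -> P Y -> P Z -> t X Y Z = - t X Z Y) ->
  forall X Y Z, P X -> P Y -> P Z -> t X Y Z = 0.
Proof.
move=> sym skew X Y Z PX PY PZ.
have e : t X Y Z = - t X Y Z.
  by rewrite {1}sym// skew// sym// skew// sym// skew// !opprK.
by lra.
Qed.

(** * Vector fields, tensorial operators and their traces *)

Section fields.
Context {R : realType} {n : nat} {M : manifold R n}.
Notation vf := (@vector_field R n M).
Implicit Types (X Y Z V W : field M) (u v : vec M) (f g h : M -> R) (p q : M).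

Lemma vf_tangent X p : vf X -> tangent p (X p).
Proof. by case. Qed.

Lemma vf_sf X f : vf X -> smooth_fun f -> smooth_fun (fun p => X p f).
Proof. by move=> [_]; exact. Qed.

Lemma vf_ext X Y : vf X -> vf Y ->
  (forall p f, smooth_fun f -> X p f = Y p f) -> X = Y.
Proof.
move=> vX vY XY; apply/funext => p.
by apply: (tangent_ext (vf_tangent p vX) (vf_tangent p vY)) => f; exact: XY.
Qed.

Lemma tangent_addv p u v : tangent p u -> tangent p v -> tangent p (u + v).
Proof.
move=> Tu Tv; have := tangent_comb 1 Tu Tv; congr (tangent p).
by apply/funext => f; rewrite mul1r.
Qed.

Lemma tangent_oppv p u : tangent p u -> tangent p (- u).
Proof.
move=> Tu; have := tangent_scale (-1) Tu; congr (tangent p).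
by apply/funext => f; rewrite mulN1r.
Qed.

Lemma tangent_subv p u v : tangent p u -> tangent p v -> tangent p (u - v).
Proof. by move=> Tu Tv; apply: tangent_addv => //; exact: tangent_oppv. Qed.

Lemma vf_comb h X Y : smooth_fun h -> vf X -> vf Y ->
  vf (fun p f => h p * X p f + Y p f).
Proof.
move=> Sh vX vY; split=> [p|f Sf].
  by apply: tangent_comb; exact: vf_tangent.
by apply: sfD; [apply: sfM => //|]; exact: vf_sf.
Qed.

Lemma vf_add X Y : vf X -> vf Y -> vf (X + Y).
Proof.
move=> vX vY; split=> [p|f Sf]; first by apply: tangent_addv; exact: vf_tangent.
by apply: sfD; exact: vf_sf.
Qed.

Lemma vf_opp X : vf X -> vf (- X).
Proof.
move=> vX; split=> [p|f Sf]; first by apply: tangent_oppv; exact: vf_tangent.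
by apply: sfN; exact: vf_sf.
Qed.

Lemma vf_sub X Y : vf X -> vf Y -> vf (X - Y).
Proof. by move=> vX vY; apply: vf_add => //; exact: vf_opp. Qed.

Lemma vf_zero : vf (fun _ _ => 0).
Proof. by split=> [p|f _]; [exact: tangent_zero|exact: sf_cst]. Qed.

Lemma vf_scale h X : smooth_fun h -> vf X -> vf (fun p f => h p * X p f).
Proof.
move=> Sh vX; split=> [p|f Sf]; first by apply: tangent_scale; exact: vf_tangent.
by apply: sfM => //; exact: vf_sf.
Qed.

Lemma vf_bracket X Y : vf X -> vf Y -> vf (bracket X Y).
Proof.
move=> vX vY; split=> [p|f Sf]; last by apply: sfB; apply: vf_sf => //; exact: vf_sf.
have [Xp Yp] := (vf_tangent p vX, vf_tangent p vY).
split=> [f nf|a f g Sf Sg|f g Sf Sg]; rewrite /bracket.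
- have -> : (fun q => Y q f) = fun=> 0.
    by apply/funext => q; exact: (tangent_nonsmooth (vf_tangent q vY)).
  have -> : (fun q => X q f) = fun=> 0.
    by apply/funext => q; exact: (tangent_nonsmooth (vf_tangent q vX)).
  by rewrite (tangent0 Xp) (tangent0 Yp) subrr.
- have -> : (fun q => Y q (fun x => a * f x + g x)) = fun q => a * Y q f + Y q g.
    by apply/funext => q; exact: (tangentP (vf_tangent q vY)).
  have -> : (fun q => X q (fun x => a * f x + g x)) = fun q => a * X q f + X q g.
    by apply/funext => q; exact: (tangentP (vf_tangent q vX)).
  rewrite (tangentP Xp) ?(tangentP Yp); try exact: vf_sf.
  by ring.
- have -> : (fun q => Y q (fun x => f x * g x)) = fun q => Y q f * g q + f q * Y q g.
    by apply/funext => q; exact: (tangentM (vf_tangent q vY)).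
  have -> : (fun q => X q (fun x => f x * g x)) = fun q => X q f * g q + f q * X q g.
    by apply/funext => q; exact: (tangentM (vf_tangent q vX)).
  have [SXf SXg] := (vf_sf vX Sf, vf_sf vX Sg).
  have [SYf SYg] := (vf_sf vY Sf, vf_sf vY Sg).
  rewrite (tangentD Xp) ?(tangentM Xp) ?(tangentD Yp) ?(tangentM Yp) //; try exact: sfM.
  by ring.
Qed.

Lemma bracketC X Y : bracket X Y = - bracket Y X.
Proof. by apply/funext => p; apply/funext => f; rewrite !fctE /bracket opprB. Qed.

Lemma bracket_addr V X Y : vf V -> vf X -> vf Y ->
  bracket V (X + Y) = bracket V X + bracket V Y.
Proof.
move=> vV vX vY; apply: vf_ext => [||p f Sf].
- by apply: vf_bracket => //; exact: vf_add.
- by apply: vf_add; exact: vf_bracket.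
rewrite !fctE /bracket !fctE (tangentD (vf_tangent p vV)); try exact: vf_sf.
by ring.
Qed.

Lemma bracket_oppr V X : vf V -> vf X -> bracket V (- X) = - bracket V X.
Proof.
move=> vV vX; apply: vf_ext => [||p f Sf].
- by apply: vf_bracket => //; exact: vf_opp.
- by apply: vf_opp; exact: vf_bracket.
rewrite !fctE /bracket !fctE (tangentN (vf_tangent p vV)); try exact: vf_sf.
by ring.
Qed.

Lemma bracket_subr V X Y : vf V -> vf X -> vf Y ->
  bracket V (X - Y) = bracket V X - bracket V Y.
Proof.
by move=> vV vX vY; rewrite bracket_addr ?bracket_oppr//; exact: vf_opp.
Qed.

Lemma jacobi X Y Z : vf X -> vf Y -> vf Z ->
  bracket X (bracket Y Z) = bracket (bracket X Y) Z + bracket Y (bracket X Z).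
Proof.
move=> vX vY vZ; have [[vXY vXZ] vYZ] := (vf_bracket vX vY, vf_bracket vX vZ, vf_bracket vY vZ).
apply: vf_ext => [||p f Sf]; first exact: vf_bracket.
  by apply: vf_add; exact: vf_bracket.
rewrite !fctE /bracket.
rewrite (tangentB (vf_tangent p vX)) ?(tangentB (vf_tangent p vY)) ?(tangentB (vf_tangent p vZ));
  try by do !apply: vf_sf => //.
by ring.
Qed.

(** Endomorphisms of the tangent bundle are handled as operators on global fields, linear over the
    smooth functions; their values matter on vector fields only. *)
Definition tensorial (B : field M -> field M) : Prop :=
  (forall Z, vf Z -> vf (B Z)) /\
  forall h X Y, smooth_fun h -> vf X -> vf Y ->
    B (fun p f => h p * X p f + Y p f) = (fun p f => h p * B X p f + B Y p f).

Section tensor.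
Variable B : field M -> field M.
Hypothesis TB : tensorial B.

Lemma tensor_zero : B (fun _ _ => 0) = fun _ _ => 0.
Proof.
(* Since 0 is [-1 * 0 + 0], the value [B 0] equals [- B 0 + B 0]. *)
have [_ lB] := TB; have := lB (fun=> -1) _ _ (sf_cst M (-1)) vf_zero vf_zero.
have E0 : (fun (p : M) (f : M -> R) => -1 * 0 + 0 : R) = fun _ _ => 0.
  by apply/funext => p; apply/funext => f; rewrite mulr0 addr0.
rewrite E0 => e; rewrite {1}e.
by apply/funext => p; apply/funext => f; rewrite mulN1r addNr.
Qed.

Lemma vf_lsum (I : Type) (r : seq I) (c : I -> M -> R) (E : I -> field M) :
  (forall i, smooth_fun (c i)) -> (forall i, vf (E i)) ->
  vf (fun p f => \sum_(i <- r) c i p * E i p f).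
Proof.
move=> Sc vE; split=> [p|f Sf].
  by apply: (@tangent_lsum _ _ M p _ r (c^~ p) (E^~ p)) => i; exact: vf_tangent.
by apply: sf_sum => i; apply: sfM => //; exact: vf_sf.
Qed.

Lemma tensor_sum (I : Type) (r : seq I) (c : I -> M -> R) (E : I -> field M) :
  (forall i, smooth_fun (c i)) -> (forall i, vf (E i)) ->
  B (fun p f => \sum_(i <- r) c i p * E i p f) =
  (fun p f => \sum_(i <- r) c i p * B (E i) p f).
Proof.
move=> Sc vE; elim: r => [|i r IH].
  rewrite (_ : (fun _ _ => _) = fun _ _ => 0); last first.
    by apply/funext => p; apply/funext => f; rewrite big_nil.
  by rewrite tensor_zero; apply/funext => p; apply/funext => f; rewrite big_nil.
have -> : (fun p f => \sum_(j <- i :: r) c j p * E j p f) =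
   (fun p f => c i p * E i p f + \sum_(j <- r) c j p * E j p f).
  by apply/funext => p; apply/funext => f; rewrite big_cons.
rewrite TB.2//; last exact: vf_lsum.
by rewrite IH; apply/funext => p; apply/funext => f; rewrite big_cons.
Qed.

Lemma tensor_scale h X : smooth_fun h -> vf X ->
  B (fun p f => h p * X p f) = (fun p f => h p * B X p f).
Proof.
move=> Sh vX; have := @tensor_sum unit [:: tt] (fun=> h) (fun=> X) (fun=> Sh) (fun=> vX).
rewrite (_ : (fun _ _ => _) = fun p f => h p * X p f); last first.
  by apply/funext => p; apply/funext => f; rewrite big_seq1.
by move=> ->; apply/funext => p; apply/funext => f; rewrite big_seq1.
Qed.

(** This contains the locality of [B]: where [chi] is nonzero, [B Z p] depends on [Z p] only. *)
Lemma tensor_frame (I : finType) chi (x : I -> M -> R) (E : I -> field M) Z p f :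
  is_frame chi x E -> vf Z ->
  chi p * B Z p f = \sum_i Z p (x i) * B (E i) p f.
Proof.
move=> [Sc Sx vE FE] vZ.
have := @tensor_sum I (index_enum I) (fun i q => Z q (x i)) E (fun i => vf_sf vZ (Sx i)) vE.
have -> : (fun q f => \sum_i Z q (x i) * E i q f) = (fun q f => chi q * Z q f).
  by apply/funext => q; apply/funext => g; rewrite FE//; exact: vf_tangent.
by rewrite tensor_scale// => /(congr1 (fun Y : field M => Y p f)).
Qed.

End tensor.

Definition frame_at p (I : finType) (x : I -> M -> R) (E : I -> field M) : Prop :=
  [/\ forall i, smooth_fun (x i), forall i, vf (E i) &
      forall v f, tangent p v -> v f = \sum_i v (x i) * E i p f].

Lemma is_frame_at p (I : finType) chi (x : I -> M -> R) (E : I -> field M) :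
  is_frame chi x E -> chi p = 1 -> frame_at p x E.
Proof.
by move=> [Sc Sx vE FE] c1; split=> // v f Tv; rewrite -FE// c1 mul1r.
Qed.

Lemma frame_around p : exists chi (x : 'I_n -> M -> R) (E : 'I_n -> field M),
  is_frame chi x E /\ \forall q \near p, chi q = 1.
Proof.
have [_ cM _ _] := premanifold_manifold M; have [c cc dp] := cM p.
have [chi [x [E [F near_p]]]] := frame_exists cc dp.
by exists chi, x, E; split => //; apply: filterS near_p => q [].
Qed.

(** A frame is chosen independently at each point. The smoothness of the trace appears only after
    [tr_frame] has replaced these choices by one frame valid near a point. *)
Definition tr (B : field M -> field M) p : R :=
  let xE := cid (frame_around p) in
  let xE' := cid (projT2 xE) in
  let x := projT1 xE' in let E := projT1 (cid (projT2 xE')) in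
  \sum_i B (E i) p (x i).

Lemma tr_spec p : exists (x : 'I_n -> M -> R) (E : 'I_n -> field M),
  frame_at p x E /\ forall B, tr B p = \sum_i B (E i) p (x i).
Proof.
set xE := cid (frame_around p); set xE' := cid (projT2 xE).
exists (projT1 xE'), (projT1 (cid (projT2 xE'))); split; last by [].
have [F c1] := projT2 (cid (projT2 xE')).
by apply: (is_frame_at F); exact: nbhs_singleton c1.
Qed.

Lemma tr_frame B (I : finType) chi (x : I -> M -> R) (E : I -> field M) p :
  tensorial B -> is_frame chi x E ->
  chi p * tr B p = \sum_i B (E i) p (x i).
Proof.
move=> TB F; have [x' [E' [[Sx' vE' FE'] ->]]] := tr_spec p.
have [Sc Sx vE FE] := F.
rewrite mulr_sumr.
under eq_bigr do rewrite (tensor_frame TB _ _ F (vE' _)).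
rewrite exchange_big /=; apply: eq_bigr => i _.
rewrite [RHS](FE' _ _ (vf_tangent p (TB.1 _ (vE i)))).
by apply: eq_bigr => j _; rewrite mulrC.
Qed.

Lemma frame_at_tensor B p (I : finType) (x : I -> M -> R) (E : I -> field M) Z f :
  tensorial B -> frame_at p x E -> vf Z ->
  B Z p f = \sum_i Z p (x i) * B (E i) p f.
Proof.
move=> TB [Sx vE FE] vZ; have [chi [x' [E' [F c1]]]] := frame_around p.
have c1p := nbhs_singleton c1.
rewrite -[LHS]mul1r -c1p (tensor_frame TB _ _ F vZ).
have [Sc Sx' vE' FE'] := F.
under [RHS]eq_bigr => i _.
  rewrite -[B (E i) p f]mul1r -c1p (tensor_frame TB _ _ F (vE i)).
  rewrite mulr_sumr; over.
rewrite exchange_big /=; apply: eq_bigr => j _.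
rewrite (FE _ _ (vf_tangent p vZ)) mulr_suml.
by apply: eq_bigr => i _; rewrite mulrA.
Qed.

Lemma trE B p (I : finType) (x : I -> M -> R) (E : I -> field M) :
  tensorial B -> frame_at p x E -> tr B p = \sum_i B (E i) p (x i).
Proof.
move=> TB F; have [x' [E' [F' ->]]] := tr_spec p.
have [[Sx vE FE] [Sx' vE' FE']] := (F, F').
under eq_bigr do rewrite (frame_at_tensor _ TB F (vE' _)).
rewrite exchange_big /=; apply: eq_bigr => i _.
rewrite [RHS](FE' _ _ (vf_tangent p (TB.1 _ (vE i)))).
by apply: eq_bigr => j _; rewrite mulrC.
Qed.

Lemma sf_tr B : tensorial B -> smooth_fun (tr B).
Proof.
move=> TB; apply: rsm_sf => p; have [chi [x [E [F c1]]]] := frame_around p.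
have [Sc Sx vE FE] := F.
apply: (@rsm_eq _ _ M (premanifold_manifold M) (fun q => \sum_i B (E i) q (x i))).
  by apply: filterS c1 => q c1; rewrite -(tr_frame q TB F) c1 mul1r.
by apply: sf_rsm; apply: sf_sum => i; apply: vf_sf => //; exact: TB.1.
Qed.

Lemma tr_comp A B p : tensorial A -> tensorial B ->
  tr (fun Z => A (B Z)) p = tr (fun Z => B (A Z)) p.
Proof.
move=> TA TB; have [x [E [F trE']]] := tr_spec p; rewrite !trE'.
have [Sx vE FE] := F.
under eq_bigr do rewrite (frame_at_tensor _ TA F (TB.1 _ (vE _))).
under [RHS]eq_bigr do rewrite (frame_at_tensor _ TB F (TA.1 _ (vE _))).
rewrite exchange_big /=; apply: eq_bigr => i _; apply: eq_bigr => j _.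
by rewrite mulrC.
Qed.

(** [S] holds the components of the basis [E'] in the frame, [C] those of the frame in [E'].
    Uniqueness of coordinates in the basis gives [S *m C = 1%:M], so the matrix [D] of [A] in the
    frame is conjugate to the transpose of [a]. *)
Lemma is_trace_atE A p t : tensorial A -> is_trace_at A p t -> t = tr A p.
Proof.
move=> TA [E' [a [vE' bE' AE' ->]]]; have [x [E [F ->]]] := tr_spec p.
have [Sx vE FE] := F.
pose S := \matrix_(j, l) E' j p (x l); pose D := \matrix_(l, m) A (E l) p (x m).
pose C := \matrix_(l, j) (projT1 (cid (bE' _ (vf_tangent p (vE l)))) : 'rV_n) 0 j.
have E'n (j : 'I_n) : vf (E' j) by [].
have EC l f : E l p f = \sum_j C l j * E' j p f.
  have [+ _] := projT2 (cid (bE' _ (vf_tangent p (vE l)))).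
  by move=> /(_ f) ->; apply: eq_bigr => j _; rewrite mxE.
have SD : S *m D = a^T *m S.
  apply/matrixP => j m; rewrite !mxE.
  have := AE' j (x m); rewrite (frame_at_tensor _ TA F (vE' j)) => h.
  under eq_bigr do rewrite !mxE.
  by rewrite h; apply: eq_bigr => i _; rewrite !mxE.
have SC : S *m C = 1%:M.
  apply/matrixP => j l; rewrite !mxE.
  have [c [_ cU]] := bE' _ (vf_tangent p (vE' j)).
  have c1 : c = delta_mx 0 j.
    apply: cU => f; rewrite (bigD1 j)//= mxE !eqxx mul1r big1 ?addr0// => i ij.
    by rewrite mxE eqxx (negbTE ij) mul0r.
  have c2 : c = \row_k (S *m C) j k.
    apply: cU => f; rewrite (FE _ f (vf_tangent p (vE' j))).
    under [RHS]eq_bigr do rewrite !mxE mulr_suml.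
    rewrite exchange_big /=; apply: eq_bigr => i _.
    rewrite EC mulr_sumr; apply: eq_bigr => k _.
    by rewrite !mxE mulrA.
  have := congr1 (fun r : 'rV_n => r 0 l) c2; rewrite c1 !mxE => <-.
  by rewrite eqxx eq_sym.
have -> : \sum_i A (E i) p (x i) = \tr D by apply: eq_bigr => i _; rewrite mxE.
have CS := mulmx1C SC.
by rewrite -[D]mul1mx -CS -mulmxA SD mxtrace_mulC -mulmxA SC mulmx1 mxtrace_tr.
Qed.

(** The Lie derivative commutes with contraction. Expanding the derivative of [chi * tr B] leaves,
    besides the wanted trace, terms with [V (x i)], [bracket V (E i)] and [V chi]; these cancel by
    contracting [B] with the derivative of the frame expansion. *)
Lemma tr_lie V B p : vf V -> tensorial B ->
  tensorial (fun Z => bracket V (B Z) - B (bracket V Z)) ->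
  V p (tr B) = tr (fun Z => bracket V (B Z) - B (bracket V Z)) p.
Proof.
move=> vV TB TLB; have [chi [x [E [F c1]]]] := frame_around p.
have [Sc Sx vE FE] := F; have c1p := nbhs_singleton c1.
have VT := vf_tangent p vV.
have SBx i : smooth_fun (fun q => B (E i) q (x i)) by apply: vf_sf => //; exact: TB.1.
(* The Lie derivative along [V] of the frame expansion of [Z]: the terms in [bracket V Z] cancel,
   leaving the derivatives of [chi], of the [x i] and of the [E i]. *)
have key Z : vf Z -> (fun q f => V q chi * Z q f) =
   (fun q f => (\sum_i Z q (fun y => V y (x i)) * E i q f) +
               \sum_i Z q (x i) * bracket V (E i) q f).
  move=> vZ; apply: vf_ext => [||q f Sf].
  - by apply: vf_scale => //; exact: vf_sf.
  - apply: vf_add; apply: vf_lsum => // i; try exact: vf_bracket.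
      by apply: vf_sf => //; exact: vf_sf.
    exact: vf_sf.
  have VTq := vf_tangent q vV; have vVZ := vf_bracket vV vZ.
  have Sf' := vf_sf vZ Sf.
  have h1 : (fun y => chi y * Z y f) = (fun y => \sum_i Z y (x i) * E i y f).
    by apply/funext => y; rewrite FE//; exact: vf_tangent.
  have h2 : V q (fun y => chi y * Z y f) = V q chi * Z q f + chi q * V q (fun y => Z y f).
    exact: (tangentM VTq Sc Sf').
  have h3 : V q (fun y => \sum_i Z y (x i) * E i y f) =
      \sum_i (V q (fun y => Z y (x i)) * E i q f + Z q (x i) * V q (fun y => E i y f)).
    rewrite (tangent_sum VTq); last by move=> i; apply: sfM; exact: vf_sf.
    by apply: eq_bigr => i _; apply: (tangentM VTq); exact: vf_sf.
  have h4 := FE q _ f (vf_tangent q vVZ); rewrite /bracket in h4.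
  have h5 := FE q _ (fun y => V y f) (vf_tangent q vZ).
  rewrite h1 h3 in h2.
  have -> : V q chi * Z q f = \sum_i (V q (fun y => Z y (x i)) * E i q f +
     Z q (x i) * V q (fun y => E i y f)) - chi q * V q (fun y => Z y f).
    by rewrite h2 addrK.
  have -> : chi q * V q (fun y => Z y f) = chi q * (V q (fun y => Z y f) - Z q (fun y => V y f))
     + chi q * Z q (fun y => V y f) by ring.
  rewrite h4 h5 -!big_split/= -sumrB; apply: eq_bigr => i _.
  by rewrite /bracket; ring.
have e1 : V p (fun q => chi q * tr B q) =
    \sum_i (bracket V (B (E i)) p (x i) + B (E i) p (fun y => V y (x i))).
  have -> : (fun q => chi q * tr B q) = (fun q => \sum_i B (E i) q (x i)).
    by apply/funext => q; rewrite (tr_frame q TB F).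
  rewrite (tangent_sum VT)//; apply: eq_bigr => i _.
  by rewrite /bracket subrK.
have e2 := tr_frame p TLB F.
rewrite c1p mul1r in e2.
rewrite (tangentM VT)// in e1; last exact: sf_tr.
rewrite c1p mul1r in e1.
have [x' [E' [F' trE']]] := tr_spec p; have [Sx' vE' FE'] := F'.
have e3 : V p chi * tr B p = \sum_i (B (E i) p (fun y => V y (x i))
    + B (bracket V (E i)) p (x i)).
  rewrite trE' mulr_sumr.
  have h j : V p chi * B (E' j) p (x' j) =
     (\sum_i E' j p (fun y => V y (x i)) * B (E i) p (x' j)) +
     \sum_i E' j p (x i) * B (bracket V (E i)) p (x' j).
    have Sv := vf_sf vV Sc.
    have := tensor_scale TB Sv (vE' j).
    rewrite (key _ (vE' j)) => /(congr1 (fun Y : field M => Y p (x' j))) <-.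
    have Si i : smooth_fun (fun q => E' j q (fun y => V y (x i))).
      by apply: vf_sf => //; exact: vf_sf.
    have vi i : vf (bracket V (E i)) by exact: vf_bracket.
    have Sj i : smooth_fun (fun q => E' j q (x i)) by exact: vf_sf.
    have := TB.2 (fun=> 1) _ _ (sf_cst M 1) (vf_lsum (index_enum _) Si vE) (vf_lsum (index_enum _) Sj vi).
    rewrite !(tensor_sum TB)//.
    rewrite (_ : (fun q f => 1 * _ + _) = (fun q f => (\sum_i E' j q (fun y => V y (x i)) * E i q f) +
               \sum_i E' j q (x i) * bracket V (E i) q f)); last first.
      by apply/funext => q; apply/funext => f; rewrite mul1r.
    by move=> ->; rewrite mul1r.
  under eq_bigr do rewrite h.
  rewrite !big_split /=; congr (_ + _); rewrite exchange_big /=; apply: eq_bigr => i _.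
    rewrite [RHS](FE' _ _ (vf_tangent p (TB.1 _ (vE i)))).
    by apply: eq_bigr => j _; rewrite mulrC.
  rewrite [RHS](FE' _ _ (vf_tangent p (TB.1 _ (vf_bracket vV (vE i))))).
  by apply: eq_bigr => j _; rewrite mulrC.
rewrite e2; rewrite e3 in e1.
have -> : V p (tr B) = \sum_i (bracket V (B (E i)) p (x i) + B (E i) p (fun y => V y (x i)))
   - \sum_i (B (E i) p (fun y => V y (x i)) + B (bracket V (E i)) p (x i)).
  by rewrite -e1 addrAC subrr add0r.
by rewrite -sumrB; apply: eq_bigr => i _; rewrite !fctE; ring.
Qed.

End fields.

(** * The Chern connection *)

Section geometry.
Context {R : realType} {n : nat} {M : manifold R n}.
Notation vf := (@vector_field R n M).
Implicit Types (X Y Z U V : field M) (u v z : vec M) (f g h : M -> R) (p q : M).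

Lemma field_addE X Y p f : (X + Y) p f = X p f + Y p f. Proof. by []. Qed.
Lemma field_oppE X p f : (- X) p f = - X p f. Proof. by []. Qed.
Lemma field_zeroE p f : (0 : field M) p f = 0. Proof. by []. Qed.
Lemma field_mul4E X p f : (X *+ 4) p f = 4 * X p f.
Proof. by rewrite mulr_natl !mulrS !mulr0n. Qed.
Definition fldE := (field_addE, field_oppE, field_zeroE, field_mul4E).

Section form.
Variable w : M -> vec M -> vec M -> R.
Hypothesis Tw : two_form w.

Lemma form_addl p u v z : tangent p u -> tangent p v -> tangent p z ->
  w p (u + v) z = w p u z + w p v z.
Proof.
move=> Tu Tv Tz; have [lw _ _] := Tw; rewrite -[w p u z]mul1r -lw//.
by congr (w p _ z); apply/funext => f; rewrite mul1r.
Qed.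

Lemma form_zerol p z : tangent p z -> w p (fun=> 0) z = 0.
Proof.
move=> Tz; have := form_addl (tangent_zero p) (tangent_zero p) Tz.
rewrite (_ : (fun=> 0) + (fun=> 0) = fun=> 0); last by apply/funext => f; rewrite !fctE addr0.
by lra.
Qed.

Lemma form_scalel p a u z : tangent p u -> tangent p z ->
  w p (fun f => a * u f) z = a * w p u z.
Proof.
move=> Tu Tz; have [lw _ _] := Tw; have := lw p a _ _ _ Tu (tangent_zero p) Tz.
rewrite form_zerol// addr0 => <-.
by congr (w p _ z); apply/funext => f; rewrite addr0.
Qed.

Lemma form_oppl p u z : tangent p u -> tangent p z -> w p (- u) z = - w p u z.
Proof.
move=> Tu Tz; rewrite -[RHS]mulN1r -form_scalel//.
by congr (w p _ z); apply/funext => f; rewrite mulN1r.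
Qed.

Lemma form_subl p u v z : tangent p u -> tangent p v -> tangent p z ->
  w p (u - v) z = w p u z - w p v z.
Proof. by move=> Tu Tv Tz; rewrite form_addl ?form_oppl//; exact: tangent_oppv. Qed.

Lemma formC p u v : tangent p u -> tangent p v -> w p u v = - w p v u.
Proof. by have [_ sw _] := Tw; exact: sw. Qed.

Lemma form_oppr p u z : tangent p u -> tangent p z -> w p u (- z) = - w p u z.
Proof.
move=> Tu Tz; rewrite formC ?form_oppl -?formC//; exact: tangent_oppv.
Qed.

Lemma form_lsuml p (I : Type) (r : seq I) (a : I -> R) (E : I -> vec M) z :
  (forall i, tangent p (E i)) -> tangent p z ->
  w p (fun f => \sum_(i <- r) a i * E i f) z = \sum_(i <- r) a i * w p (E i) z.
Proof.
move=> TE Tz; elim: r => [|i r IH].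
  rewrite big_nil -[RHS](form_zerol Tz); congr (w p _ z).
  by apply/funext => f; rewrite big_nil.
rewrite big_cons -IH; have [lw _ _] := Tw; rewrite -lw//; last exact: tangent_lsum.
by congr (w p _ z); apply/funext => f; rewrite big_cons.
Qed.

Lemma form_lsumr p (I : Type) (r : seq I) (a : I -> R) (E : I -> vec M) z :
  (forall i, tangent p (E i)) -> tangent p z ->
  w p z (fun f => \sum_(i <- r) a i * E i f) = \sum_(i <- r) a i * w p z (E i).
Proof.
move=> TE Tz; rewrite formC//; last exact: tangent_lsum.
rewrite form_lsuml// -sumrN; apply: eq_bigr => i _.
by rewrite [in RHS]formC// mulrN.
Qed.

Lemma sf_form X Y : vf X -> vf Y -> smooth_fun (fun p => w p (X p) (Y p)).
Proof. by have [_ _] := Tw; exact. Qed.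

End form.

Variables (w : M -> vec M -> vec M -> R) (J : M -> vec M -> vec M).
Hypotheses (Sw : symplectic w) (CJ : compatible_acs w J).

Let Tw : two_form w. Proof. by case: Sw. Qed.

Definition Jf X : field M := fun p => J p (X p).

Lemma J_tangent p v : tangent p v -> tangent p (J p v).
Proof. by have [[h _ _] _ _ _] := CJ; exact: h. Qed.

Lemma Jf_vf X : vf X -> vf (Jf X).
Proof. by have [[_ _ h] _ _ _] := CJ; exact: h. Qed.

Lemma J_comb p a u v : tangent p u -> tangent p v ->
  J p (fun f => a * u f + v f) = (fun f => a * J p u f + J p v f).
Proof. by have [[_ h _] _ _ _] := CJ; exact: h. Qed.

Lemma J_add p u v : tangent p u -> tangent p v -> J p (u + v) = J p u + J p v.
Proof.
move=> Tu Tv; have := J_comb 1 Tu Tv.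
rewrite (_ : (fun f => 1 * u f + v f) = u + v); last by apply/funext => f; rewrite mul1r.
by move=> ->; apply/funext => f; rewrite mul1r.
Qed.

Lemma JJ p v : tangent p v -> J p (J p v) = - v.
Proof. by have [_ h _ _] := CJ; exact: h. Qed.

Lemma J_opp p u : tangent p u -> J p (- u) = - J p u.
Proof.
move=> Tu; have TJ := J_tangent Tu.
by rewrite -(JJ Tu) (JJ TJ).
Qed.

Lemma J_sub p u v : tangent p u -> tangent p v -> J p (u - v) = J p u - J p v.
Proof. by move=> Tu Tv; rewrite J_add ?J_opp//; exact: tangent_oppv. Qed.

Lemma wJJ p u v : tangent p u -> tangent p v -> w p (J p u) (J p v) = w p u v.
Proof. by have [_ _ h _] := CJ; exact: h. Qed.

Lemma wJl p u v : tangent p u -> tangent p v -> w p (J p u) v = - w p u (J p v).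
Proof.
move=> Tu Tv; rewrite -(wJJ Tu (J_tangent Tv)) JJ// (form_oppr Tw)//; first by rewrite opprK.
exact: J_tangent.
Qed.

Lemma w_pos p v : tangent p v -> w p v (J p v) = 0 -> v = fun=> 0.
Proof.
have [_ _ _ h] := CJ => Tv v0; apply: contrapT => /(h _ _ Tv).
by rewrite v0 ltxx.
Qed.

Definition gm p u v : R := w p u (J p v).

Lemma gmC p u v : tangent p u -> tangent p v -> gm p u v = gm p v u.
Proof.
move=> Tu Tv; rewrite /gm (formC Tw)//; last exact: J_tangent.
by rewrite wJl// opprK.
Qed.

Lemma gm_addl p u v z : tangent p u -> tangent p v -> tangent p z ->
  gm p (u + v) z = gm p u z + gm p v z.
Proof. by move=> Tu Tv Tz; apply: (form_addl Tw) => //; exact: J_tangent. Qed.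

Lemma gm_oppl p u z : tangent p u -> tangent p z -> gm p (- u) z = - gm p u z.
Proof. by move=> Tu Tz; apply: (form_oppl Tw) => //; exact: J_tangent. Qed.

Lemma gm_subl p u v z : tangent p u -> tangent p v -> tangent p z ->
  gm p (u - v) z = gm p u z - gm p v z.
Proof. by move=> Tu Tv Tz; apply: (form_subl Tw) => //; exact: J_tangent. Qed.

Lemma gm_J p u v : tangent p u -> tangent p v -> gm p (J p u) v = - gm p u (J p v).
Proof. by move=> Tu Tv; rewrite /gm wJl//; exact: J_tangent. Qed.

Lemma gm_w p u v : tangent p u -> tangent p v -> gm p (J p u) v = w p u v.
Proof. by move=> Tu Tv; rewrite /gm wJJ. Qed.

Lemma sf_gm X Y : vf X -> vf Y -> smooth_fun (fun p => gm p (X p) (Y p)).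
Proof. by move=> vX vY; apply: (sf_form Tw (Y := Jf Y)) => //; exact: Jf_vf. Qed.

Lemma gm_field_zero X : vf X -> (forall Z, vf Z -> forall p, gm p (X p) (Z p) = 0) ->
  X = fun _ _ => 0.
Proof. by move=> vX H; apply/funext => p; apply: (w_pos (vf_tangent p vX)); exact: H. Qed.

Variable nabla : field M -> field M -> field M.
Hypothesis Cn : chern_connection w J nabla.

Lemma nabla_vf X Y : vf X -> vf Y -> vf (nabla X Y).
Proof. by have [[h _ _] _ _] := Cn; exact: h. Qed.

Lemma nabla_combl h X Y Z : smooth_fun h -> vf X -> vf Y -> vf Z ->
  nabla (fun p f => h p * X p f + Y p f) Z
  = (fun p f => h p * nabla X Z p f + nabla Y Z p f).
Proof. by have [[_ H _] _ _] := Cn; exact: H. Qed.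

Lemma nabla_combr h X Y Z : smooth_fun h -> vf X -> vf Y -> vf Z ->
  nabla X (fun p f => h p * Y p f + Z p f)
  = (fun p f => X p h * Y p f + h p * nabla X Y p f + nabla X Z p f).
Proof. by have [[_ _ H] _ _] := Cn; exact: H. Qed.

Lemma nabla_addl X Y Z : vf X -> vf Y -> vf Z ->
  nabla (X + Y) Z = nabla X Z + nabla Y Z.
Proof.
move=> vX vY vZ; have := nabla_combl (sf_cst M 1) vX vY vZ.
rewrite (_ : (fun p f => 1 * X p f + Y p f) = X + Y); last first.
  by apply/funext => p; apply/funext => f; rewrite mul1r.
by move=> ->; apply/funext => p; apply/funext => f; rewrite mul1r.
Qed.

Lemma nabla_addr X Y Z : vf X -> vf Y -> vf Z ->
  nabla X (Y + Z) = nabla X Y + nabla X Z.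
Proof.
move=> vX vY vZ; have := nabla_combr (sf_cst M 1) vX vY vZ.
rewrite (_ : (fun p f => 1 * Y p f + Z p f) = Y + Z); last first.
  by apply/funext => p; apply/funext => f; rewrite mul1r.
move=> ->; apply/funext => p; apply/funext => f.
by rewrite (tangent_cst (vf_tangent p vX)) mul0r add0r mul1r.
Qed.

Lemma nabla_oppr X Y : vf X -> vf Y -> nabla X (- Y) = - nabla X Y.
Proof.
move=> vX vY; apply/eqP; rewrite -subr_eq0 opprK -nabla_addr//; last exact: vf_opp.
rewrite addNr; apply/eqP.
have v0 : vf (0 : field M) by exact: vf_zero.
have := nabla_addr vX v0 v0; rewrite addr0 => /eqP.
by rewrite -subr_eq subrr => /eqP.
Qed.

Lemma nabla_oppl X Y : vf X -> vf Y -> nabla (- X) Y = - nabla X Y.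
Proof.
move=> vX vY; apply/eqP; rewrite -subr_eq0 opprK -nabla_addl//; last exact: vf_opp.
rewrite addNr; apply/eqP.
have v0 : vf (0 : field M) by exact: vf_zero.
have := nabla_addl v0 v0 vY; rewrite addr0 => /eqP.
by rewrite -subr_eq subrr => /eqP.
Qed.

Lemma nabla_subr X Y Z : vf X -> vf Y -> vf Z ->
  nabla X (Y - Z) = nabla X Y - nabla X Z.
Proof. by move=> vX vY vZ; rewrite nabla_addr ?nabla_oppr//; exact: vf_opp. Qed.

Lemma nabla_gm X Y Z p : vf X -> vf Y -> vf Z ->
  X p (fun q => gm q (Y q) (Z q)) = gm p (nabla X Y p) (Z p) + gm p (Y p) (nabla X Z p).
Proof. by have [_ h _] := Cn; move=> vX vY vZ; exact: h. Qed.

Notation N := (nijenhuis J).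

Lemma torsionE X Y : vf X -> vf Y -> nabla X Y - nabla Y X = bracket X Y + N X Y.
Proof.
have [_ _ h] := Cn => vX vY; rewrite -(h _ _ vX vY).
by apply/funext => p; apply/funext => f; rewrite !fldE /torsion; ring.
Qed.

(** Multiplied by 4, the identities for [N] become identities between sums of brackets;
    [field_mul4_inj] divides by 4 at the end. *)
Lemma nijenhuis4 X Y : N X Y *+ 4 = bracket (Jf X) (Jf Y) - Jf (bracket (Jf X) Y)
  - Jf (bracket X (Jf Y)) - bracket X Y.
Proof.
apply/funext => p; apply/funext => f.
by rewrite !fldE /nijenhuis mulrA mulfV ?mul1r.
Qed.

Lemma field_mul4_inj : injective (fun X : field M => X *+ 4).
Proof.
move=> X Y XY; apply/funext => p; apply/funext => f.
by have := congr1 (fun Z : field M => Z p f) XY; rewrite !fldE; lra.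
Qed.

Lemma nijenhuis_vf X Y : vf X -> vf Y -> vf (N X Y).
Proof.
move=> vX vY.
have -> : N X Y = nabla X Y - nabla Y X - bracket X Y.
  by rewrite torsionE// addrAC subrr add0r.
apply: vf_sub; last exact: vf_bracket.
by apply: vf_sub; exact: nabla_vf.
Qed.

Lemma Jf_add X Y : vf X -> vf Y -> Jf (X + Y) = Jf X + Jf Y.
Proof. by move=> vX vY; apply/funext => p; apply: J_add; exact: vf_tangent. Qed.

Lemma Jf_opp X : vf X -> Jf (- X) = - Jf X.
Proof. by move=> vX; apply/funext => p; apply: J_opp; exact: vf_tangent. Qed.

Lemma Jf_sub X Y : vf X -> vf Y -> Jf (X - Y) = Jf X - Jf Y.
Proof. by move=> vX vY; apply/funext => p; apply: J_sub; exact: vf_tangent. Qed.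

Lemma JfJf X : vf X -> Jf (Jf X) = - X.
Proof. by move=> vX; apply/funext => p; apply: JJ; exact: vf_tangent. Qed.

Lemma bracket_oppl V X : vf V -> vf X -> bracket (- X) V = - bracket X V.
Proof. by move=> vV vX; rewrite bracketC bracket_oppr// -(bracketC _ V). Qed.

Ltac vft := by do ?[exact: Jf_vf|apply: Jf_vf|apply: vf_bracket|apply: nabla_vf|
  apply: vf_opp|apply: vf_add|apply: nijenhuis_vf|assumption].

Lemma nijenhuis_Jl X Y : vf X -> vf Y -> N (Jf X) Y = - Jf (N X Y).
Proof.
move=> vX vY; have [vJX vJY] := (Jf_vf vX, Jf_vf vY); have vN := nijenhuis_vf vX vY.
have va := vf_bracket vJX vJY; have vb := vf_bracket vJX vY.
have vc := vf_bracket vX vJY; have vd := vf_bracket vX vY.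
have [vJb vJc] := (Jf_vf vb, Jf_vf vc).
have E : Jf (N X Y *+ 4) = Jf (N X Y) *+ 4.
  by rewrite !mulrS !mulr0n !addr0 !Jf_add//; do !apply: vf_add.
apply: field_mul4_inj => /=.
rewrite mulNrn -E !nijenhuis4 (JfJf vX) (bracket_oppl vJY vX) (bracket_oppl vY vX).
rewrite (Jf_opp vd) (Jf_sub _ vd); last by apply: vf_sub => //; exact: vf_sub.
rewrite (Jf_sub _ vJc); last exact: vf_sub.
rewrite (Jf_sub va vJb) (JfJf vb) (JfJf vc).
by apply/funext => p; apply/funext => f; rewrite !fldE; ring.
Qed.

Lemma nijenhuisC X Y : vf X -> vf Y -> N X Y = - N Y X.
Proof.
move=> vX vY; apply: field_mul4_inj => /=; rewrite mulNrn !nijenhuis4.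
have [vJX vJY] := (Jf_vf vX, Jf_vf vY).
rewrite (bracketC (Jf X) (Jf Y)) (bracketC (Jf X) Y) (bracketC X (Jf Y)) (bracketC X Y).
rewrite (Jf_opp (vf_bracket vY vJX)) (Jf_opp (vf_bracket vJY vX)).
by apply/funext => p; apply/funext => f; rewrite !fldE; ring.
Qed.

Lemma nijenhuis_Jr X Y : vf X -> vf Y -> N X (Jf Y) = - Jf (N X Y).
Proof.
move=> vX vY; have vJY := Jf_vf vY; rewrite (nijenhuisC vX vJY) (nijenhuis_Jl vY vX).
by rewrite (nijenhuisC vX vY) (Jf_opp (nijenhuis_vf vY vX)).
Qed.

(** The covariant derivative of [J] along [X], applied to [Y]. *)
Definition DJ X Y : field M := nabla X (Jf Y) - Jf (nabla X Y).

Lemma DJ_vf X Y : vf X -> vf Y -> vf (DJ X Y).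
Proof. by move=> vX vY; vft. Qed.

Definition bJ p X Y Z : R := gm p (DJ X Y p) (Z p).

(** [J] is skew for the metric and the metric is parallel, so the covariant derivative of [J] is
    skew too: differentiate [gm (J Y) Z = - gm Y (J Z)]. *)
Lemma bJ_skew p X Y Z : vf X -> vf Y -> vf Z -> bJ p X Y Z = - bJ p X Z Y.
Proof.
move=> vX vY vZ; have [vJY vJZ] := (Jf_vf vY, Jf_vf vZ).
have T U : vf U -> tangent p (U p) by move=> vU; exact: vf_tangent.
have E : (fun q => gm q (Jf Y q) (Z q)) = (fun q => - gm q (Y q) (Jf Z q)).
  by apply/funext => q; apply: gm_J; exact: vf_tangent.
have h1 := nabla_gm p vX vJY vZ; have h2 := nabla_gm p vX vY vJZ.
rewrite E (tangentN (T _ vX)) in h1; last exact: sf_gm.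
have vn U : vf U -> tangent p (nabla X U p) by move=> vU; apply: vf_tangent; exact: nabla_vf.
rewrite /bJ /DJ !fctE !gm_subl ?gm_J//; try (by apply: J_tangent; auto); auto.
have e1 : gm p (nabla X (Jf Z) p) (Y p) = gm p (Y p) (nabla X (Jf Z) p) by apply: gmC; auto.
have e2 : gm p (nabla X Z p) (J p (Y p)) = gm p (Jf Y p) (nabla X Z p).
  by apply: gmC; [auto|exact: J_tangent (T _ vY)].
rewrite e1 e2 -/(Jf Z p); rewrite -/(Jf Z p) in h2; lra.
Qed.

Lemma DJ_J X Y : vf X -> vf Y -> DJ X (Jf Y) = - Jf (DJ X Y).
Proof.
move=> vX vY; rewrite /DJ JfJf// nabla_oppr// Jf_sub ?JfJf ?opprB//; try vft.
Qed.

Lemma bJ_J p X Y Z : vf X -> vf Y -> vf Z -> bJ p X (Jf Y) Z = bJ p X Y (Jf Z).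
Proof.
move=> vX vY vZ; have TD := vf_tangent p (DJ_vf vX vY); have TZ := vf_tangent p vZ.
rewrite /bJ DJ_J// (_ : (- Jf (DJ X Y)) p = - J p (DJ X Y p))//.
by rewrite gm_oppl ?gm_J ?opprK//; exact: J_tangent.
Qed.

(** Substitute [bracket U U' = nabla U U' - nabla U' U - N U U'] in the formula for 4N. As [N] is
    J-antilinear in each argument, the four torsion terms on the right add up to 4N and cancel the
    left side; the rest involves only the derivative of [J]. *)
Lemma DJ_torsion X Y : vf X -> vf Y ->
  DJ (Jf X) Y - DJ (Jf Y) X - Jf (DJ X Y) + Jf (DJ Y X) = 0.
Proof.
move=> vX vY; have [vJX vJY] := (Jf_vf vX, Jf_vf vY).
have vn U U' : vf U -> vf U' -> vf (nabla U U') by exact: nabla_vf.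
have vN := nijenhuis_vf vX vY; have vJN := Jf_vf vN.
have B U U' : vf U -> vf U' -> bracket U U' = nabla U U' - nabla U' U - N U U'.
  by move=> vU vU'; rewrite torsionE// addrK.
have n1 : N (Jf X) Y = - Jf (N X Y) by exact: nijenhuis_Jl.
have n2 : N X (Jf Y) = - Jf (N X Y) by exact: nijenhuis_Jr.
have n3 : N (Jf X) (Jf Y) = - N X Y.
  by rewrite nijenhuis_Jr// n1 (Jf_opp vJN) (JfJf vN) opprK.
have J1 : Jf (bracket (Jf X) Y) = Jf (nabla (Jf X) Y) - Jf (nabla Y (Jf X)) - N X Y.
  rewrite (B _ _ vJX vY) n1 opprK Jf_add//; last by apply: vf_sub; exact: vn.
  by rewrite (Jf_sub (vn _ _ vJX vY) (vn _ _ vY vJX)) (JfJf vN).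
have J2 : Jf (bracket X (Jf Y)) = Jf (nabla X (Jf Y)) - Jf (nabla (Jf Y) X) - N X Y.
  rewrite (B _ _ vX vJY) n2 opprK Jf_add//; last by apply: vf_sub; exact: vn.
  by rewrite (Jf_sub (vn _ _ vX vJY) (vn _ _ vJY vX)) (JfJf vN).
have J3 : Jf (DJ X Y) = Jf (nabla X (Jf Y)) + nabla X Y.
  by rewrite (Jf_sub (vn _ _ vX vJY)) ?(JfJf (vn _ _ vX vY)) ?opprK//; apply: Jf_vf; exact: vn.
have J4 : Jf (DJ Y X) = Jf (nabla Y (Jf X)) + nabla Y X.
  by rewrite (Jf_sub (vn _ _ vY vJX)) ?(JfJf (vn _ _ vY vX)) ?opprK//; apply: Jf_vf; exact: vn.
have N4 := nijenhuis4 X Y.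
rewrite J1 J2 (B _ _ vJX vJY) (B _ _ vX vY) n3 in N4.
rewrite J3 J4 /DJ; apply/funext => p; apply/funext => f.
by have := congr1 (fun Z : field M => Z p f) N4; rewrite !fldE; lra.
Qed.

(* This is dw = 0, with the brackets expressed through nabla and its torsion. *)
Lemma bJ_closed p X Y Z : vf X -> vf Y -> vf Z ->
  bJ p X Y Z - bJ p Y X Z + bJ p Z X Y
  + w p (N X Y p) (Z p) - w p (N X Z p) (Y p) + w p (N Y Z p) (X p) = 0.
Proof.
move=> vX vY vZ; have [_ dw _] := Sw; have := dw X Y Z vX vY vZ p.
have T U : vf U -> tangent p (U p) by move=> vU; exact: vf_tangent.
have D U U' U'' : vf U -> vf U' -> vf U'' -> U p (fun q => w q (U' q) (U'' q)) =
    bJ p U U' U'' + w p (nabla U U' p) (U'' p) + w p (U' p) (nabla U U'' p).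
  move=> vU vU' vU''; have vJ := Jf_vf vU'.
  have -> : (fun q => w q (U' q) (U'' q)) = (fun q => gm q (Jf U' q) (U'' q)).
    by apply/funext => q; rewrite gm_w//; exact: vf_tangent.
  have Tn := T _ (nabla_vf vU vU'); have Tn' := T _ (nabla_vf vU vU'').
  rewrite (nabla_gm p vU vJ vU'') (gm_w (T _ vU') Tn'); congr (_ + _).
  rewrite /bJ /DJ -(gm_w Tn (T _ vU'')).
  rewrite (_ : (nabla U (Jf U') - Jf (nabla U U')) p = nabla U (Jf U') p - J p (nabla U U' p))//.
  rewrite gm_subl ?subrK//; first exact: T (nabla_vf vU vJ); last exact: T.
  exact: J_tangent.
have B U U' U'' : vf U -> vf U' -> vf U'' -> w p (bracket U U' p) (U'' p) =
    w p (nabla U U' p) (U'' p) - w p (nabla U' U p) (U'' p) - w p (N U U' p) (U'' p).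
  move=> vU vU' vU''.
  have Tn := T _ (nabla_vf vU vU'); have Tn' := T _ (nabla_vf vU' vU).
  have TN := T _ (nijenhuis_vf vU vU').
  have -> : bracket U U' p = nabla U U' p - nabla U' U p - N U U' p.
    by have := congr1 (fun F : field M => F p) (torsionE vU vU') => /= h;
      rewrite -[LHS](addrK (N U U' p)) -[_ + N U U' p]h.
  rewrite (form_subl Tw) ?(form_subl Tw)//; try exact: T.
  exact: tangent_subv.
rewrite !D// !B//.
have C u v : tangent p u -> tangent p v -> w p u v = - w p v u by exact: formC.
rewrite (C (Y p) (nabla X Z p)) ?(C (X p) (nabla Y Z p)) ?(C (X p) (nabla Z Y p));
  try (by apply: T); try (by apply: T; exact: nabla_vf).
lra.
Qed.

(* [dw = 0] makes e(X,Y,Z) = b(X,Y,Z) + b(JX,Y,JZ) symmetric in X and Y; as it is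
   skew in Y and Z it vanishes.  So [b(JX,Y,Z) = b(X,Y,JZ)], and the formula for
   the torsion then makes b itself symmetric in X and Y. *)
Lemma bJ_zero p : forall X Y Z, vf X -> vf Y -> vf Z -> bJ p X Y Z = 0.
Proof.
have e0 A B C : vf A -> vf B -> vf C -> bJ p A B C + bJ p (Jf A) B (Jf C) = 0.
  apply: (@sym_skew_zero R _ vf (fun X Y Z => bJ p X Y Z + bJ p (Jf X) Y (Jf Z)))
    => {A B C} X Y Z vX vY vZ.
    have [vJX vJY] := (Jf_vf vX, Jf_vf vY).
    have T U : vf U -> tangent p (U p) by move=> vU; exact: vf_tangent.
    have h1 := bJ_closed p vX vY vZ; have h2 := bJ_closed p vJX vJY vZ.
    have n1 := nijenhuis_Jl vX vZ; have n2 := nijenhuis_Jl vY vZ.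
    have n3 : N (Jf X) (Jf Y) = - N X Y.
      have vN := nijenhuis_vf vX vY.
      by rewrite nijenhuis_Jr// nijenhuis_Jl// (Jf_opp (Jf_vf vN)) (JfJf vN) opprK.
    have [[vXY vXZ] vYZ] := (nijenhuis_vf vX vY, nijenhuis_vf vX vZ, nijenhuis_vf vY vZ).
    have m1 : w p (N (Jf X) Z p) (Jf Y p) = - w p (N X Z p) (Y p).
      rewrite n1 (_ : (- Jf (N X Z)) p = - J p (N X Z p))// (form_oppl Tw) ?wJJ//; try exact: T.
      exact: J_tangent (T _ vXZ).
    have m2 : w p (N (Jf Y) Z p) (Jf X p) = - w p (N Y Z p) (X p).
      rewrite n2 (_ : (- Jf (N Y Z)) p = - J p (N Y Z p))// (form_oppl Tw) ?wJJ//; try exact: T.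
      exact: J_tangent (T _ vYZ).
    have m3 : w p (N (Jf X) (Jf Y) p) (Z p) = - w p (N X Y p) (Z p).
      by rewrite n3 (_ : (- N X Y) p = - N X Y p)// (form_oppl Tw)//; exact: T.
    rewrite m1 m2 m3 in h2.
    have k1 := bJ_J p vJX vY vZ; have k2 := bJ_J p vJY vX vZ.
    have k3 : bJ p Z (Jf X) (Jf Y) = - bJ p Z X Y.
      rewrite (bJ_J p vZ vX vJY) (JfJf vY) /bJ (_ : (- Y) p = - Y p)//.
      have TD := T _ (DJ_vf vZ vX).
      by rewrite gmC ?gm_oppl ?(gmC (T _ vY) TD)//; [exact: T|apply: tangent_oppv; exact: T].
    rewrite k1 k2 k3 in h2; lra.
  have [vJX vJY] := (Jf_vf vX, Jf_vf vY); have vJZ := Jf_vf vZ.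
  rewrite (bJ_skew p vX vY vZ) -(bJ_J p vJX vY vZ) (bJ_skew p vJX vJY vZ).
  by rewrite opprD.
have JJl A B C : vf A -> vf B -> vf C -> bJ p (Jf A) B C = bJ p A B (Jf C).
  move=> vA vB vC; have := e0 A B (Jf C) vA vB (Jf_vf vC).
  rewrite (JfJf vC) {2}/bJ (_ : (- C) p = - C p)//.
  have TD := vf_tangent p (DJ_vf (Jf_vf vA) vB); have TC := vf_tangent p vC.
  rewrite gmC ?gm_oppl ?(gmC TC TD)//; last exact: tangent_oppv.
  by rewrite -/(bJ p (Jf A) B C); lra.
apply: (@sym_skew_zero R _ vf (bJ p)) => X Y Z vX vY vZ; last exact: bJ_skew.
have vJZ := Jf_vf vZ.
(* [DJ_torsion] is paired with [J Z], so the symmetry comes out at [J (J Z)], which is [- Z]. *)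
have K : bJ p X Y (Jf (Jf Z)) = bJ p Y X (Jf (Jf Z)).
  have := congr1 (fun F : field M => gm p (F p) (Jf Z p)) (DJ_torsion vX vY).
  have [vJX vJY] := (Jf_vf vX, Jf_vf vY).
  have T U : vf U -> tangent p (U p) by move=> vU; exact: vf_tangent.
  have d1 := T _ (DJ_vf vJX vY); have d2 := T _ (DJ_vf vJY vX).
  have d3 := T _ (DJ_vf vX vY); have d4 := T _ (DJ_vf vY vX).
  have [TJ3 TJ4] := (J_tangent d3, J_tangent d4); have TJZ := T _ vJZ.
  rewrite (_ : (DJ (Jf X) Y - DJ (Jf Y) X - Jf (DJ X Y) + Jf (DJ Y X)) p =
    DJ (Jf X) Y p - DJ (Jf Y) X p - J p (DJ X Y p) + J p (DJ Y X p))//.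
  rewrite (gm_addl (tangent_subv (tangent_subv d1 d2) TJ3) TJ4 TJZ).
  rewrite (gm_subl (tangent_subv d1 d2) TJ3 TJZ) (gm_subl d1 d2 TJZ).
  rewrite (gm_J d3 TJZ) (gm_J d4 TJZ).
  have -> : gm p ((0 : field M) p) (Jf Z p) = 0 by exact: (form_zerol Tw (J_tangent TJZ)).
  rewrite -![gm p (DJ _ _ p) (Jf Z p)]/(bJ p _ _ (Jf Z)).
  rewrite (JJl X Y (Jf Z))// (JJl Y X (Jf Z))//.
  by rewrite /bJ /Jf; lra.
have O A B : vf A -> vf B -> bJ p A B (Jf (Jf Z)) = - bJ p A B Z.
  move=> vA vB; rewrite (JfJf vZ) /bJ (_ : (- Z) p = - Z p)//.
  have TD := vf_tangent p (DJ_vf vA vB); have TZ := vf_tangent p vZ.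
  by rewrite gmC ?gm_oppl ?(gmC TZ TD)//; exact: tangent_oppv.
by move: K; rewrite !O//; lra.
Qed.

Lemma nabla_J X Y : vf X -> vf Y -> nabla X (Jf Y) = Jf (nabla X Y).
Proof.
move=> vX vY; apply/eqP; rewrite -subr_eq0; apply/eqP.
apply: (gm_field_zero (DJ_vf vX vY)) => Z vZ p; exact: bJ_zero.
Qed.

End geometry.

(** * Infinitesimal automorphisms *)

Section automorphisms.
Context {R : realType} {n : nat} {M : manifold R n}.
Notation vf := (@vector_field R n M).
Implicit Types (X Y Z U V W : field M) (f g h : M -> R) (p q : M).
Implicit Types A B : field M -> field M.

Lemma tensorial_ext A B : (forall Z, vf Z -> A Z = B Z) -> tensorial B -> tensorial A.
Proof.
move=> AB [vB lB]; split=> [Z vZ|h X Y Sh vX vY]; first by rewrite AB//; exact: vB.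
by rewrite !AB ?lB//; exact: vf_comb.
Qed.

Lemma tr_ext A B p : (forall Z, vf Z -> A Z = B Z) -> tr A p = tr B p.
Proof.
move=> AB; have [x [E [[Sx vE FE] trE']]] := tr_spec p.
by rewrite !trE'; apply: eq_bigr => i _; rewrite AB.
Qed.

Lemma tr_add A B p : tr (fun Z => A Z + B Z) p = tr A p + tr B p.
Proof.
have [x [E [F trE']]] := tr_spec p; rewrite !trE' -big_split/=.
by apply: eq_bigr => i _.
Qed.

Lemma tr_opp A p : tr (fun Z => - A Z) p = - tr A p.
Proof.
have [x [E [F trE']]] := tr_spec p; rewrite !trE' -sumrN.
by apply: eq_bigr => i _.
Qed.

Lemma tensorial_add A B : tensorial A -> tensorial B -> tensorial (fun Z => A Z + B Z).
Proof.
move=> TA TB; split=> [Z vZ|h X Y Sh vX vY].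
  by apply: vf_add; [exact: TA.1|exact: TB.1].
rewrite TA.2// TB.2//; apply/funext => p; apply/funext => f.
by rewrite !fldE; ring.
Qed.

Lemma tensorial_opp A : tensorial A -> tensorial (fun Z => - A Z).
Proof.
move=> TA; split=> [Z vZ|h X Y Sh vX vY]; first by apply: vf_opp; exact: TA.1.
rewrite TA.2//; apply/funext => p; apply/funext => f.
by rewrite !fldE; ring.
Qed.

Lemma tensorial_comp A B : tensorial A -> tensorial B -> tensorial (fun Z => A (B Z)).
Proof.
move=> TA TB; split=> [Z vZ|h X Y Sh vX vY]; first by apply: TA.1; exact: TB.1.
by rewrite TB.2// TA.2//; exact: TB.1.
Qed.

Variables (w : M -> vec M -> vec M -> R) (J : M -> vec M -> vec M).
Hypotheses (Sw : symplectic w) (CJ : compatible_acs w J).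
Variable nabla : field M -> field M -> field M.
Hypothesis Cn : chern_connection w J nabla.
Notation Jf := (Jf J).
Notation gm := (gm w J).
Notation N := (nijenhuis J).

Let Tw : two_form w. Proof. by case: Sw. Qed.

Lemma tensorial_J : tensorial Jf.
Proof.
split=> [Z vZ|h X Y Sh vX vY]; first exact: (Jf_vf CJ vZ).
by apply/funext => p; apply: (J_comb CJ); exact: vf_tangent.
Qed.

(* L_V w = 0 and L_V J = 0. *)
Definition infaut V : Prop :=
  [/\ vf V,
      forall X Y p, vf X -> vf Y -> V p (fun q => w q (X q) (Y q)) =
        w p (bracket V X p) (Y p) + w p (X p) (bracket V Y p) &
      forall X, vf X -> bracket V (Jf X) = Jf (bracket V X)].

Lemma infaut_gm V X Y p : infaut V -> vf X -> vf Y ->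
  V p (fun q => gm q (X q) (Y q)) =
  gm p (bracket V X p) (Y p) + gm p (X p) (bracket V Y p).
Proof.
move=> [vV Vw VJ] vX vY; have := Vw X (Jf Y) p vX (Jf_vf CJ vY).
by rewrite VJ.
Qed.

(** [N] is built from [J] and brackets: [V] commutes with [J], and by Jacobi's identity it is a
    derivation of brackets. *)
Lemma lie_nijenhuis V X Y : infaut V -> vf X -> vf Y ->
  bracket V (N X Y) = N (bracket V X) Y + N X (bracket V Y).
Proof.
move=> [vV Vw VJ] vX vY; have [vJX vJY] := (Jf_vf CJ vX, Jf_vf CJ vY).
have [vVX vVY] := (vf_bracket vV vX, vf_bracket vV vY).
have [vJVX vJVY] := (Jf_vf CJ vVX, Jf_vf CJ vVY).
have b4 (U : field M) : vf U -> bracket V U *+ 4 = bracket V (U *+ 4).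
  by move=> vU; rewrite !mulrS !mulr0n !addr0 !bracket_addr//; do !apply: vf_add.
apply: field_mul4_inj; rewrite [RHS]mulrnDl (b4 _ (nijenhuis_vf Cn vX vY)).
rewrite !nijenhuis4.
have va := vf_bracket vJX vJY; have vb := vf_bracket vJX vY.
have vc := vf_bracket vX vJY; have vd := vf_bracket vX vY.
have [vJb vJc] := (Jf_vf CJ vb, Jf_vf CJ vc).
have -> : bracket V (bracket (Jf X) (Jf Y) - Jf (bracket (Jf X) Y)
    - Jf (bracket X (Jf Y)) - bracket X Y) =
    bracket V (bracket (Jf X) (Jf Y)) - bracket V (Jf (bracket (Jf X) Y))
    - bracket V (Jf (bracket X (Jf Y))) - bracket V (bracket X Y).
  rewrite (bracket_subr vV (vf_sub (vf_sub va vJb) vJc) vd).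
  by rewrite (bracket_subr vV (vf_sub va vJb) vJc) (bracket_subr vV va vJb).
rewrite (VJ _ vb) (VJ _ vc) (jacobi vV vJX vJY) (jacobi vV vJX vY).
rewrite (jacobi vV vX vJY) (jacobi vV vX vY) (VJ _ vX) (VJ _ vY).
rewrite (Jf_add CJ (vf_bracket vJVX vY) (vf_bracket vJX vVY)).
rewrite (Jf_add CJ (vf_bracket vVX vJY) (vf_bracket vX vJVY)).
by apply/funext => p; apply/funext => f; rewrite !fldE; ring.
Qed.

(* The defect is symmetric in X and Y because L_V N = 0, and skew in Y and Z
   because L_V g = 0. *)
Lemma lie_nabla V X Y : infaut V -> vf X -> vf Y ->
  bracket V (nabla X Y) = nabla (bracket V X) Y + nabla X (bracket V Y).
Proof.
move=> IV; have [vV Vw VJ] := IV.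
have vn U U' : vf U -> vf U' -> vf (nabla U U') by move=> vU vU'; exact: (nabla_vf Cn vU vU').
have vb U : vf U -> vf (bracket V U) by exact: vf_bracket.
pose S X Y := bracket V (nabla X Y) - (nabla (bracket V X) Y + nabla X (bracket V Y)).
have vS X' Y' : vf X' -> vf Y' -> vf (S X' Y').
  by move=> vX vY; apply: vf_sub; [|apply: vf_add]; auto.
suff S0 : forall p X Y Z, vf X -> vf Y -> vf Z -> gm p (S X Y p) (Z p) = 0.
  move=> vX vY; apply/eqP; rewrite -subr_eq0; apply/eqP.
  apply: (gm_field_zero CJ (vS _ _ vX vY)) => Z vZ p; exact: S0.
move=> p.
have T U : vf U -> tangent p (U p) by move=> vU; exact: vf_tangent.
apply: (@sym_skew_zero R _ vf (fun X Y Z => gm p (S X Y p) (Z p))) => {}X {}Y Z vX vY vZ.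
  congr (gm p (_ p) _); apply/eqP; rewrite -subr_eq0; apply/eqP.
  have t1 := torsionE Cn vX vY; have t2 := torsionE Cn (vb _ vX) vY.
  have t3 := torsionE Cn vX (vb _ vY).
  have vN := nijenhuis_vf Cn vX vY.
  have : bracket V (nabla X Y - nabla Y X) = bracket V (bracket X Y + N X Y) by rewrite t1.
  rewrite (bracket_subr vV (vn _ _ vX vY) (vn _ _ vY vX)).
  rewrite (bracket_addr vV (vf_bracket vX vY) vN) (jacobi vV vX vY).
  rewrite (lie_nijenhuis IV vX vY) => h.
  apply/funext => q; apply/funext => f; rewrite /S !fldE.
  have := congr1 (fun F : field M => F q f) h.
  have := congr1 (fun F : field M => F q f) t2.
  have := congr1 (fun F : field M => F q f) t3.
  by rewrite !fldE; lra.
have h1 := nabla_gm Cn p vX vY vZ.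
have sg1 : smooth_fun (fun q => gm q (nabla X Y q) (Z q)) by exact: (sf_gm Sw CJ (vn _ _ vX vY) vZ).
have sg2 : smooth_fun (fun q => gm q (Y q) (nabla X Z q)) by exact: (sf_gm Sw CJ vY (vn _ _ vX vZ)).
have sg3 : smooth_fun (fun q => gm q (bracket V Y q) (Z q)) by exact: (sf_gm Sw CJ (vb _ vY) vZ).
have sg4 : smooth_fun (fun q => gm q (Y q) (bracket V Z q)) by exact: (sf_gm Sw CJ vY (vb _ vZ)).
have e1 : V p (fun q => X q (fun q => gm q (Y q) (Z q))) =
    V p (fun q => gm q (nabla X Y q) (Z q)) + V p (fun q => gm q (Y q) (nabla X Z q)).
  rewrite -(tangentD (T _ vV) sg1 sg2); congr (V p _); apply/funext => q.
  exact: (nabla_gm Cn q vX vY vZ).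
have e2 : X p (fun q => V q (fun q => gm q (Y q) (Z q))) =
    X p (fun q => gm q (bracket V Y q) (Z q)) + X p (fun q => gm q (Y q) (bracket V Z q)).
  rewrite -(tangentD (T _ vX) sg3 sg4); congr (X p _); apply/funext => q.
  exact: infaut_gm.
have e3 := nabla_gm Cn p (vb _ vX) vY vZ; rewrite {1}/bracket e1 e2 in e3.
rewrite (infaut_gm p IV (vn _ _ vX vY) vZ) (infaut_gm p IV vY (vn _ _ vX vZ)) in e3.
rewrite (nabla_gm Cn p vX (vb _ vY) vZ) (nabla_gm Cn p vX vY (vb _ vZ)) in e3.
have SE U U' : S U U' p = bracket V (nabla U U') p
    - (nabla (bracket V U) U' p + nabla U (bracket V U') p) by [].
have g U U' U'' : vf U -> vf U' -> vf U'' -> gm p (S U U' p) (U'' p) =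
    gm p (bracket V (nabla U U') p) (U'' p) - (gm p (nabla (bracket V U) U' p) (U'' p)
    + gm p (nabla U (bracket V U') p) (U'' p)).
  move=> vU vU' vU''; rewrite SE.
  have t1 := T _ (vn _ _ (vb _ vU) vU'); have t2 := T _ (vn _ _ vU (vb _ vU')).
  have t3 := T _ (vb _ (vn _ _ vU vU')).
  by rewrite (gm_subl Sw CJ t3 (tangent_addv t1 t2) (T _ vU'')) (gm_addl Sw CJ t1 t2 (T _ vU'')).
rewrite !g//; move: e3.
rewrite (gmC Sw CJ (T _ vY) (T _ (vb _ (vn _ _ vX vZ)))).
rewrite (gmC Sw CJ (T _ vY) (T _ (vn _ _ (vb _ vX) vZ))).
rewrite (gmC Sw CJ (T _ vY) (T _ (vn _ _ vX (vb _ vZ)))).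
lra.
Qed.

(* Kostant's operator nabla_V - L_V, tensorial although its two terms are not. *)
Definition covA V Z : field M := nabla V Z - bracket V Z.

Lemma tensorial_covA V : vf V -> tensorial (covA V).
Proof.
move=> vV; split=> [Z vZ|h X Y Sh vX vY].
  by apply: vf_sub; [exact: (nabla_vf Cn vV vZ)|exact: vf_bracket].
rewrite /covA (nabla_combr Cn Sh vV vX vY).
apply: vf_ext => [||p f Sf].
- apply: vf_sub; last by apply: vf_bracket => //; exact: vf_comb.
  rewrite -(nabla_combr Cn Sh vV vX vY).
  by apply: (nabla_vf Cn vV); exact: vf_comb.
- by apply: vf_comb => //; (apply: vf_sub; [exact: (nabla_vf Cn)|exact: vf_bracket]).
have SXf := vf_sf vX Sf; have SYf := vf_sf vY Sf.
rewrite !fldE /bracket (tangentD (vf_tangent p vV)) ?(tangentM (vf_tangent p vV))//.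
  by ring.
exact: sfM.
Qed.

Lemma covA_J V Z : infaut V -> vf Z -> covA V (Jf Z) = Jf (covA V Z).
Proof.
move=> [vV Vw VJ] vZ; rewrite /covA (nabla_J Sw CJ Cn vV vZ) VJ//.
by rewrite (Jf_sub CJ)//; [exact: (nabla_vf Cn vV vZ)|exact: vf_bracket].
Qed.

(** With nabla_V written as A_V + L_V, the mixed terms are rearranged by L_V nabla = 0 and the
    double Lie derivatives combine by Jacobi's identity. *)
Lemma curvature_covA V W Z : infaut V -> infaut W -> vf Z ->
  curvature nabla V W Z =
  covA V (covA W Z) - covA W (covA V Z) + covA (bracket V W) Z.
Proof.
move=> IV IW vZ; have [[vV _ _] [vW _ _]] := (IV, IW).
have vn U U' : vf U -> vf U' -> vf (nabla U U') by move=> vU vU'; exact: (nabla_vf Cn vU vU').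
have [vVZ vWZ] := (vf_bracket vV vZ, vf_bracket vW vZ).
have [nVZ nWZ] := (vn _ _ vV vZ, vn _ _ vW vZ).
rewrite /covA (nabla_subr Cn vV nWZ vWZ) (nabla_subr Cn vW nVZ vVZ).
rewrite (bracket_subr vV nWZ vWZ) (bracket_subr vW nVZ vVZ).
rewrite (lie_nabla IV vW vZ) (lie_nabla IW vV vZ) (bracketC W V).
rewrite (nabla_oppl Cn (vf_bracket vV vW) vZ) (jacobi vV vW vZ).
by apply/funext => p; apply/funext => f; rewrite !fldE /curvature; ring.
Qed.

Definition trA V : M -> R := tr (fun Z => Jf (covA V Z)).

Lemma tensorial_JA V : vf V -> tensorial (fun Z => Jf (covA V Z)).
Proof. by move=> vV; apply: (tensorial_comp tensorial_J); exact: tensorial_covA. Qed.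

(* Since the A's commute with J, the commutator term is traceless. *)
Lemma ricci_trA V W p t : infaut V -> infaut W ->
  is_trace_at (fun Z q => J q (curvature nabla V W Z q)) p t ->
  t = trA (bracket V W) p.
Proof.
move=> IV IW; have [[vV _ _] [vW _ _]] := (IV, IW).
have [TV TW] := (tensorial_covA vV, tensorial_covA vW).
have TVW := tensorial_covA (vf_bracket vV vW).
pose B Z := Jf (covA V (covA W Z)) + - Jf (covA W (covA V Z)) + Jf (covA (bracket V W) Z).
have E Z : vf Z -> (fun q => J q (curvature nabla V W Z q)) = B Z.
  move=> vZ; rewrite curvature_covA// -[LHS]/(Jf _) /B.
  have [vZ1 vZ2] := (TV.1 _ vZ, TW.1 _ vZ).
  have [vZ3 vZ4] := (TV.1 _ vZ2, TW.1 _ vZ1).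
  by rewrite (Jf_add CJ (vf_sub vZ3 vZ4) (TVW.1 _ vZ)) (Jf_sub CJ vZ3 vZ4).
have TB1 : tensorial (fun Z => Jf (covA V (covA W Z))).
  by apply: (tensorial_comp tensorial_J); exact: tensorial_comp.
have TB2 : tensorial (fun Z => Jf (covA W (covA V Z))).
  by apply: (tensorial_comp tensorial_J); exact: tensorial_comp.
have TB : tensorial B.
  apply: tensorial_add; last exact: tensorial_JA (vf_bracket vV vW).
  by apply: tensorial_add => //; exact: tensorial_opp.
move=> /(is_trace_atE (tensorial_ext E TB)) ->.
rewrite (tr_ext _ E) !tr_add tr_opp.
have -> : tr (fun Z => Jf (covA V (covA W Z))) p = tr (fun Z => Jf (covA W (covA V Z))) p.
  rewrite (tr_comp p (tensorial_JA vV) TW); apply: tr_ext => Z vZ.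
  by rewrite covA_J//; exact: TV.1.
by rewrite subrr add0r.
Qed.

Lemma lie_covA V W Z : infaut V -> vf W -> vf Z ->
  bracket V (covA W Z) - covA W (bracket V Z) = covA (bracket V W) Z.
Proof.
move=> IV vW vZ; have [vV _ _] := IV.
have vn U U' : vf U -> vf U' -> vf (nabla U U') by move=> vU vU'; exact: (nabla_vf Cn vU vU').
rewrite /covA (bracket_subr vV (vn _ _ vW vZ) (vf_bracket vW vZ)).
rewrite (lie_nabla IV vW vZ) (jacobi vV vW vZ).
by apply/funext => p; apply/funext => f; rewrite !fldE; ring.
Qed.

(** L_V commutes with the trace by [tr_lie] and with [J], and L_V nabla = 0 gives L_V A_W = A_[V,W].
    This will be the derivative of the moment map. *)
Lemma lie_trA V W p : infaut V -> vf W -> V p (trA W) = trA (bracket V W) p.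
Proof.
move=> IV vW; have [vV _ VJ] := IV; have TW := tensorial_covA vW.
have E Z : vf Z -> bracket V (Jf (covA W Z)) - Jf (covA W (bracket V Z)) =
    Jf (covA (bracket V W) Z).
  move=> vZ; rewrite VJ; last exact: TW.1.
  rewrite -(Jf_sub CJ) ?lie_covA//; first by apply: vf_bracket => //; exact: TW.1.
  by apply: TW.1; exact: vf_bracket.
rewrite /trA (tr_lie p vV (tensorial_JA vW)); first exact: tr_ext.
by apply: tensorial_ext E _; apply: tensorial_JA; exact: vf_bracket.
Qed.

Lemma sf_trA V : vf V -> smooth_fun (trA V).
Proof. by move=> vV; apply: sf_tr; exact: tensorial_JA. Qed.

Lemma trA_comb a V W p : vf V -> vf W ->
  trA (fun p f => a * V p f + W p f) p = a * trA V p + trA W p.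
Proof.
move=> vV vW; rewrite /trA; have [x [E [[Sx vE FE] trE']]] := tr_spec p.
rewrite !trE' mulr_sumr -big_split/=; apply: eq_bigr => i _.
have e : covA (fun p f => a * V p f + W p f) (E i) =
    (fun q f => a * covA V (E i) q f + covA W (E i) q f).
  rewrite /covA (nabla_combl Cn (sf_cst M a) vV vW (vE i)).
  apply/funext => q; apply/funext => f; rewrite !fldE /bracket.
  have [Sf|nf] := pselect (smooth_fun f).
    rewrite (tangentP (vf_tangent q (vE i)) a (vf_sf vV Sf) (vf_sf vW Sf)).
    by ring.
  have z (U : field M) : vf U -> (fun q => U q f) = fun=> 0.
    by move=> vU; apply/funext => y; exact: (tangent_nonsmooth (vf_tangent y vU)).
  have -> : (fun q => a * V q f + W q f) = fun=> 0.
    apply/funext => y; rewrite (tangent_nonsmooth (vf_tangent y vV) nf).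
    by rewrite (tangent_nonsmooth (vf_tangent y vW) nf) mulr0 addr0.
  rewrite (z _ (vE i)) (z _ vV) (z _ vW) (tangent0 (vf_tangent q (vE i))) (tangent0 (vf_tangent q vV)).
  by rewrite (tangent0 (vf_tangent q vW)); ring.
rewrite e.
have [t1 t2] := (vf_tangent p ((tensorial_covA vV).1 _ (vE i)),
  vf_tangent p ((tensorial_covA vW).1 _ (vE i))).
by have := J_comb CJ a t1 t2 => /(congr1 (fun u : vec M => u (x i))).
Qed.

Lemma trA_opp V p : vf V -> trA (- V) p = - trA V p.
Proof.
(* [- V] is the combination [-2 * V + V]. *)
move=> vV; have := trA_comb (-2) p vV vV.
rewrite (_ : (fun p f => _) = - V); first by lra.
by apply/funext => q; apply/funext => f; rewrite fldE; ring.
Qed.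

End automorphisms.

(** * Differentials and push-forwards *)

Section differential.
Context {R : realType} {m n : nat} {M : manifold R m} {N : manifold R n}.

Lemma smooth_smooth_at (F : M -> N) p : smooth F -> smooth_at F p.
Proof. by move=> /(smoothP (premanifold_manifold M) (premanifold_manifold N)); exact. Qed.

Lemma sf_pull (F : M -> N) f : smooth F -> smooth_fun f -> smooth_fun (f \o F).
Proof.
move=> SF Sf; apply: rsm_sf => p.
apply: (@smooth_at_comp _ _ _ _ M N (real_line R) F f p (premanifold_manifold M)
  (premanifold_manifold N)); last exact: smooth_smooth_at.
exact: sf_rsm.
Qed.

Lemma differentialE (F : M -> N) v f : smooth_fun f -> differential F v f = v (f \o F).
Proof. by move=> Sf; rewrite /differential asboolT. Qed.

Lemma differential_tangent (F : M -> N) p v : smooth F -> tangent p v ->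
  tangent (F p) (differential F v).
Proof.
move=> SF Tv; split=> [f nf|a f g Sf Sg|f g Sf Sg].
- by rewrite /differential asboolF.
- have [Sf' Sg'] := (sf_pull SF Sf, sf_pull SF Sg).
  rewrite !differentialE//; last by apply: sfD => //; exact: sfZ.
  exact: (tangentP Tv).
- have [Sf' Sg'] := (sf_pull SF Sf, sf_pull SF Sg).
  rewrite !differentialE//; last exact: sfM.
  exact: (tangentM Tv).
Qed.

Lemma differential_comb (F : M -> N) a u v :
  differential F (fun f => a * u f + v f) =
  (fun f => a * differential F u f + differential F v f).
Proof.
apply/funext => f; rewrite /differential; case: asboolP => // _.
by rewrite mulr0 addr0.
Qed.

End differential.

Lemma differential_comp {R : realType} {l m n : nat} {L : manifold R l} {M : manifold R m}
    {N : manifold R n} (F : L -> M) (G : M -> N) v : smooth G ->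
  differential (G \o F) v = differential G (differential F v).
Proof.
move=> SG; apply/funext => f.
have [Sf|nf] := pselect (smooth_fun f); last by rewrite /differential !asboolF.
by rewrite !differentialE//; exact: sf_pull.
Qed.

Lemma differential_id {R : realType} {n : nat} {M : manifold R n} (p : M) v :
  tangent p v -> differential (fun x : M => x) v = v.
Proof.
move=> Tv; apply/funext => f.
have [Sf|nf] := pselect (smooth_fun f); first by rewrite differentialE.
by rewrite /differential asboolF// (tangent_nonsmooth Tv).
Qed.

Section pushforward.
Context {R : realType} {n : nat} {M : manifold R n}.
Variables phi phi' : M -> M.
Notation vf := (@vector_field R n M).
Implicit Types (X Y Z U V W : field M) (f g h : M -> R) (p q : M).

(** The inverse is passed as data, as with [act g] and [act (inv g)], so pulling back is the same
    operation with the two maps exchanged. *)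
Definition push X : field M := fun q => differential phi (X (phi' q)).

Lemma push_add X Y : push (X + Y) = push X + push Y.
Proof.
apply/funext => q; apply/funext => f; rewrite field_addE /push /differential.
by case: ifP => //; rewrite addr0.
Qed.

Lemma push_opp X : push (- X) = - push X.
Proof.
apply/funext => q; apply/funext => f; rewrite field_oppE /push /differential.
by case: ifP => //; rewrite oppr0.
Qed.

Hypotheses (Sphi : smooth phi) (Sphi' : smooth phi').
Hypotheses (phiK : cancel phi phi') (phiK' : cancel phi' phi).

Lemma pushE X q f : smooth_fun f -> push X q f = X (phi' q) (f \o phi).
Proof. exact: differentialE. Qed.

Lemma push_phi X p : push X (phi p) = differential phi (X p).
Proof. by rewrite /push phiK. Qed.

Lemma vf_push X : vf X -> vf (push X).
Proof.
move=> vX; split=> [q|f Sf].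
  by rewrite -{1}[q]phiK'; apply: differential_tangent => //; exact: vf_tangent.
have -> : (fun q => push X q f) = (fun p => X p (f \o phi)) \o phi'.
  by apply/funext => q; rewrite pushE.
by apply: sf_pull => //; apply: vf_sf => //; exact: sf_pull.
Qed.

Lemma bracket_push X Y : vf X -> vf Y -> bracket (push X) (push Y) = push (bracket X Y).
Proof.
move=> vX vY; have [vpX vpY] := (vf_push vX, vf_push vY).
apply: vf_ext => [||q f Sf]; first exact: vf_bracket.
  by apply: vf_push; exact: vf_bracket.
rewrite pushE// /bracket !pushE//; try exact: vf_sf.
by congr (X _ _ - Y _ _); apply/funext => y; rewrite /= pushE// phiK.
Qed.

End pushforward.

Lemma pushK {R : realType} {n : nat} {M : manifold R n} (phi phi' : M -> M) (X : field M) :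
  smooth phi -> smooth phi' -> cancel phi phi' ->
  vector_field X -> push phi' phi (push phi phi' X) = X.
Proof.
move=> S S' K vX; apply/funext => p; rewrite /push K -differential_comp//.
rewrite (_ : phi' \o phi = fun x => x); last by apply/funext => x; exact: K.
exact: (differential_id (vf_tangent p vX)).
Qed.

(** * Invariance of the Chern connection under automorphisms of (w, J) *)

Section naturality.
Context {R : realType} {n : nat} {M : manifold R n}.
Variables phi phi' : M -> M.
Notation vf := (@vector_field R n M).
Implicit Types (X Y Z U V W : field M) (f g h : M -> R) (p q : M).
Hypotheses (Sphi : smooth phi) (Sphi' : smooth phi').
Hypotheses (phiK : cancel phi phi') (phiK' : cancel phi' phi).
Variables (w : M -> vec M -> vec M -> R) (J : M -> vec M -> vec M).
Hypotheses (Sw : symplectic w) (CJ : compatible_acs w J).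
Variable nabla : field M -> field M -> field M.
Hypothesis Cn : chern_connection w J nabla.
Hypothesis phiw : forall p u v, tangent p u -> tangent p v ->
  w (phi p) (differential phi u) (differential phi v) = w p u v.
Hypothesis phiJ : forall p v, tangent p v ->
  J (phi p) (differential phi v) = differential phi (J p v).
Notation Jf := (Jf J).
Notation gm := (gm w J).
Notation N := (nijenhuis J).
Notation psh := (push phi phi').
Let vfp := vf_push Sphi Sphi' phiK'.

Lemma Jf_push X : vf X -> Jf (psh X) = psh (Jf X).
Proof.
move=> vX; apply/funext => q; rewrite -[RHS]phiJ -?[LHS]/(J q (psh X q)) ?phiK'//.
exact: vf_tangent.
Qed.

Lemma gm_push X Y p : vf X -> vf Y ->
  gm (phi p) (psh X (phi p)) (psh Y (phi p)) = gm p (X p) (Y p).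
Proof.
move=> vX vY; have [TX TY] := (vf_tangent p vX, vf_tangent p vY).
rewrite !(push_phi phiK) -[LHS]/(w _ _ (J _ _)) phiJ// phiw//.
exact: (J_tangent CJ).
Qed.

Lemma nijenhuis_push X Y : vf X -> vf Y -> N (psh X) (psh Y) = psh (N X Y).
Proof.
move=> vX vY; have [vJX vJY] := (Jf_vf CJ vX, Jf_vf CJ vY).
have p4 Z : psh Z *+ 4 = psh (Z *+ 4) by rewrite !mulrS !mulr0n !addr0 !push_add.
apply: field_mul4_inj; rewrite [RHS]p4 !nijenhuis4.
rewrite (Jf_push vX) (Jf_push vY) !(bracket_push Sphi Sphi' phiK phiK')//.
rewrite (Jf_push (vf_bracket vJX vY)) (Jf_push (vf_bracket vX vJY)).
have pB A B : psh (A - B) = psh A - psh B by rewrite push_add push_opp.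
by rewrite -!pB.
Qed.

(** Both [nabla] and its transport by [phi] are metric with torsion [N], because brackets, [N] and
    the metric are carried along by [phi]. So their difference [S] is symmetric in X, Y and skew in
    Y, Z. *)
Lemma nabla_push X Y : vf X -> vf Y -> nabla (psh X) (psh Y) = psh (nabla X Y).
Proof.
have vn U U' : vf U -> vf U' -> vf (nabla U U').
  by move=> vU vU'; exact: (nabla_vf Cn vU vU').
pose S X Y := nabla (psh X) (psh Y) - psh (nabla X Y).
have vS X' Y' : vf X' -> vf Y' -> vf (S X' Y').
  by move=> vX vY; apply: vf_sub; auto.
suff S0 : forall p X Y Z, vf X -> vf Y -> vf Z ->
    gm (phi p) (S X Y (phi p)) (psh Z (phi p)) = 0.
  move=> vX vY; apply/eqP; rewrite -subr_eq0; apply/eqP.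
  apply: (gm_field_zero CJ (vS _ _ vX vY)) => Z vZ q.
  have := S0 (phi' q) X Y (push phi' phi Z) vX vY (vf_push Sphi' Sphi phiK vZ).
  by rewrite phiK' (pushK Sphi' Sphi phiK').
move=> p; have T U : vf U -> tangent (phi p) (U (phi p)) by move=> vU; exact: vf_tangent.
apply: (@sym_skew_zero R _ vf (fun X Y Z => gm (phi p) (S X Y (phi p)) (psh Z (phi p))))
    => {}X {}Y Z vX vY vZ.
  congr (gm _ (_ _) _); apply/eqP; rewrite -subr_eq0; apply/eqP.
  have [vpX vpY] := (vfp vX, vfp vY).
  have t1 := torsionE Cn vX vY; have t2 := torsionE Cn vpX vpY.
  have : psh (nabla X Y) - psh (nabla Y X) = psh (bracket X Y) + psh (N X Y).
    by rewrite -push_opp -!push_add t1.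
  rewrite -(bracket_push Sphi Sphi' phiK phiK' vX vY) -(nijenhuis_push vX vY) -t2 => h.
  apply/funext => q; apply/funext => f; rewrite /S !fldE.
  by have := congr1 (fun F : field M => F q f) h; rewrite !fldE; lra.
have [vpX [vpY vpZ]] := (vfp vX, (vfp vY, vfp vZ)).
have h1 := nabla_gm Cn p vX vY vZ; have h2 := nabla_gm Cn (phi p) vpX vpY vpZ.
have e : psh X (phi p) (fun q => gm q (psh Y q) (psh Z q)) = X p (fun q => gm q (Y q) (Z q)).
  rewrite pushE ?phiK; last exact: (sf_gm Sw CJ vpY vpZ).
  by congr (X p _); apply/funext => q /=; exact: gm_push.
rewrite e h1 -(gm_push p (vn _ _ vX vY) vZ) -(gm_push p vY (vn _ _ vX vZ)) in h2.
have g U U' U'' : vf U -> vf U' -> vf U'' ->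
    gm (phi p) (S U U' (phi p)) (psh U'' (phi p)) =
    gm (phi p) (nabla (psh U) (psh U') (phi p)) (psh U'' (phi p))
    - gm (phi p) (psh (nabla U U') (phi p)) (psh U'' (phi p)).
  move=> vU vU' vU''; rewrite -(gm_subl Sw CJ)//.
  - exact: T (vn _ _ (vfp vU) (vfp vU')).
  - exact: T (vfp (vn _ _ vU vU')).
  - exact: T (vfp vU'').
rewrite !g//; move: h2.
rewrite (gmC Sw CJ (T _ vpY) (T _ (vfp (vn _ _ vX vZ)))).
rewrite (gmC Sw CJ (T _ vpY) (T _ (vn _ _ vpX vpZ))).
lra.
Qed.

Lemma covA_push V Z : vf V -> vf Z ->
  covA nabla (psh V) (psh Z) = psh (covA nabla V Z).
Proof.
move=> vV vZ; rewrite /covA nabla_push// (bracket_push Sphi Sphi' phiK phiK')//.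
by rewrite push_add push_opp.
Qed.

Lemma frame_at_push p (I : finType) (x : I -> M -> R) (E : I -> field M) :
  frame_at p x E -> frame_at (phi p) (fun i => x i \o phi') (fun i => psh (E i)).
Proof.
move=> [Sx vE FE]; split=> [i|i|v f Tv]; first exact: sf_pull.
  exact: vfp.
have [Sf|nf] := pselect (smooth_fun f); last first.
  rewrite (tangent_nonsmooth Tv nf) big1// => i _.
  by rewrite (tangent_nonsmooth (vf_tangent _ (vfp (vE i))) nf) mulr0.
have T' := differential_tangent Sphi' Tv; rewrite phiK in T'.
have := FE _ (f \o phi) T'; rewrite differentialE; last exact: sf_pull.
rewrite (_ : (f \o phi) \o phi' = f); last by apply/funext => q /=; rewrite phiK'.
move=> ->; apply: eq_bigr => i _.
by rewrite differentialE// pushE// phiK.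
Qed.

(** The trace at [phi p] may be taken in the image of the frame used at [p], where the two sums
    agree term by term. *)
Lemma trA_push V p : vf V -> trA J nabla (psh V) (phi p) = trA J nabla V p.
Proof.
move=> vV; rewrite /trA; have [x [E [F ->]]] := tr_spec p; have [Sx vE FE] := F.
rewrite (trE (tensorial_JA CJ Cn (vfp vV)) (frame_at_push F)).
apply: eq_bigr => i _; rewrite covA_push// Jf_push; last first.
  exact: ((tensorial_covA Cn vV).1 _ (vE i)).
rewrite pushE; last exact: sf_pull.
by rewrite phiK; congr (Jf _ _ _); apply/funext => q /=; rewrite phiK.
Qed.

End naturality.

(** * Lie group actions *)

Section lie_groups.
Context {R : realType} {k : nat} {G : lie_group R k}.
Notation "g ** h" := (@lie_mul R k G g h) (at level 40, left associativity).
Notation inv := (@lie_inv R k G).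
Notation one := (lie_one G).
Notation vf := (@vector_field R k G).
Implicit Types (g h : G) (u v : vec G).

Lemma lie_mulgV g : g ** inv g = one.
Proof.
rewrite -[g ** inv g]lie_mul1 -{1}(lie_mulV (inv g)) -lie_mulA (lie_mulA (inv g)).
by rewrite lie_mulV lie_mul1 lie_mulV.
Qed.

Lemma lie_mulg1 g : g ** one = g.
Proof. by rewrite -(lie_mulV g) lie_mulA lie_mulgV lie_mul1. Qed.

Lemma lie_invK : involutive inv.
Proof. by move=> g; rewrite -[LHS]lie_mulg1 -(lie_mulV g) lie_mulA lie_mulV lie_mul1. Qed.

Lemma lie_mul_action : @lie_action R k k G G (@lie_mul R k G).
Proof.
by split; [exact: lie_mul1|move=> g h x; rewrite lie_mulA|exact: lie_mul_smooth].
Qed.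

Section action.
Context {n : nat} {M : manifold R n}.
Variable act : G -> M -> M.
Hypothesis Aact : lie_action act.

Lemma act1 p : act one p = p. Proof. by have [h _ _] := Aact; exact: h. Qed.
Lemma actM g h p : act (g ** h) p = act g (act h p).
Proof. by have [_ m _] := Aact; exact: m. Qed.
Lemma actK g : cancel (act g) (act (inv g)).
Proof. by move=> p; rewrite -actM lie_mulV act1. Qed.
Lemma actKV g : cancel (act (inv g)) (act g).
Proof. by move=> p; rewrite -actM lie_mulgV act1. Qed.

Let pG := premanifold_manifold G.
Let pM := premanifold_manifold M.

Lemma smooth_at_act gp : smooth_at (M := prod_charted G M) (fun gp => act gp.1 gp.2) gp.
Proof.
by have [_ _ /(smoothP (premanifold_prod pG pM) pM)] := Aact; exact.
Qed.

Lemma smooth_act g : smooth (act g).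
Proof.
apply/(smoothP pM pM) => p.
apply: (@smooth_at_comp _ _ _ _ M (prod_charted G M) M (fun p => (g, p))
  (fun gp => act gp.1 gp.2) p pM (premanifold_prod pG pM)); first exact: smooth_at_act.
by apply: smooth_at_pair; [exact: smooth_at_cst|exact: smooth_at_id].
Qed.

Lemma smooth_orbit p : smooth (act^~ p).
Proof.
apply/(smoothP pG pM) => g.
apply: (@smooth_at_comp _ _ _ _ G (prod_charted G M) M (fun g => (g, p))
  (fun gp => act gp.1 gp.2) g pG (premanifold_prod pG pM)); first exact: smooth_at_act.
by apply: smooth_at_pair; [exact: smooth_at_id|exact: smooth_at_cst].
Qed.

Lemma rsm_act (f : M -> R) gp : smooth_fun f ->
  rsm (M := prod_charted G M) (fun gp => f (act gp.1 gp.2)) gp.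
Proof.
move=> Sf.
apply: (@smooth_at_comp _ _ _ _ (prod_charted G M) M (real_line R)
  (fun gp => act gp.1 gp.2) f gp (premanifold_prod pG pM) pM); last exact: smooth_at_act.
exact: sf_rsm.
Qed.

Definition fund (u : vec G) : field M := fun p => differential (act^~ p) u.

Lemma fundE u p f : smooth_fun f -> fund u p f = u (fun g => f (act g p)).
Proof. exact: differentialE. Qed.

Lemma fund_comb a u v : fund (fun f => a * u f + v f) =
  fun p f => a * fund u p f + fund v p f.
Proof. by apply/funext => p; exact: differential_comb. Qed.

Lemma vf_fund u : tangent one u -> vector_field (fund u).
Proof.
move=> Tu; split=> [p|f Sf].
  by rewrite -{1}[p]act1; apply: differential_tangent => //; exact: smooth_orbit.
have -> : (fun p => fund u p f) = fun p => u (fun g => f (act g p)).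
  by apply/funext => p; exact: fundE.
by apply: (smooth_partial_l (F := fun g p => f (act g p)) _ Tu) => gp; exact: rsm_act.
Qed.

(** A Lie derivative taken at the unit of the group: [Z] at the moved point is compared with [Z p]
    transported by [act g]. For the second term, the derivative in [g] is exchanged with the one
    along [Z p]. *)
Lemma bracket_fund u (Z : field M) p f : tangent one u -> vector_field Z -> smooth_fun f ->
  bracket (fund u) Z p f =
  u (fun g => Z (act g p) f) - u (fun g => Z p (fun q => f (act g q))).
Proof.
move=> Tu vZ Sf; rewrite /bracket fundE; last exact: vf_sf.
congr (_ - _).
rewrite (tangent_swap (F := fun g q => f (act g q)) _ Tu (vf_tangent p vZ)); last first.
  by move=> gp; exact: rsm_act.
by congr (Z p _); apply/funext => q; rewrite fundE.
Qed.

Section invariance.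
Variables (w : M -> vec M -> vec M -> R) (J : M -> vec M -> vec M).
Hypotheses (Sw : symplectic w) (CJ : compatible_acs w J).
Hypotheses (Iw : form_invariant act w) (IJ : acs_invariant act J).
Let Tw : two_form w. Proof. by case: Sw. Qed.

(** Invariance under all [act g] is differentiated at the unit. Here [a] is a component of [X] at
    the moved point and [b] that of [X p] transported there; they agree at the unit, and the
    derivative of [a - b] is the bracket. A cutoff frame expresses [w] and [J] at the moved point
    through such components. *)
Lemma infaut_fund u : tangent one u -> infaut w J (fund u).
Proof.
move=> Tu; have vV := vf_fund Tu; pose V := fund u.
pose a (X : field M) p (y : M -> R) g := X (act g p) y.
pose b (X : field M) p (y : M -> R) g := X p (fun q => y (act g q)).
have Sa X p y : vector_field X -> smooth_fun y -> smooth_fun (a X p y).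
  move=> vX Sy; apply: (sf_pull (f := fun p => X p y) (smooth_orbit p)).
  exact: vf_sf.
have Sb X p y : vector_field X -> smooth_fun y -> smooth_fun (b X p y).
  move=> vX Sy; apply: (smooth_partial_r (F := fun g p => y (act g p)) _ (vf_tangent p vX)).
  by move=> gp; exact: rsm_act.
have ab X p y : a X p y one = b X p y one.
  by rewrite /a /b act1; congr (X p _); apply/funext => q; rewrite act1.
have Vab X p y : vector_field X -> smooth_fun y ->
    bracket V X p y = u (a X p y) - u (b X p y).
  by move=> vX Sy; exact: bracket_fund.
have bE X p y g : smooth_fun y -> b X p y g = differential (act g) (X p) y.
  by move=> Sy; rewrite differentialE.
have Td X p g : vector_field X -> tangent (act g p) (differential (act g) (X p)).
  by move=> vX; apply: differential_tangent; [exact: smooth_act|exact: vf_tangent].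
split=> [//|X Y p vX vY|X vX].
- have [chi [x [E [F c1]]]] := frame_around p; have [Sc Sx vE FE] := F.
  have c1p := nbhs_singleton c1.
  have [TV0 TV1] := (vf_tangent p (vf_bracket vV vX), vf_tangent p (vf_bracket vV vY)).
  pose W i j := fun q => w q (E i q) (E j q).
  have SW i j : smooth_fun (W i j) by have [_ _ s] := Tw; exact: s.
  have exp q (v v' : vec M) : tangent q v -> tangent q v' ->
      chi q ^+ 2 * w q v v' = \sum_i \sum_j v (x i) * v' (x j) * W i j q.
    move=> Tv Tv'; rewrite expr2 -mulrA.
    have -> : chi q * w q v v' = w q v (fun f => chi q * v' f).
      by rewrite !(formC Tw Tv) ?(form_scalel Tw)//; [rewrite mulrN|exact: tangent_scale].
    rewrite -(form_scalel Tw _ Tv (tangent_scale _ Tv')).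
    have -> : (fun f => chi q * v f) = (fun f => \sum_i v (x i) * E i q f).
      by apply/funext => f; exact: FE.
    have -> : (fun f => chi q * v' f) = (fun f => \sum_i v' (x i) * E i q f).
      by apply/funext => f; exact: FE.
    have TE i : tangent q (E i q) by exact: vf_tangent.
    rewrite (form_lsuml Tw)//; last exact: tangent_lsum.
    apply: eq_bigr => i _; rewrite (form_lsumr Tw)// mulr_sumr.
    by apply: eq_bigr => j _; rewrite mulrA.
  pose f1 g := chi (act g p) ^+ 2.
  pose f2 g := w (act g p) (X (act g p)) (Y (act g p)).
  have Sf1 : smooth_fun f1.
    by apply: (sf_pull (f := fun q => chi q ^+ 2) (smooth_orbit p)); exact: sfM.
  have Sf2' : smooth_fun (fun q => w q (X q) (Y q)) by have [_ _ s] := Tw; exact: s.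
  have Sf2 : smooth_fun f2 by exact: (sf_pull (smooth_orbit p) Sf2').
  rewrite fundE// -[u _]/(u f2).
  (* The second factor vanishes at the unit, where [f1] is 1, so neither [f1] nor the subtracted
     constant changes the derivative. [f1] is a square because each argument of [w] takes one [chi]
     for its expansion. *)
  have e1 : u (fun g => f1 g * (f2 g - w p (X p) (Y p))) = u f2.
    have Sd : smooth_fun (fun g => f2 g - w p (X p) (Y p)) by apply: sfB => //; exact: sf_cst.
    rewrite (tangentM Tu Sf1 Sd) (tangentB Tu Sf2 (sf_cst _ _)) (tangent_cst Tu).
    by rewrite /f1 /f2 act1 c1p subrr; ring.
  rewrite -e1.
  have -> : (fun g => f1 g * (f2 g - w p (X p) (Y p))) = fun g => \sum_i \sum_j
     ((a X p (x i) g * a Y p (x j) g - b X p (x i) g * b Y p (x j) g) * W i j (act g p)).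
    apply/funext => g; rewrite mulrBr /f1 /f2 exp; try exact: vf_tangent.
    (* By invariance the constant is also [w] at the moved point on the transported vectors, so the
       same frame expands both terms. *)
    rewrite -(Iw g (vf_tangent p vX) (vf_tangent p vY)) exp; try exact: Td.
    rewrite -sumrB; apply: eq_bigr => i _; rewrite -sumrB; apply: eq_bigr => j _.
    by rewrite mulrBl !bE.
  have SWg i j : smooth_fun (fun g => W i j (act g p)).
    exact: (sf_pull (smooth_orbit p) (SW i j)).
  have Sterm i j : smooth_fun (fun g =>
      (a X p (x i) g * a Y p (x j) g - b X p (x i) g * b Y p (x j) g) * W i j (act g p)).
    by apply: sfM => //; apply: sfB; apply: sfM; auto.
  rewrite (tangent_sum Tu); last by move=> i; exact: sf_sum.
  have -> : w p (bracket V X p) (Y p) = \sum_i \sum_j bracket V X p (x i) * Y p (x j) * W i j p.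
    by rewrite -exp ?c1p ?expr1n ?mul1r//; exact: vf_tangent.
  have -> : w p (X p) (bracket V Y p) = \sum_i \sum_j X p (x i) * bracket V Y p (x j) * W i j p.
    by rewrite -exp ?c1p ?expr1n ?mul1r//; exact: vf_tangent.
  rewrite -big_split/=; apply: eq_bigr => i _.
  rewrite (tangent_sum Tu)// -big_split/=; apply: eq_bigr => j _.
  have [Sai Saj] := (Sa X p _ vX (Sx i), Sa Y p _ vY (Sx j)).
  have [Sbi Sbj] := (Sb X p _ vX (Sx i), Sb Y p _ vY (Sx j)).
  rewrite (tangentM Tu) ?(tangentB Tu) ?(tangentM Tu Sai Saj) ?(tangentM Tu Sbi Sbj);
    try by [exact: sfM|apply: sfB; exact: sfM|].
  rewrite -!ab !Vab// /a act1; ring.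
apply: vf_ext => [||p f Sf]; first by apply: vf_bracket => //; exact: Jf_vf CJ _ vX.
  by apply: (Jf_vf CJ); exact: vf_bracket.
have vJX := Jf_vf CJ vX.
have [chi [x [E [F c1]]]] := frame_around p; have [Sc Sx vE FE] := F.
have c1p := nbhs_singleton c1.
pose f1 g := chi (act g p).
have Sf1 : smooth_fun f1 by exact: (sf_pull (smooth_orbit p) Sc).
have [SaJ SbJ] := (Sa _ p _ vJX Sf, Sb _ p _ vJX Sf).
rewrite Vab//.
have -> : u (a (Jf J X) p f) - u (b (Jf J X) p f) =
    u (fun g => f1 g * (a (Jf J X) p f g - b (Jf J X) p f g)).
  rewrite (tangentM Tu Sf1 (sfB SaJ SbJ)) (tangentB Tu SaJ SbJ) ab subrr mulr0 add0r.
  by rewrite /f1 act1 c1p mul1r.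
have -> : (fun g => f1 g * (a (Jf J X) p f g - b (Jf J X) p f g)) =
    fun g => \sum_i (a X p (x i) g - b X p (x i) g) * Jf J (E i) (act g p) f.
  apply/funext => g; have [t1 t2] := (vf_tangent (act g p) vX, Td X p g vX).
  have e : a (Jf J X) p f g - b (Jf J X) p f g =
      J (act g p) (X (act g p) - differential (act g) (X p)) f.
    by rewrite (J_sub CJ t1 t2) (IJ g (vf_tangent p vX)) [b _ _ _ _]bE.
  (* [tensor_frame] speaks of fields, so the difference of the two vectors is extended to one. *)
  have [Z vZ Zv] := vector_field_extend (tangent_subv t1 t2).
  rewrite e -Zv -[X in f1 g * X]/(Jf J Z _ _) (tensor_frame (tensorial_J CJ) _ _ F vZ) Zv.
  by apply: eq_bigr => i _; rewrite bE.
have SJg i : smooth_fun (fun g => Jf J (E i) (act g p) f).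
  apply: (sf_pull (f := fun q => Jf J (E i) q f) (smooth_orbit p)).
  by apply: vf_sf => //; exact: Jf_vf CJ _ (vE i).
have vVX := vf_bracket vV vX.
rewrite -[RHS]mul1r -c1p (tensor_frame (tensorial_J CJ) _ _ F vVX).
rewrite (tangent_sum Tu); last by move=> i; apply: sfM => //; apply: sfB; auto.
apply: eq_bigr => i _; have [Sai Sbi] := (Sa X p _ vX (Sx i), Sb X p _ vX (Sx i)).
rewrite (tangentM Tu (sfB Sai Sbi) (SJg i)) (tangentB Tu Sai Sbi) ab subrr mul0r addr0.
by rewrite act1 Vab.
Qed.

End invariance.
End action.
End lie_groups.

(** * Left-invariant fields, fundamental fields and the adjoint action *)

Section lie_algebra.
Context {R : realType} {k : nat} {G : lie_group R k}.
Notation "g ** h" := (@lie_mul R k G g h) (at level 40, left associativity).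
Notation inv := (@lie_inv R k G).
Notation one := (lie_one G).
Implicit Types (g h : G) (u v : vec G) (X Y Z : field G).

Let AL := @lie_mul_action R k G.

Definition linv u : field G := fun g => differential (lie_mul g) u.

Lemma linv_one u : tangent one u -> linv u one = u.
Proof.
move=> Tu; rewrite /linv (_ : lie_mul one = fun x => x); first exact: differential_id Tu.
by apply/funext => x; exact: lie_mul1.
Qed.

Lemma lie_algebra_linv u : tangent one u -> lie_algebra (linv u).
Proof.
move=> Tu; split.
  split=> [g|f Sf].
    have := differential_tangent (smooth_act AL g) Tu.
    by rewrite lie_mulg1.
  have -> : (fun g => linv u g f) = fun g => u (fun h => f (g ** h)).
    by apply/funext => g; rewrite /linv differentialE.
  by apply: (smooth_partial_r (F := fun g h => f (g ** h)) _ Tu) => gh; exact: (rsm_act AL).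
move=> g h; rewrite /linv -differential_comp; last exact: (smooth_act AL).
congr (differential _ u); by apply/funext => x /=; rewrite lie_mulA.
Qed.

Lemma lie_algebra_tangent X : lie_algebra X -> tangent one (X one).
Proof. by move=> [vX _]; exact: vf_tangent. Qed.

Lemma lie_algebraE X : lie_algebra X -> X = linv (X one).
Proof. by move=> [vX LX]; apply/funext => g; rewrite /linv LX lie_mulg1. Qed.

Lemma lie_algebra_val X g f : lie_algebra X -> smooth_fun f ->
  X g f = X one (fun h => f (g ** h)).
Proof. by move=> LX Sf; rewrite {1}(lie_algebraE LX) /linv differentialE. Qed.

Lemma lie_algebra_comb a X Y : lie_algebra X -> lie_algebra Y ->
  lie_algebra (fun p f => a * X p f + Y p f).
Proof.
move=> [vX LX] [vY LY]; split; first by apply: vf_comb => //; exact: sf_cst.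
by move=> g h; rewrite differential_comb LX LY.
Qed.

Lemma lie_algebra_bracket X Y : lie_algebra X -> lie_algebra Y ->
  lie_algebra (bracket X Y).
Proof.
move=> [vX LX] [vY LY]; have vXY := vf_bracket vX vY; split=> // g h.
have SL := smooth_act AL g.
apply: (@tangent_ext _ _ _ (g ** h)) => [||f Sf].
- by apply: differential_tangent => //; exact: vf_tangent.
- exact: vf_tangent.
have e (Z : field G) q : (forall g h, differential (lie_mul g) (Z h) = Z (g ** h)) ->
    forall f, smooth_fun f -> Z q (f \o lie_mul g) = Z (g ** q) f.
  by move=> LZ f' Sf'; rewrite -LZ differentialE.
rewrite differentialE// /bracket.
rewrite -(e X)//; last exact: vf_sf.
rewrite -(e Y)//; last exact: vf_sf.
by congr (X h _ - Y h _); apply/funext => q /=; rewrite e.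
Qed.

Section action.
Context {n : nat} {M : manifold R n}.
Variable act : G -> M -> M.
Hypothesis Aact : lie_action act.
Notation fund X := (fund act (X one)).

(** Differentiating at the moved point [act g p] involves the products [h ** g], while
    left-invariant fields involve [g ** h]. After [tangent_swap] the two terms are therefore those
    of the bracket on the group with the roles of [X] and [Y] exchanged, whence the sign. *)
Lemma fund_bracket X Y : lie_algebra X -> lie_algebra Y ->
  bracket (fund X) (fund Y) = - fund (bracket X Y).
Proof.
move=> LX LY; have [TX TY] := (lie_algebra_tangent LX, lie_algebra_tangent LY).
have [vX vY] := (vf_fund Aact TX, vf_fund Aact TY).
have LXY := lie_algebra_bracket LX LY.
have vXY := vf_fund Aact (lie_algebra_tangent LXY).
apply: vf_ext => [||p f Sf]; [exact: vf_bracket|exact: vf_opp|].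
have SF : smooth_fun (fun g => f (act g p)) by exact: (sf_pull (smooth_orbit Aact p)).
rewrite fldE fundE// (bracket_fund Aact p TX vY Sf) /bracket.
have e1 : X one (fun g => fund Y (act g p) f) = Y one (fun h => X h (fun g => f (act g p))).
  have -> : (fun g => fund Y (act g p) f) = fun g => Y one (fun h => f (act (h ** g) p)).
    by apply/funext => g; rewrite fundE//; congr (Y one _); apply/funext => h; rewrite (actM Aact).
  rewrite (tangent_swap (F := fun g h => f (act (h ** g) p)) _ TX TY).
    by congr (Y one _); apply/funext => h; rewrite [RHS]lie_algebra_val.
  move=> gh.
  have pG := premanifold_manifold G; have pGG := premanifold_prod pG pG.
  apply: (@smooth_at_comp _ _ _ _ (prod_charted G G) (prod_charted G G) (real_line R)
    (fun gh => (gh.2, gh.1)) (fun gh => f (act (gh.1 ** gh.2) p)) gh pGG pGG).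
    exact: (rsm_act AL _ SF).
  by apply: smooth_at_pair; [exact: smooth_at_snd|exact: smooth_at_fst].
have e2 : X one (fun g => fund Y p (fun q => f (act g q))) =
    X one (fun h => Y h (fun g => f (act g p))).
  congr (X one _); apply/funext => g; rewrite fundE; last exact: (sf_pull (smooth_act Aact g)).
  rewrite [RHS]lie_algebra_val//; congr (Y one _).
  by apply/funext => h; rewrite (actM Aact).
by rewrite e1 e2 opprB.
Qed.

Lemma Ad_one g X f : lie_algebra X -> smooth_fun f ->
  Ad g X one f = X one (fun h => f (g ** h ** inv g)).
Proof. by move=> LX Sf; rewrite /Ad lie_mulg1 lie_mulV differentialE. Qed.

Lemma smooth_conj g : smooth (fun h : G => g ** h ** inv g).
Proof.
apply/(smoothP (premanifold_manifold G) (premanifold_manifold G)) => h.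
apply: (@smooth_at_comp _ _ _ _ G G G (lie_mul g) (fun x => x ** inv g)).
- exact: premanifold_manifold.
- exact: premanifold_manifold.
- by apply: smooth_smooth_at; exact: (smooth_orbit AL).
- by apply: smooth_smooth_at; exact: (smooth_act AL).
Qed.

Lemma Ad_linv g X : lie_algebra X -> tangent one (Ad g X one) /\ Ad g X = linv (Ad g X one).
Proof.
move=> LX; have TX := lie_algebra_tangent LX.
have TA : tangent one (Ad g X one).
  have := differential_tangent (smooth_conj g) TX.
  by rewrite /Ad lie_mulg1 lie_mulgV lie_mulg1 lie_mulV.
split=> //; apply/funext => h; apply/funext => f.
have [Sf|nf] := pselect (smooth_fun f); last first.
  by rewrite /linv /Ad /differential !asboolF.
rewrite /linv differentialE//.
have SfL := sf_pull (smooth_act AL h) Sf.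
rewrite Ad_one// /Ad differentialE//.
have SfC := sf_pull (smooth_conj g) Sf.
rewrite lie_algebra_val//; congr (X one _); apply/funext => x /=.
by rewrite !lie_mulA lie_mulgV lie_mul1.
Qed.

Lemma lie_algebra_Ad g X : lie_algebra X -> lie_algebra (Ad g X).
Proof. by move=> /(Ad_linv g)[TA ->]; exact: lie_algebra_linv. Qed.

Lemma fund_Ad g X : lie_algebra X ->
  fund (Ad g X) = push (act g) (act (inv g)) (fund X).
Proof.
move=> LX; have TX := lie_algebra_tangent LX; have [TA _] := Ad_linv g LX.
have [K1 K2] := (actK Aact g, actKV Aact g).
have [S1 S2] := (smooth_act Aact g, smooth_act Aact (inv g)).
apply: vf_ext => [||p f Sf]; first exact: (vf_fund Aact TA).
  by apply: vf_push => //; exact: (vf_fund Aact TX).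
have SF : smooth_fun (fun g => f (act g p)) by exact: (sf_pull (smooth_orbit Aact p)).
rewrite pushE// fundE// Ad_one// fundE; last exact: sf_pull.
by congr (X one _); apply/funext => h /=; rewrite !(actM Aact).
Qed.

End action.
End lie_algebra.

(** * The moment map *)

Section moment.
Context {R : realType} {k n : nat} {G : lie_group R k} {M : manifold R n}.
Notation "g ** h" := (@lie_mul R k G g h) (at level 40, left associativity).
Notation inv := (@lie_inv R k G).
Notation one := (lie_one G).
Variable act : G -> M -> M.
Variables (w : M -> vec M -> vec M -> R) (J : M -> vec M -> vec M).
Variables (rho : M -> vec M -> vec M -> R) (lambda : R).
Variable nabla : field M -> field M -> field M.
Hypotheses (Aact : lie_action act) (Sw : symplectic w) (CJ : compatible_acs w J).
Hypotheses (Iw : form_invariant act w) (IJ : acs_invariant act J).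
Hypothesis Cn : chern_connection w J nabla.
Hypothesis rho_trace : forall X Y, vector_field X -> vector_field Y -> forall p,
  is_trace_at (fun Z q => J q (curvature nabla X Y Z q)) p (rho p (X p) (Y p)).
Hypothesis lambda_neq0 : lambda <> 0.
Hypothesis rhoE : forall p u v, tangent p u -> tangent p v ->
  rho p u v = lambda * w p u v.
Implicit Types (g h : G) (X Y Z : field G).
Notation fund X := (fund act (X one)).
Notation trA := (trA J nabla).

Definition moment (p : M) : field G -> R := fun Z =>
  if `[< lie_algebra Z >] then - lambda^-1 * trA (fund Z) p else 0.

Lemma momentE p Z : lie_algebra Z -> moment p Z = - lambda^-1 * trA (fund Z) p.
Proof. by move=> LZ; rewrite /moment asboolT. Qed.

Lemma moment_lie_dual p : lie_dual (moment p).
Proof.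
split=> [X nX|a X Y LX LY]; first by rewrite /moment asboolF.
have [TX TY] := (lie_algebra_tangent LX, lie_algebra_tangent LY).
rewrite !momentE//; last exact: lie_algebra_comb.
rewrite fund_comb (trA_comb CJ Cn a p (vf_fund Aact TX) (vf_fund Aact TY)).
by ring.
Qed.

Lemma moment_bracket p X Y : lie_algebra X -> lie_algebra Y ->
  moment p (bracket X Y) = w p (fund X p) (fund Y p).
Proof.
move=> LX LY; have [TX TY] := (lie_algebra_tangent LX, lie_algebra_tangent LY).
have [vX vY] := (vf_fund Aact TX, vf_fund Aact TY).
have IX := infaut_fund Aact Sw CJ Iw IJ TX; have IY := infaut_fund Aact Sw CJ Iw IJ TY.
have LXY := lie_algebra_bracket LX LY.
have vXY := vf_fund Aact (lie_algebra_tangent LXY).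
rewrite momentE//; have := ricci_trA Sw CJ Cn IX IY (rho_trace vX vY p).
rewrite rhoE; try exact: vf_tangent.
rewrite (fund_bracket Aact LX LY) (trA_opp CJ Cn p vXY) => e.
have /eqP l0 := lambda_neq0.
have -> : trA (fund (bracket X Y)) p = - (lambda * w p (fund X p) (fund Y p)) by rewrite e opprK.
by rewrite mulrNN mulrA mulVf// mul1r.
Qed.

(** [trA] is invariant under automorphisms, and these carry fundamental fields to fundamental fields
    of adjoint images. Since [coAd g] contains [Ad (inv g)], the automorphism used is
    [act (inv g)]. *)
Lemma moment_equivariant g p : moment (act g p) = coAd g (moment p).
Proof.
apply/funext => Z; rewrite /coAd; case: asboolP => [LZ|nL]; last by rewrite /moment asboolF.
rewrite !momentE//; last exact: lie_algebra_Ad.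
rewrite (fund_Ad Aact (inv g) LZ) lie_invK; congr (_ * _).
have S g' := smooth_act Aact g'.
have := trA_push (S (inv g)) (S g) (actKV Aact g) (actK Aact g) Sw CJ Cn
  (Iw (inv g)) (IJ (inv g)) (act g p) (vf_fund Aact (lie_algebra_tangent LZ)).
by rewrite (actK Aact) => ->.
Qed.

Lemma sf_moment Z : smooth_fun (fun p => moment p Z).
Proof.
have [LZ|nL] := pselect (lie_algebra Z); last first.
  rewrite (_ : (fun p => moment p Z) = fun=> 0); first exact: sf_cst.
  by apply/funext => p; rewrite /moment asboolF.
rewrite (_ : (fun p => moment p Z) = fun p => - lambda^-1 * trA (fund Z) p).
  by apply: sfZ; apply: (sf_trA CJ Cn); exact: (vf_fund Aact (lie_algebra_tangent LZ)).
by apply/funext => p; rewrite momentE.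
Qed.

(** The component of the moment map along [Z] is a Hamiltonian of the fundamental field of [Z]: by
    [lie_trA] its derivative is the trace attached to a bracket, which [moment_bracket]
    evaluates. *)
Lemma moment_derive Y Z p : lie_algebra Y -> lie_algebra Z ->
  fund Y p (fun q => moment q Z) = w p (fund Z p) (fund Y p).
Proof.
move=> LY LZ; have [TY TZ] := (lie_algebra_tangent LY, lie_algebra_tangent LZ).
have [vY vZ] := (vf_fund Aact TY, vf_fund Aact TZ).
have IY := infaut_fund Aact Sw CJ Iw IJ TY.
have LYZ := lie_algebra_bracket LY LZ; have Tw : two_form w by case: Sw.
have vYZ := vf_fund Aact (lie_algebra_tangent LYZ).
rewrite (_ : (fun q => moment q Z) = fun q => - lambda^-1 * trA (fund Z) q); last first.
  by apply/funext => q; rewrite momentE.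
rewrite (tangentZ (vf_tangent p vY)); last exact: (sf_trA CJ Cn).
rewrite (lie_trA Sw CJ Cn p IY vZ) (fund_bracket Aact LY LZ) (trA_opp CJ Cn p vYZ).
rewrite (formC Tw (vf_tangent p vZ) (vf_tangent p vY)) -(moment_bracket p LY LZ) momentE//.
by rewrite mulrN.
Qed.

End moment.

(** * Local sections of transitive actions *)

Section orbit_map.
Context {R : realType} {k n : nat}.
Variables (Phi : 'rV[R]_k * 'rV[R]_n -> 'rV[R]_n) (b : 'rV[R]_k) (z0 : 'rV[R]_n).
Implicit Types (a e : 'rV[R]_k) (y z v : 'rV[R]_n).
Hypothesis CPhi : \forall az \near (b, z0), Cinf_at az Phi.
Hypothesis Phi1 : \forall z \near z0, Phi (b, z) = z.

(** [Phi] stands for the action read in charts, [b] for the unit and [z0] for a point; this is the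
    derivative at the unit of the orbit map of [z]. *)
Definition orbit_jac z : 'M[R]_(k, n) := jac (fun a => Phi (a, z)) b.
Let D := orbit_jac z0.
(** Row vectors are multiplied on the right, and [D *m A *m D = D]. Thus [P] is a projection onto
    the row space of [D], that is, onto the orbit directions at [z0]. *)
Let A := pinvmx D.
Let P := A *m D.

Let lin y : 'rV[R]_k * 'rV[R]_n := (b + y *m A, z0 + y *m (1%:M - P)).
(* The orbit map in the directions of its range, the flat coordinates in a
   complement: the derivative at 0 is the identity. *)
Definition straighten y := Phi (lin y).
Notation Psi := straighten.

Let DP : D *m P = D. Proof. by rewrite /P mulmxA mulmxKpV. Qed.
Let PP : P *m P = P. Proof. by rewrite {1}/P -mulmxA DP. Qed.
Let rankP : \rank P = \rank D.
Proof.
by apply/eqP; rewrite eqn_leq {1}/P mxrankM_maxr -{1}DP mxrankM_maxr.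
Qed.

Lemma Cinf_aff m (B : 'M[R]_(n, m)) (c : 'rV[R]_m) y : Cinf_at y (fun y => c + y *m B).
Proof.
apply: Cinf_atD; first exact: Cinf_at_cst.
have Lm : linear (fun y => y *m B) by move=> r u v; rewrite mulmxDl scalemxAl.
have Cm := findimE (findim_rV n) Lm.
exact: Cinf_at_linear Lm Cm.
Qed.

Lemma derive_aff m (B : 'M[R]_(n, m)) (c : 'rV[R]_m) y v : 'D_v (fun y => c + y *m B) y = v *m B.
Proof.
have Lm : linear (fun y => y *m B) by move=> r u w; rewrite mulmxDl scalemxAl.
have Cm : continuous (fun y => y *m B) by exact: (findimE (findim_rV n) Lm).
have Cl : Cinf_at y (fun y => y *m B) by exact: Cinf_at_linear Lm Cm.
rewrite deriveD; [|exact: derivable_cst|exact: Cinf_at_derivable].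
by rewrite derive_cst add0r derive_linear.
Qed.

Lemma Clin y : Cinf_at y lin.
Proof. by apply: Cinf_at_pair; exact: Cinf_aff. Qed.

Lemma lin0 : lin 0 = (b, z0).
Proof. by rewrite /lin !mul0mx !addr0. Qed.

Let fkn := findim_prod (findim_rV (R := R) k) (findim_rV (R := R) n).

Lemma derive_lin y v : Cinf_at (lin y) Phi ->
  'D_v Psi y = 'D_(v *m A) (fun a => Phi (a, (lin y).2)) (lin y).1 +
               'D_(v *m (1%:M - P)) (fun z => Phi ((lin y).1, z)) (lin y).2.
Proof.
move=> C; rewrite -[LHS]/('D_v (Phi \o lin) y) (derive_comp v C (Clin y)).
have -> : 'D_v lin y = (v *m A, v *m (1%:M - P)).
  have [C1 C2] := (Cinf_aff A b y, Cinf_aff (1%:M - P) z0 y).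
  rewrite (deriveE _ (Cinf_at_diff (Clin y))).
  rewrite (@diff_pair _ _ _ _ (fun y => b + y *m A) (fun y => z0 + y *m (1%:M - P))) /=;
    try exact: Cinf_at_diff.
  by rewrite -!deriveE; try (exact: Cinf_at_diff); rewrite !derive_aff.
have -> : (v *m A, v *m (1%:M - P)) = (v *m A, 0) + (0, v *m (1%:M - P)).
  by apply: injective_projections; rewrite /= ?addr0 ?add0r.
have /linear_pack[l lE] := derive_linearv C.
rewrite -[LHS]/((fun u => 'D_u Phi (lin y)) _) -lE linearD lE.
move: C {l lE}; case: (lin y) => a z C.
by rewrite (derive_pair_l _ C) (derive_pair_r _ C).
Qed.

Lemma straighten0 : Psi 0 = z0.
Proof. by rewrite /straighten lin0 (nbhs_singleton Phi1). Qed.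

Lemma Cinf_straighten0 : Cinf_at 0 Psi.
Proof.
apply: (@Cinf_at_comp _ _ _ _ 0 Phi lin) => //.
  by rewrite lin0; exact: nbhs_singleton CPhi.
exact: Clin.
Qed.

Lemma derive_straighten0 v : 'D_v Psi 0 = v.
Proof.
have C := nbhs_singleton CPhi.
rewrite derive_lin lin0//= jacE; last first.
  by apply: (@Cinf_at_comp _ _ _ _ b Phi (fun a => (a, z0))) => //;
     apply: Cinf_at_pair; [exact: Cinf_at_id|exact: Cinf_at_cst].
have -> : 'D_(v *m (1%:M - P)) (fun z => Phi (b, z)) z0 = 'D_(v *m (1%:M - P)) id z0.
  exact: near_eq_derive.
by rewrite derive_id -[jac _ _]/D -mulmxA mulmxBr mulmx1 addrC subrK.
Qed.

(** At full rank [P] is the identity, so [straighten] is the orbit map of [z0] along the directions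
    [y *m A]; its local inverse, followed by this affine map, is the section. *)
Lemma local_section_coord : \rank D = n -> exists U (h : 'rV[R]_n -> 'rV[R]_k),
  [/\ open_nbhs z0 U, h z0 = b &
      forall z, U z -> Cinf_at z h /\ Phi (h z, z0) = z].
Proof.
move=> rD; have P1 : P = 1%:M.
  have /row_fullP[Q QD] : row_full D by rewrite /row_full rD.
  by rewrite -[P]mul1mx -QD -mulmxA DP.
have [U [h [[oU U0] _ oV H CH]]] := inverse_function filterT Cinf_straighten0 derive_straighten0.
exists (Psi @` U), (fun z => b + h z *m A); split.
- by split=> //; exists 0 => //; exact: straighten0.
- have [h0 _ _] := H _ U0; rewrite straighten0 in h0.
  by rewrite h0 mul0mx addr0.
- move=> _ [y Uy <-]; split.
    apply: (@Cinf_at_comp _ _ _ _ _ (fun y => b + y *m A) h); [exact: findim_rV|exact: Cinf_aff|].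
    by apply: CH; exists y.
  have [-> _ _] := H _ Uy.
  by rewrite /straighten /lin P1 subrr mulmx0 addr0.
Qed.

(** The group law in coordinates: [kappa] is right translation by the inverse of the element [az.1].
    It turns the orbit map of [az.2] near [az.1] into the orbit map of [Phi az] near the unit. *)
Hypothesis transport : \forall az \near (b, z0), exists kappa : 'rV[R]_k -> 'rV[R]_k,
  [/\ kappa az.1 = b, Cinf_at az.1 kappa &
      \forall a \near az.1, Phi (a, az.2) = Phi (kappa a, Phi az)].
Hypothesis rank_le : \forall z \near z0, (\rank (orbit_jac z) <= \rank D)%N.

(** A Frobenius statement for orbits of locally maximal rank: in the straightened coordinates they
    stay in slices where the component along [1%:M - P] is constant. This component is [tau], and
    [zeta] is a curve crossing the slices. *)
Lemma orbit_transversal : (\rank D < n)%N ->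
  exists (tau : 'rV[R]_n -> 'rV[R]_n) (v : 'rV[R]_n) (zeta : R -> 'rV[R]_n),
  [/\ v != 0, zeta s @[s --> 0] --> z0,
      \forall s \near 0, tau (zeta s) = s *: v &
      \forall z \near z0, \forall a \near b, tau (Phi (a, z)) = tau z].
Proof.
move=> rD; pose good az := Cinf_at az Phi /\ exists kappa : 'rV[R]_k -> 'rV[R]_k,
  [/\ kappa az.1 = b, Cinf_at az.1 kappa &
      \forall a \near az.1, Phi (a, az.2) = Phi (kappa a, Phi az)].
have pD : \forall az \near (b, z0), good az by exact: filterI.
have cl0 : {for (0 : 'rV[R]_n), continuous lin} by exact: Cinf_at_continuous (Clin 0).
have N1 : nbhs (0 : 'rV[R]_n) [set y | good (lin y)].
  by apply: (@near_comp _ _ lin 0 good cl0); rewrite lin0.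
have Cz : \forall z \near z0, Cinf_at (b, z) Phi.
  apply: (@near_comp _ _ (fun z => (b, z)) z0 (fun az => Cinf_at az Phi)) CPhi.
  by apply: Cinf_at_continuous; apply: Cinf_at_pair; [exact: Cinf_at_cst|exact: Cinf_at_id].
have Cl az : Cinf_at az Phi -> Cinf_at az.1 (fun a => Phi (a, az.2)).
  case: az => a z C; apply: (@Cinf_at_comp _ _ _ _ a Phi (fun a => (a, z))) => //.
  by apply: Cinf_at_pair; [exact: Cinf_at_id|exact: Cinf_at_cst].
have [U [h [[oU U0] UN oV H CH]]] := inverse_function N1 Cinf_straighten0 derive_straighten0.
pose tau z := h z *m (1%:M - P).
have Ctau z : (Psi @` U) z -> Cinf_at z tau.
  move=> Vz; apply: (@Cinf_at_ext _ _ _ _ (fun z => 0 + h z *m (1%:M - P))).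
    by move=> y; rewrite add0r.
  apply: (@Cinf_at_comp _ _ _ _ _ (fun y => 0 + y *m (1%:M - P)) h); first exact: findim_rV.
    exact: Cinf_aff.
  exact: CH.
pose W := [set z | (Psi @` U) z /\ Cinf_at (b, z) Phi /\ (\rank (orbit_jac z) <= \rank D)%N
  /\ Phi (b, z) = z].
have nW : nbhs z0 W.
  apply: filterI; last by apply: filterI => //; apply: filterI.
  by apply: open_nbhs_nbhs; split=> //; exists 0 => //; exact: straighten0.
(* The image under [jac Psi y] of the range of [P] lies in the orbit directions at [z]; by the rank
   hypothesis it is all of them. But [tau \o Psi] is multiplication by [1%:M - P], which kills the
   range of [P]. *)
have tau0 z : W z -> forall e, 'D_e (fun a => tau (Phi (a, z))) b = 0.
  move=> [[y Uy yz] [Cbz [rz bz]]] e; have [C [kappa [k1 Ck kE]]] := UN _ Uy.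
  have [hK CPsi uJ] := H _ Uy.
  have sub : (P *m jac Psi y <= orbit_jac z)%MS.
    apply/row_subP => i; rewrite row_mul -jacE// derive_lin//.
    have -> : row i P *m (1%:M - P) = 0.
      by rewrite mulmxBr mulmx1 -row_mul PP subrr.
    rewrite (_ : 'D_0 _ _ = 0) ?addr0; last first.
      have C2 : Cinf_at (lin y).2 (fun z => Phi ((lin y).1, z)).
        apply: (@Cinf_at_comp _ _ _ _ _ Phi (fun z => ((lin y).1, z))) => //.
        by apply: Cinf_at_pair; [exact: Cinf_at_cst|exact: Cinf_at_id].
      by rewrite (jacE _ C2) mul0mx.
    have -> : 'D_(row i P *m A) (fun a => Phi (a, (lin y).2)) (lin y).1 =
        'D_(row i P *m A) ((fun a => Phi (a, z)) \o kappa) (lin y).1.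
      by apply: near_eq_derive; apply: filterS kE => x /= ->; rewrite -yz.
    rewrite (derive_comp _ _ Ck) k1; last exact: (Cl (b, z)).
    by rewrite jacE; [exact: submxMl|exact: (Cl (b, z))].
  have rPJ : \rank (P *m jac Psi y) = \rank D.
    by rewrite mxrankMfree ?rankP// row_free_unit.
  have [_ eqr] := mxrank_leqif_sup sub.
  have /submxP[Q QE] : (orbit_jac z <= P *m jac Psi y)%MS.
    by rewrite -eqr eqn_leq rPJ rz -{1}rPJ mxrankS.
  have Ct : Cinf_at (Phi (b, z)) tau by rewrite bz; apply: Ctau; exists y.
  have Cb := Cl _ Cbz.
  have -> : 'D_e (fun a => tau (Phi (a, z))) b = 'D_e (tau \o (fun a => Phi (a, z))) b by [].
  rewrite (derive_comp e Ct Cb) bz (jacE _ Cb).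
  rewrite -[jac _ _]/(orbit_jac z) QE (mulmxA e) (mulmxA (e *m Q)) -(jacE _ CPsi) -yz.
  rewrite -derive_comp//; last by apply: Ctau; exists y.
  have -> : 'D_(e *m Q *m P) (tau \o Psi) y =
      'D_(e *m Q *m P) (fun y => 0 + y *m (1%:M - P)) y.
    apply: near_eq_derive; have : nbhs y U by exact: open_nbhs_nbhs.
    by apply: filterS => x Ux; have [hx _ _] := H _ Ux; rewrite /tau/= hx add0r.
  by rewrite derive_aff -mulmxA mulmxBr mulmx1 PP subrr mulmx0.
have [v v0 vP] : exists2 v : 'rV[R]_n, v != 0 & v *m (1%:M - P) = v.
  have : 1%:M - P != 0.
    by apply: contraTneq rD => /subr0_eq P1; rewrite -rankP -P1 mxrank1 ltnn.
  move=> /eqP n0; have [i ri] : exists i, row i (1%:M - P) != 0.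
    apply: contrapT => hn; apply: n0; apply/row_matrixP => i; rewrite row0.
    by apply/eqP; apply: contrapT => ri; apply: hn; exists i; apply/negP.
  exists (row i (1%:M - P)) => //.
  by rewrite -row_mul mulmxBl mul1mx mulmxBr mulmx1 PP subrr subr0.
exists tau, v, (fun s => Psi (s *: v)); split=> //.
- have cs : {for (0 : R^o), continuous (fun s : R^o => s *: v)} by exact: scalel_continuous.
  have cP : Psi y @[y --> (0 : R^o) *: v] --> z0.
    by rewrite scale0r -[X in _ --> X]straighten0; exact: Cinf_at_continuous Cinf_straighten0.
  exact: cvg_comp cs cP.
- have cs : {for (0 : R^o), continuous (fun s : R^o => s *: v)} by exact: scalel_continuous.
  have nU : nbhs ((0 : R^o) *: v) U by rewrite scale0r; exact: open_nbhs_nbhs.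
  have := near_comp cs nU; apply: filterS => s Us.
  by have [hs _ _] := H _ Us; rewrite /tau hs -scalemxAl vP.
have cPhi : {for (b, z0), continuous Phi}.
  by apply: Cinf_at_continuous; exact: nbhs_singleton CPhi.
have Wgood : \forall az \near (b, z0), W (Phi az) /\ good az.
  apply: filterI => //; apply: (near_comp cPhi).
  by rewrite (nbhs_singleton Phi1).
have [[B1 B2] /= [nB1 nB2] BB] := Wgood.
have [d d0 dB] := (nbhs_ballP _ _).1 nB1.
apply: (filterS2 _ _ nB2 nW) => z B2z Wz.
have : nbhs b (ball b d) by exact: nbhsx_ballx.
apply: filterS => a da; apply/rowP => i.
have bb : ball b d b by exact: ballxx.
have -> : tau z = tau (Phi (b, z)) by have [_ [_ [_ ->]]] := Wz.
(* [tau0] gives a zero derivative at the unit only; [kappa] reduces the derivative at [a] to the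
   unit, for the orbit map of [Phi (a, z)]. *)
apply: (@derive0_cst R k (fun a => tau (Phi (a, z)) 0 i) b d _ a b da bb) => {da}a da.
have [Wa [Ca [kappa [k1 Ck kE]]]] : W (Phi (a, z)) /\ good (a, z).
  by apply: (BB (a, z)); split=> //; exact: dB.
have Ct : Cinf_at a (fun a => tau (Phi (a, z))).
  apply: (@Cinf_at_comp _ _ _ _ a tau (fun a => Phi (a, z))); [exact: findim_rV| |exact: (Cl (a, z))].
  by apply: Ctau; have [] := Wa.
split=> [|e]; first exact: (@Cinf_at_coord _ _ _ _ a (fun a => tau (Phi (a, z))) 0 i).
rewrite (derive_coord e 0 i Ct).
have -> : 'D_e (fun a => tau (Phi (a, z))) a =
    'D_e ((fun a' => tau (Phi (a', Phi (a, z)))) \o kappa) a.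
  by apply: near_eq_derive; apply: filterS kE => x /= ->.
have [Va [Cb [_ ba]]] := Wa.
rewrite (derive_comp _ _ Ck) k1 ?tau0 ?mxE//.
apply: (@Cinf_at_comp _ _ _ _ b tau (fun a' => Phi (a', Phi (a, z)))); [exact: findim_rV| |exact: (Cl (b, _))].
by rewrite ba; exact: Ctau.
Qed.

End orbit_map.

(** Around each point of [S] some basic open set lies in a level set of [T], so every value is read
    off a member of a countable basis. *)
Lemma countable_values {R : realType} {k n : nat} (G : manifold R k) (S : set G)
    (T : G -> 'rV[R]_n) :
  (forall g, S g -> \forall h \near g, T h = T g) -> countable (T @` S).
Proof.
move=> loc; have [_ [B cB [oB bB]] _ _ _] := manifoldP G.
have [->|/set0P[g0 Sg0]] := eqVneq S set0.
  by rewrite image_set0; exact: countable0.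
pose F (A : set G) := T (xget g0 A).
apply: (@sub_countable _ _ _ (F @` B)); last exact: card_le_trans (card_image_le _ _) cB.
apply: subset_card_le => _ [g Sg <-].
have [A [BA Ag] AT] := bB g _ (loc g Sg).
by exists A => //; exact: (AT _ (xgetPex g0 (ex_intro _ g Ag))).
Qed.

Lemma nbhs_uncountable {R : realType} (A : set R) : nbhs (0 : R) A -> ~ countable A.
Proof.
move=> /nbhs_ballP[e /= e0 eA] cA.
have cI : countable [set` `]0, e[%R].
  apply: sub_countable cA; apply: subset_card_le => s /=; rewrite in_itv/= => /andP[s0 se].
  by apply: eA; rewrite /ball/= sub0r normrN gtr0_norm.
have := countable_lebesgue_measure0 cI; rewrite lebesgue_measure_itv/= lte_fin e0.
by rewrite sube0 => /eqP; rewrite eqe gt_eqF.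
Qed.

Section transitive_action.
Context {R : realType} {k n : nat} {G : lie_group R k} {M : manifold R n}.
Notation "g ** h" := (@lie_mul R k G g h) (at level 40, left associativity).
Notation inv := (@lie_inv R k G).
Notation one := (lie_one G).
Variable act : G -> M -> M.
Hypotheses (Aact : lie_action act) (trans : forall x y, exists g, act g x = y).
Implicit Types (g h : G) (p q x : M).

Let pG := premanifold_manifold G.
Let pM := premanifold_manifold M.
Let AL := @lie_mul_action R k G.
Let CO q g : {for g, continuous (act^~ q)}.
Proof. exact: smooth_at_continuous (smooth_smooth_at g (smooth_orbit Aact q)). Qed.
Let CR h g : {for g, continuous (fun g => g ** h)}.
Proof. exact: smooth_at_continuous (smooth_smooth_at g (smooth_orbit AL h)). Qed.

Section charts.
Variables (b : chart 'rV[R]_k G) (c : chart 'rV[R]_n M) (p : M).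
Hypotheses (cb : charts b) (d1 : chart_dom b one) (cc : charts c) (dp : chart_dom c p).
Let lb : chart_laws b. Proof. by have [_ _ l _] := pG; exact: l. Qed.
Let lc : chart_laws c. Proof. by have [_ _ l _] := pM; exact: l. Qed.
Let bK g : chart_dom b g -> chart_inv b (chart_map b g) = g.
Proof. by have [_ _ h _ _] := lb; exact: h. Qed.
Let cK q : chart_dom c q -> chart_inv c (chart_map c q) = q.
Proof. by have [_ _ h _ _] := lc; exact: h. Qed.

Definition act_rep (az : 'rV[R]_k * 'rV[R]_n) : 'rV[R]_n :=
  chart_map c (act (chart_inv b az.1) (chart_inv c az.2)).
Notation Phi := act_rep.
Notation b1 := (chart_map b one).
Notation z0 := (chart_map c p).

Let nearb : \forall a \near b1, chart_dom b (chart_inv b a) /\ chart_map b (chart_inv b a) = a.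
Proof. exact: chart_image_near. Qed.
Let nearc : \forall z \near z0, chart_dom c (chart_inv c z) /\ chart_map c (chart_inv c z) = z.
Proof. exact: chart_image_near. Qed.

Lemma Cinf_act_rep : Cinf_at (b1, z0) Phi.
Proof.
have ce : charts (prod_chart b c : chart _ (prod_charted G M)) by exists b, c.
have [_ H] := smooth_at_act Aact (one, p).
by apply: (H _ c ce cc) => //=; rewrite (act1 Aact).
Qed.

Lemma act_rep1 : \forall z \near z0, Phi (b1, z) = z.
Proof. by apply: filterS nearc => z [dz zE]; rewrite /act_rep/= bK// (act1 Aact). Qed.

Lemma near_act : \forall az \near (b1, z0), chart_dom c (act (chart_inv b az.1) (chart_inv c az.2)).
Proof.
have [_ _ _ _ ib] := lb; have [oc _ _ _ ic] := lc.
have : nbhs (act (chart_inv b b1) (chart_inv c z0)) (chart_dom c).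
  by rewrite bK// cK// (act1 Aact); exact: chart_dom_near.
apply: near_comp.
have := @continuous_comp _ _ _ (fun az : 'rV[R]_k * 'rV[R]_n => (chart_inv b az.1, chart_inv c az.2))
  (fun gp => act gp.1 gp.2) (b1, z0); apply.
  apply: (@cvg_pair _ _ _ _ (nbhs (chart_inv b b1)) (nbhs (chart_inv c z0))).
    by apply: (cvg_comp _ _ cvg_fst); exact: ib.
  by apply: (cvg_comp _ _ cvg_snd); exact: ic.
exact: smooth_at_continuous (smooth_at_act Aact (chart_inv b b1, chart_inv c z0)).
Qed.

Lemma Cinf_group_rep (F : G -> G) g : smooth F -> chart_dom b g -> chart_dom b (F g) ->
  Cinf_at (chart_map b g) (chart_map b \o F \o chart_inv b).
Proof. by move=> SF dg dF; have [_ H] := smooth_smooth_at g SF; exact: H. Qed.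

Lemma near_group_rep (F : G -> G) g : smooth F -> chart_dom b g -> chart_dom b (F g) ->
  \forall a \near chart_map b g, chart_dom b (F (chart_inv b a)).
Proof.
move=> SF dg dF; apply: (chart_nbhs lb dg (P := fun x : G => chart_dom b (F x))).
have := smooth_at_continuous (smooth_smooth_at g SF); apply.
exact: chart_dom_near.
Qed.

Lemma act_rep_transport : \forall az \near (b1, z0), exists kappa : 'rV[R]_k -> 'rV[R]_k,
  [/\ kappa az.1 = b1, Cinf_at az.1 kappa &
      \forall a \near az.1, Phi (a, az.2) = Phi (kappa a, Phi az)].
Proof.
have nb' : \forall az \near (b1, z0), chart_dom b (chart_inv b az.1) /\ chart_map b (chart_inv b az.1) = az.1.
  apply: (@near_comp _ _ fst (b1, z0) (fun a => chart_dom b (chart_inv b a) /\ chart_map b (chart_inv b a) = a)) nearb.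
  exact: cvg_fst.
apply: filterS2 nb' near_act => -[a z] /= [da aE] daz.
pose g := chart_inv b a; have SR := smooth_orbit AL (inv g).
have dR : chart_dom b (g ** inv g) by rewrite lie_mulgV.
exists (chart_map b \o (fun x : G => x ** inv g) \o chart_inv b); split.
- by rewrite /= lie_mulgV.
- by have := Cinf_group_rep SR da dR; rewrite aE.
- have := near_group_rep SR da dR; rewrite aE; apply: filterS => a' da'.
  by rewrite /act_rep /= cK// bK// -(actM Aact) -lie_mulA lie_mulV lie_mulg1.
Qed.

(** Conjugation fixes the unit with invertible derivative, and relates the orbit map of a point to
    that of its image under [act g]. *)
Let conj_rep g := chart_map b \o (fun x : G => g ** x ** inv g) \o chart_inv b.

Lemma conj_rep_dom g : chart_dom b (g ** one ** inv g).
Proof. by rewrite lie_mulg1 lie_mulgV. Qed.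

Lemma near_conj_rep g : \forall a \near b1, chart_inv b (conj_rep g a) = g ** chart_inv b a ** inv g.
Proof.
apply: filterS (near_group_rep (smooth_conj g) d1 (conj_rep_dom g)) => a da.
by rewrite /conj_rep/= bK.
Qed.

Lemma conj_rep_one g : conj_rep g b1 = b1.
Proof. by rewrite /conj_rep/= bK// lie_mulg1 lie_mulgV. Qed.

Lemma Cinf_conj_rep g : Cinf_at b1 (conj_rep g).
Proof. exact: (Cinf_group_rep (smooth_conj g) d1 (conj_rep_dom g)). Qed.

Lemma jac_conj_rep g : jac (conj_rep g) b1 *m jac (conj_rep (inv g)) b1 = 1%:M.
Proof.
have := @jac_comp _ _ _ _ (conj_rep (inv g)) (conj_rep g) b1; rewrite conj_rep_one => <-; try exact: Cinf_conj_rep.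
rewrite -(jac_id b1); apply: jac_near; apply: filterS2 (near_conj_rep g) nearb => a e [da aE].
rewrite [LHS]/conj_rep/= e lie_invK !lie_mulA lie_mulV lie_mul1 -lie_mulA lie_mulV lie_mulg1.
exact: aE.
Qed.

Lemma Cinf_orbit_rep z : Cinf_at (b1, z) Phi -> Cinf_at b1 (fun a => Phi (a, z)).
Proof.
move=> C; apply: (@Cinf_at_comp _ _ _ _ b1 Phi (fun a => (a, z))) => //.
  exact: (findim_prod (findim_rV k) (findim_rV n)).
by apply: Cinf_at_pair; [exact: Cinf_at_id|exact: Cinf_at_cst].
Qed.

(** By transitivity the nearby point is [act g p], where g x g^-1 acts as x does at [p], up to
    [act g]. So the derivative of its orbit map is that at [p] with a factor on each side. *)
Lemma act_rep_rank : \forall z \near z0,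
  (\rank (orbit_jac Phi b1 z) <= \rank (orbit_jac Phi b1 z0))%N.
Proof.
have Cz : \forall z \near z0, Cinf_at (b1, z) Phi.
  apply: (@near_comp _ _ (fun z => (b1, z)) z0 (fun az => Cinf_at az Phi)).
    by apply: Cinf_at_continuous; apply: Cinf_at_pair; [exact: Cinf_at_cst|exact: Cinf_at_id].
  exact: Cinf_at_near Cinf_act_rep.
apply: filterS2 Cz nearc => z Cz [dz zE].
have [g gE] := trans p (chart_inv c z).
pose Lg := chart_map c \o act g \o chart_inv c.
have CLg : Cinf_at z0 Lg.
  by have [_ H] := smooth_smooth_at p (smooth_act Aact g); apply: H => //; rewrite gE.
have C0 := Cinf_orbit_rep Cinf_act_rep.
have e1 : jac (conj_rep g) b1 *m orbit_jac Phi b1 z = orbit_jac Phi b1 z0 *m jac Lg z0.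
  have := @jac_comp _ _ _ _ (fun a => Phi (a, z)) (conj_rep g) b1; rewrite conj_rep_one => <-; [|exact: Cinf_orbit_rep|exact: Cinf_conj_rep].
  have P0 := nbhs_singleton act_rep1.
  have := @jac_comp _ _ _ _ Lg (fun a => Phi (a, z0)) b1; rewrite P0 => <-; [|exact: CLg|exact: C0].
  apply: jac_near.
  have nd : \forall a \near b1, chart_dom c (act (chart_inv b a) p).
    apply: (chart_nbhs lb d1 (P := fun x : G => chart_dom c (act x p))).
    by apply: CO; rewrite (act1 Aact); exact: chart_dom_near.
  apply: filterS2 (near_conj_rep g) nd => a e da.
  rewrite /act_rep/= e -gE /Lg/= (cK dp) cK//.
  by rewrite !(actM Aact) (actK Aact).
have -> : orbit_jac Phi b1 z = jac (conj_rep (inv g)) b1 *m (orbit_jac Phi b1 z0 *m jac Lg z0).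
  by rewrite -e1 mulmxA (mulmx1C (jac_conj_rep g)) mul1mx.
by apply: leq_trans (mxrankM_maxr _ _) (mxrankM_maxl _ _).
Qed.

(* If the orbit map had rank < n, a function transverse to the orbit directions
   would be locally constant along the group, hence take only countably many
   values. *)
Lemma orbit_jac_full : \rank (orbit_jac Phi b1 z0) = n.
Proof.
apply/eqP; rewrite eqn_leq rank_leq_col leqNgt; apply/negP => rD.
have [tau [v [zeta [v0 zeta0 tau_zeta tau_cst]]]] := orbit_transversal
  (Cinf_at_near Cinf_act_rep) act_rep1 act_rep_transport act_rep_rank rD.
(* [S] collects the elements that carry [p] to a point whose nearby orbit stays in a level set of
   [tau]; there [T] is locally constant. *)
pose S : set G := [set g | chart_dom c (act g p) /\
  \forall a \near b1, tau (Phi (a, chart_map c (act g p))) = tau (chart_map c (act g p))].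
pose T g := tau (chart_map c (act g p)).
have cS : countable (T @` S).
  apply: countable_values => g [dg Sg].
  have [_ _ _ mb _] := lb.
  have n1 : \forall x \near (one : G), tau (Phi (chart_map b x, chart_map c (act g p))) = T g.
    exact: (mb _ d1 _ Sg).
  have n2 : \forall x \near (one : G), T (x ** g) = T g.
    apply: filterS2 (chart_dom_near lb d1) n1 => x dx <-.
    by rewrite /T /act_rep/= cK// bK// (actM Aact).
  have n3 : nbhs (g ** inv g) [set x : G | T (x ** g) = T g] by rewrite lie_mulgV.
  have := near_comp (@CR (inv g) g) n3; apply: filterS => h /=.
  by rewrite -lie_mulA lie_mulV lie_mulg1.
have [j vj] : exists j, v 0 j != 0 by exact/rV0Pn.
(* By transitivity the points [zeta s] are images of [p], so the countable set of values contains
   every small [s *: v]; dividing the coordinate [j] by that of [v] recovers [s]. *)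
have cI : countable ((fun w : 'rV[R]_n => w 0 j / v 0 j) @` (T @` S)).
  exact: card_le_trans (card_image_le _ _) cS.
apply: nbhs_uncountable cI.
have n1 : \forall t \near (0 : R), (chart_dom c (chart_inv c (zeta t)) /\
    chart_map c (chart_inv c (zeta t)) = zeta t) /\
    \forall a \near b1, tau (Phi (a, zeta t)) = tau (zeta t).
  exact: (zeta0 _ (filterI nearc tau_cst)).
apply: filterS2 tau_zeta n1 => s ts [[dz zE] tz].
exists (s *: v); last by rewrite mxE mulfK.
have [g gE] := trans p (chart_inv c (zeta s)).
by exists g; rewrite /S /T /= gE zE.
Qed.

Lemma tangent_fund_chart v : tangent p v -> exists2 u, tangent one u & v = fund act u p.
Proof.
move=> Tv; have [e vE] := tangent_cvecP cc dp Tv.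
have /row_fullP[Q QD] : row_full (orbit_jac Phi b1 z0) by rewrite /row_full orbit_jac_full.
exists (cvec b one (e *m Q)); first exact: tangent_cvec.
rewrite vE; apply: (@tangent_ext _ _ M p) => [||f Sf]; first exact: tangent_cvec.
  exact: vf_tangent (vf_fund Aact (tangent_cvec _ cb d1)).
rewrite fundE// cvecE// cvecE; last exact: (sf_pull (smooth_orbit Aact p) Sf).
have C0 := Cinf_orbit_rep Cinf_act_rep.
have P0 := nbhs_singleton act_rep1.
have Cf := sf_chart cc dp Sf.
have := @derive_comp _ _ _ _ b1 (e *m Q) (f \o chart_inv c : _ -> R^o) (fun a => Phi (a, z0)).
rewrite P0 => /(_ Cf C0); rewrite (jacE _ C0) -[jac _ _]/(orbit_jac Phi b1 z0).
rewrite -mulmxA QD mulmx1 => <-.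
apply: near_eq_derive.
have nd : \forall a \near b1, chart_dom c (act (chart_inv b a) p).
  apply: (chart_nbhs lb d1 (P := fun x : G => chart_dom c (act x p))).
  by apply: CO; rewrite (act1 Aact); exact: chart_dom_near.
by apply: filterS nd => a da; rewrite /act_rep/= (cK dp) cK.
Qed.

Lemma local_section_chart : exists s : M -> G, s p = one /\
  \forall x \near p, smooth_at s x /\ act (s x) p = x.
Proof.
have [U [h [[oU U0] h0 H]]] := local_section_coord (Cinf_at_near Cinf_act_rep) act_rep1 orbit_jac_full.
pose s x := chart_inv b (h (chart_map c x)).
have sp : s p = one by rewrite /s h0 bK.
exists s; split=> //.
have [_ _ _ mb ib] := lb; have [_ _ _ mc ic] := lc.
have Ch := (H _ U0).1; have ch := Cinf_at_continuous Ch.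
have chc : {for p, continuous (h \o chart_map c)} by apply: continuous_comp => //; exact: mc.
have n1 : \forall x \near p, U (chart_map c x) by apply: mc => //; exact: open_nbhs_nbhs.
have n2 : \forall x \near p, chart_dom b (s x) /\ chart_map b (s x) = h (chart_map c x).
  apply: (@near_comp _ _ (h \o chart_map c) p (fun a => chart_dom b (chart_inv b a) /\ chart_map b (chart_inv b a) = a) chc).
  by rewrite /= h0.
have cs : {for p, continuous s}.
  apply: (@continuous_comp _ _ _ (h \o chart_map c) (chart_inv b)) => //.
  by rewrite /= h0; exact: ib.
have n3 : \forall x \near p, chart_dom c (act (s x) p).
  have : {for p, continuous ((act^~ p) \o s)} by exact: continuous_comp.
  by apply; rewrite /= sp (act1 Aact); exact: chart_dom_near.
have n12 : \forall x \near p, U (chart_map c x) /\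
    (chart_dom b (s x) /\ chart_map b (s x) = h (chart_map c x)) by exact: filterI.
have n03 : \forall x \near p, chart_dom c x /\ chart_dom c (act (s x) p).
  by apply: filterI => //; exact: chart_dom_near.
apply: filterS2 n03 n12 => x [dx dsxp] [Ux [dsx sxE]].
have [Chx hx] := H _ Ux; split.
  have pFk := premanifold_flat (findim_rV (R := R) k).
  have pFn := premanifold_flat (findim_rV (R := R) n).
  apply: (@smooth_at_comp _ _ _ _ M (flat 'rV[R]_k) G (h \o chart_map c) (chart_inv b) x pM pFk).
  - by rewrite /= -sxE; exact: smooth_at_chart_inv.
  - apply: (@smooth_at_comp _ _ _ _ M (flat 'rV[R]_n) (flat 'rV[R]_k) (chart_map c) h x pM pFn).
    + exact/smooth_at_flat.
    + exact: smooth_at_chart_map.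
move: hx; rewrite /act_rep/= (cK dp) -/(s x) => hx.
by rewrite -[LHS]cK// hx cK.
Qed.

End charts.

Lemma tangent_fund p v : tangent p v -> exists2 u, tangent one u & v = fund act u p.
Proof.
have [_ cG _ _] := pG; have [_ cM _ _] := pM.
have [b cb db] := cG one; have [c cc dc] := cM p.
exact: (tangent_fund_chart cb db cc dc).
Qed.

Lemma local_section p : exists s : M -> G, s p = one /\
  \forall x \near p, smooth_at s x /\ act (s x) p = x.
Proof.
have [_ cG _ _] := pG; have [_ cM _ _] := pM.
have [b cb db] := cG one; have [c cc dc] := cM p.
exact: (local_section_chart cb db cc dc).
Qed.

End transitive_action.

Section smooth_extension.
Context {R : realType} {n : nat} {M : manifold R n}.
Let pM := premanifold_manifold M.

Lemma closed_nbhs (p : M) (U : set M) : nbhs p U ->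
  exists K : set M, [/\ closed K, nbhs p K & K `<=` U].
Proof.
move=> Up; have [_ cM lM _] := pM; have [c cc dp] := cM p.
have [_ _ cK mc _] := lM _ cc.
have [s s0 sU] := chart_radius cc dp Up.
have sD : ball (chart_map c p) s `<=` chart_map c @` chart_dom c.
  by move=> z /sU[x [dx _] <-]; exists x.
have h0 : 0 < s / 2 by rewrite divr_gt0.
exists (cball c p (s / 2)); split.
- by apply: (cball_closed cc sD) => //; rewrite ltr_pdivrMr//; lra.
- have n1 : \forall x \near p, ball (chart_map c p) (s / 2) (chart_map c x).
    by apply: mc => //; exact: nbhsx_ballx.
  apply: filterS2 (chart_dom_near (lM _ cc) dp) n1 => x dx.
  by rewrite -ball_normE/= distrC => xs; split => //; exact: ltW.
- move=> x [dx xs]; have : ball (chart_map c p) s (chart_map c x).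
    rewrite -ball_normE/= distrC; apply: le_lt_trans xs _.
    by rewrite ltr_pdivrMr//; lra.
  by move=> /sU[y [dy Uy] e]; rewrite -(cK _ dx) -e cK.
Qed.

Lemma smooth_extend (p : M) (f : M -> R) : (\forall x \near p, rsm f x) ->
  exists F : M -> R, smooth_fun F /\ {near p, F =1 f}.
Proof.
move=> Sf; have [K [cK Kp KS]] := closed_nbhs Sf.
have [h [Sh h1 h0]] := bump_in Kp.
exists (fun x => h x * f x); split.
  by apply: (smooth_cutoff cK Sh h0) => x /KS.
by apply: filterS h1 => x hx; rewrite hx mul1r.
Qed.

End smooth_extension.

(** * The moment map is a local injection *)

Section moment_injective.
Context {R : realType} {k n : nat} {G : lie_group R k} {M : manifold R n}.
Notation one := (lie_one G).
Variable act : G -> M -> M.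
Variable w : M -> vec M -> vec M -> R.
Variable theta : M -> (field G -> R).
Hypotheses (Aact : lie_action act) (trans : forall x y, exists g, act g x = y).
Hypothesis Sw : symplectic w.
Hypothesis Stheta : forall Z, smooth_fun (fun p => theta p Z).
Hypothesis theta_derive : forall Y Z p, lie_algebra Y -> lie_algebra Z ->
  fund act (Y one) p (fun q => theta q Z) = w p (fund act (Z one) p) (fund act (Y one) p).
Let pM := premanifold_manifold M.
Let Tw : two_form w. Proof. by case: Sw. Qed.

(** All tangent vectors are fundamental, so by [theta_derive] a vector killed by all components of
    theta lies in the kernel of [w]. *)
Lemma moment_immersion p v : tangent p v ->
  (forall Z, lie_algebra Z -> v (fun q => theta q Z) = 0) -> v = fun=> 0.
Proof.
move=> Tv v0; have [_ _ nw] := Sw; apply: (nw p) => // u Tu.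
have [a Ta vE] := tangent_fund Aact trans Tv; have [b Tb uE] := tangent_fund Aact trans Tu.
have [La Lb] := (lie_algebra_linv Ta, lie_algebra_linv Tb).
rewrite (formC Tw Tv Tu).
have := theta_derive p La Lb; rewrite !linv_one// -vE -uE => <-.
by rewrite v0 ?oppr0.
Qed.

(** Choose elements [Z i] of the Lie algebra whose fundamental vectors at [p] are the coordinate
    vectors. The Jacobian of the components of theta along them is the matrix of [w], invertible by
    nondegeneracy; composing with its inverse fits the normal form of [inverse_function]. *)
Lemma moment_locally_injective p : exists2 U, open_nbhs p U &
  forall x y, U x -> U y -> theta x = theta y -> x = y.
Proof.
have [_ cM lM _] := pM; have [c cc dp] := cM p; have lc := lM _ cc.
have [oc _ cK mc ic] := lc.
have Tc e := tangent_cvec e cc dp.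
have ex i : exists Z : field G, lie_algebra Z /\ fund act (Z one) p = cvec c p (delta_mx 0 i).
  have [u Tu uE] := tangent_fund Aact trans (Tc (delta_mx 0 i)).
  by exists (linv u); split; [exact: lie_algebra_linv|rewrite linv_one].
pose Z i := projT1 (cid (ex i)).
have LZ i : lie_algebra (Z i) by have [] := projT2 (cid (ex i)).
have ZE i : fund act (Z i one) p = cvec c p (delta_mx 0 i) by have [] := projT2 (cid (ex i)).
pose mu (z : 'rV[R]_n) : 'rV[R]_n := \row_i theta (chart_inv c z) (Z i).
have Cmu : Cinf_at (chart_map c p) mu.
  apply: Cinf_at_row => i; have := sf_chart cc dp (Stheta (Z i)).
  by apply: Cinf_at_ext => z; rewrite mxE.
have jacE' i j : jac mu (chart_map c p) i j = w p (cvec c p (delta_mx 0 j)) (cvec c p (delta_mx 0 i)).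
  rewrite mxE -(derive_coord _ 0 j Cmu) -!ZE -theta_derive// ZE cvecE//.
  rewrite (_ : (fun z : 'rV[R]_n => mu z 0 j : R^o) = (fun q => theta q (Z j)) \o chart_inv c)//.
  by apply/funext => z; rewrite mxE.
have uJ : jac mu (chart_map c p) \in unitmx.
  rewrite -row_free_unit; apply: inj_row_free => e eJ.
  have eW j : w p (cvec c p (delta_mx 0 j)) (cvec c p e) = 0.
    have -> : cvec c p e = fun f => \sum_i e 0 i * cvec c p (delta_mx 0 i) f.
      by apply/funext => f; exact: cvec_sum.
    rewrite (form_lsumr Tw)//; have := congr1 (fun r : 'rV_n => r 0 j) eJ.
    by rewrite !mxE => eq; rewrite -[RHS]eq; apply: eq_bigr => i _; rewrite jacE'.
  have [_ _ nw] := Sw.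
  have e0 : cvec c p e = fun=> 0.
    apply: (nw p) => // v Tv; have [a ->] := tangent_cvecP cc dp Tv.
    have -> : cvec c p a = fun f => \sum_i a 0 i * cvec c p (delta_mx 0 i) f.
      by apply/funext => f; exact: cvec_sum.
    rewrite (form_lsumr Tw)// big1// => i _.
    by rewrite (formC Tw)// eW oppr0 mulr0.
  have [chi [x [E [[Sc Sx vE FE] near_p]]]] := frame_exists cc dp.
  have [_ _ xc _] := nbhs_singleton near_p.
  by apply/rowP => i; rewrite -(cvec_coord e cc dp (Sx i) (xc i)) e0 mxE.
pose J := jac mu (chart_map c p); pose f z := mu z *m invmx J.
have Cf : Cinf_at (chart_map c p) f.
  have Lm : linear (fun z : 'rV[R]_n => z *m invmx J) by move=> a u v; rewrite mulmxDl scalemxAl.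
  have Cm := findimE (findim_rV n) Lm.
  apply: (@Cinf_at_comp _ _ _ _ _ (fun z : 'rV[R]_n => z *m invmx J) mu) => //.
    exact: findim_rV.
  exact: Cinf_at_linear Lm Cm.
have Df v : 'D_v f (chart_map c p) = v.
  have Lm : linear (fun z : 'rV[R]_n => z *m invmx J) by move=> a u u'; rewrite mulmxDl scalemxAl.
  have Cm := findimE (findim_rV n) Lm.
  have Cl : Cinf_at (mu (chart_map c p)) (fun z : 'rV[R]_n => z *m invmx J).
    exact: Cinf_at_linear Lm Cm.
  rewrite -[LHS]/('D_v ((fun z : 'rV[R]_n => z *m invmx J) \o mu) _) (derive_comp v Cl Cmu).
  by rewrite (derive_linear _ _ Lm Cm) (jacE _ Cmu) mulmxK.
have [U [h [oU _ _ H _]]] := inverse_function filterT Cf Df.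
have n1 : \forall x \near p, U (chart_map c x) by apply: mc => //; exact: open_nbhs_nbhs.
have n2 : nbhs p [set x | chart_dom c x /\ U (chart_map c x)].
  by apply: filterI => //; exact: chart_dom_near.
move: n2; rewrite nbhsE => -[V oV VU].
exists V => // x y /VU[dx Ux] /VU[dy Uy] txy.
rewrite -(cK _ dx) -(cK _ dy); congr (chart_inv c _).
have [<- _ _] := H _ Ux; have [<- _ _] := H _ Uy; congr (h (_ *m _)).
by apply/rowP => i; rewrite !mxE !cK// txy.
Qed.

End moment_injective.

(** * The coadjoint orbit *)

Section image_space.
Context {M : topologicalType} {T : Type}.
Variable theta : M -> T.

Definition image_space : Type := {o : T | exists p, theta p = o}.

Definition to_image (p : M) : image_space := exist _ (theta p) (ex_intro _ p erefl).

HB.instance Definition _ := gen_eqMixin image_space.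
HB.instance Definition _ := gen_choiceMixin image_space.

(** The topology is the quotient one and not that induced by the dual, since a coadjoint orbit may
    be immersed without being embedded. *)
Definition image_open : set_system image_space := [set U | open (to_image @^-1` U)].

Lemma image_openT : image_open setT.
Proof. by rewrite /image_open/= preimage_setT; exact: openT. Qed.

Lemma image_openI : setI_closed image_open.
Proof. by move=> U V oU oV; exact: openI. Qed.

Lemma image_open_bigcup (I : Type) (f : I -> set image_space) :
  (forall i, image_open (f i)) -> image_open (\bigcup_i f i).
Proof. move=> oF; rewrite /image_open/= preimage_bigcup.
by apply: bigcup_open => i _; exact: oF. Qed.

HB.instance Definition _ :=
  isOpenTopological.Build image_space image_openT image_openI image_open_bigcup.

Lemma image_spaceP (o o' : image_space) : sval o = sval o' -> o = o'.
Proof. by case: o o' => [x hx] [y hy] /= e; exact: eq_exist. Qed.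

Lemma to_imageP p q : to_image p = to_image q <-> theta p = theta q.
Proof. by split=> [/(congr1 sval)|e]; [|exact: image_spaceP]. Qed.

Lemma to_image_surj o : exists p, to_image p = o.
Proof. by case: o => [x [p e]]; exists p; exact: image_spaceP. Qed.

Lemma open_imageE (U : set image_space) : open U = open (to_image @^-1` U).
Proof. by []. Qed.

Lemma to_image_continuous : continuous to_image.
Proof. by apply/continuousP => A; rewrite open_imageE. Qed.

End image_space.

Section orbit.
Context {R : realType} {k n : nat} {G : lie_group R k} {M : manifold R n}.
Notation "g ** h" := (@lie_mul R k G g h) (at level 40, left associativity).
Notation inv := (@lie_inv R k G).
Notation one := (lie_one G).
Variable act : G -> M -> M.
Variable theta : M -> (field G -> R).
Variable p0 : M.
Hypotheses (Aact : lie_action act) (trans : forall x y, exists g, act g x = y).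
Hypothesis Stheta : forall Z, smooth_fun (fun p => theta p Z).
Hypothesis theta_act : forall g p, theta (act g p) = coAd g (theta p).
Hypothesis theta_inj : forall p, exists2 U, open_nbhs p U &
  forall x y, U x -> U y -> theta x = theta y -> x = y.
Notation O := (image_space theta).
Notation pi := (to_image theta).
Let pM := premanifold_manifold M.
Let pG := premanifold_manifold G.

Lemma pi_act g p q : pi p = pi q -> pi (act g p) = pi (act g q).
Proof. by move=> /to_imageP e; apply/to_imageP; rewrite !theta_act e. Qed.

Lemma smooth_section_act (s : M -> G) q x : smooth_at s x -> smooth_at (fun y => act (s y) q) x.
Proof.
move=> Ss; apply: (@smooth_at_comp _ _ _ _ M G M s (act^~ q) x pM pG) => //.
exact: smooth_smooth_at (smooth_orbit Aact q).
Qed.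

(** If [q] has the same image as some [u] in [U], then [act (s x) u], for a local section [s] at
    [q], stays in [U] and has the image of [x] for all [x] near [q]. *)
Lemma pi_open (U : set M) : open U -> open (pi @` U).
Proof.
move=> oU; rewrite open_imageE openE => q [u Uu uq].
have [s [s1 sq]] := local_section Aact trans q.
have S := smooth_section_act u (nbhs_singleton sq).1.
have nU : nbhs (act (s q) u) U by rewrite s1 (act1 Aact); exact: open_nbhs_nbhs.
have := near_comp (smooth_at_continuous S) nU.
apply: filterS2 sq => x [_ sx] Ux; exists (act (s x) u) => //.
by rewrite (pi_act (s x) uq) sx.
Qed.

Lemma pi_nbhs p (A : set M) : nbhs p A -> nbhs (pi p) (pi @` A).
Proof.
rewrite nbhsE => -[U [oU Up] UA]; apply: (@filterS _ _ _ (pi @` U)).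
  exact: image_subset.
by apply: open_nbhs_nbhs; split; [exact: pi_open|exists p].
Qed.

Definition is_sheet (U : set M) : Prop :=
  open U /\ forall x y, U x -> U y -> pi x = pi y -> x = y.

Lemma sheet_around p (A : set M) : nbhs p A -> exists U, [/\ is_sheet U, U p & U `<=` A].
Proof.
rewrite nbhsE => -[B [oB Bp] BA]; have [U [oU Up] Uinj] := theta_inj p.
exists (U `&` B); split; [split|by []|by move=> x [_ /BA]].
- exact: openI.
- by move=> x y [Ux _] [Uy _] /to_imageP; exact: Uinj.
Qed.

(* [p0] is a dummy, returned outside the image of U. *)
Definition sect (U : set M) (o : O) : M := xget p0 [set x | U x /\ pi x = o].

Lemma sect_in U o : (pi @` U) o -> U (sect U o) /\ pi (sect U o) = o.
Proof. by move=> [x Ux xo]; apply: (@xgetPex _ p0 [set x | U x /\ pi x = o]); exists x. Qed.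

Lemma sectK U x : is_sheet U -> U x -> sect U (pi x) = x.
Proof.
move=> [oU Uinj] Ux; have [|h1 h2] := @sect_in U (pi x); first by exists x.
exact: Uinj.
Qed.

Lemma sect_continuous U x : is_sheet U -> U x -> {for pi x, continuous (sect U)}.
Proof.
move=> SU Ux A; rewrite /= (sectK SU Ux) => Ax.
have nU : nbhs x U by apply: open_nbhs_nbhs; split => //; case: SU.
have nAU : nbhs x (A `&` U) by exact: filterI.
have := pi_nbhs nAU; apply: filterS => _ [y [Ay Uy] <-] /=.
by rewrite sectK.
Qed.

(** Passing from the sheet of [u] to that of [u'] is locally [x -> act (s x) u'] with a local
    section [s] at [u]. This gives smooth transition maps on the orbit. *)
Lemma sect_pi_smooth U u u' : is_sheet U -> U u' -> pi u = pi u' ->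
  smooth_at (N := M) (sect U \o pi) u.
Proof.
move=> SU Uu' e; have [s [s1 su]] := local_section Aact trans u.
have S := smooth_section_act u' (nbhs_singleton su).1.
apply: (smooth_at_eq pM _ S).
have nU : nbhs (act (s u) u') U.
  by rewrite s1 (act1 Aact); apply: open_nbhs_nbhs; split => //; case: SU.
have := near_comp (smooth_at_continuous S) nU.
apply: filterS2 su => x [_ sx] Ux; rewrite -[in RHS]sx /=.
by rewrite (pi_act (s x) e) sectK.
Qed.

Definition orbit_chart (c : chart 'rV[R]_n M) (U : set M) : chart 'rV[R]_n O :=
  Chart (pi @` U) (chart_map c \o sect U) (pi \o chart_inv c).

Definition orbit_charted : charted 'rV[R]_n := @Charted R 'rV[R]_n O
  [set d | exists c U, [/\ charts c, is_sheet U, U `<=` chart_dom c & d = orbit_chart c U]].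

Lemma orbit_chart_image c U (A : set O) : is_sheet U -> A `<=` pi @` U ->
  chart_map (orbit_chart c U) @` A = chart_map c @` (U `&` pi @^-1` A).
Proof.
move=> SU AU; apply/seteqP; split=> [_ [y Ay <-]|_ [x [Ux Ax] <-]].
  have [h1 h2] := sect_in (AU _ Ay); exists (sect U y) => //; split=> //.
  by rewrite /= h2.
by exists (pi x) => //=; rewrite sectK.
Qed.

Lemma orbit_chart_laws c U : charts c -> is_sheet U -> U `<=` chart_dom c ->
  chart_laws (orbit_chart c U).
Proof.
move=> cc SU Uc; have [_ _ lM _] := pM; have lc := lM _ cc.
have [oc _ cK mc ic] := lc; have oU := SU.1; split.
- exact: pi_open.
- rewrite orbit_chart_image//; apply: (chart_image_open lc).
    by move=> x [/Uc].
  by apply: openI => //; rewrite -open_imageE; exact: pi_open.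
- move=> o /sect_in[h1 h2]; rewrite /= cK ?h2//; exact: Uc.
- move=> _ [x Ux <-]; apply: continuous_comp; first exact: sect_continuous.
  by rewrite sectK//; apply: mc; exact: Uc.
- move=> _ [x Ux <-]; rewrite /= sectK//.
  apply: continuous_comp; first by apply: ic; exact: Uc.
  exact: to_image_continuous.
Qed.

Lemma orbit_chart_change c U d V : charts c -> is_sheet U -> U `<=` chart_dom c ->
  charts d -> is_sheet V -> V `<=` chart_dom d ->
  Cinfty (chart_map (orbit_chart c U) @`
            (chart_dom (orbit_chart c U) `&` chart_dom (orbit_chart d V)))
         (chart_map (orbit_chart d V) \o chart_inv (orbit_chart c U)).
Proof.
move=> cc SU Uc cd SV Vd; have [_ _ lM _] := pM; have lc := lM _ cc.
rewrite orbit_chart_image//.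
have o1 : open (U `&` pi @^-1` (chart_dom (orbit_chart c U) `&` chart_dom (orbit_chart d V))).
  apply: openI; first exact: SU.1.
  by rewrite -open_imageE; apply: openI; apply: pi_open; [exact: SU.1|exact: SV.1].
apply: (Cinf_atP _ _).2; first by apply: (chart_image_open lc) => // x [/Uc].
move=> _ [x [Ux [_ [y Vy yx]]] <-].
have [_ H] := sect_pi_smooth SV Vy (esym yx).
by have := H c d cc cd (Uc _ Ux); rewrite /= -yx sectK// => /(_ (Vd _ Vy)).
Qed.

(** Distinct functionals differ at some [Z], and evaluation at [Z] is continuous on the quotient
    because it is so on [M]. *)
Lemma image_space_hausdorff : hausdorff_space O.
Proof.
move=> o o' oo'; apply: image_spaceP; apply/funext => Z.
apply: (@Rhausdorff R) => A B nA nB.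
have cZ : continuous (fun o : O => sval o Z).
  apply/continuousP => C oC; rewrite open_imageE.
  have : continuous (fun p => theta p Z : R^o).
    move=> p; exact: (rsm_continuous (sf_rsm p (Stheta Z))).
  by move=> /continuousP; exact.
have [x [Ax Bx]] := oo' _ _ (cZ o A nA) (cZ o' B nB).
by exists (sval x Z).
Qed.

Lemma image_space_second_countable : @second_countable O.
Proof.
have [_ [B cB [oB bB]] _ _ _] := manifoldP M.
exists [set pi @` A | A in B]; first exact: card_le_trans (card_image_le _ _) cB.
split=> [_ [A BA <-]|o]; first by apply: pi_open; exact: oB.
have [p <-] := to_image_surj o; move=> A nA.
have [C [BC Cp] CA] := bB p _ (to_image_continuous nA).
exists (pi @` C); first by split; [exists C|exists p].
by move=> _ [x Cx <-]; exact: CA.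
Qed.

Lemma orbit_is_manifold : is_manifold orbit_charted.
Proof.
have [_ cM _ _] := pM; split.
- exact: image_space_hausdorff.
- exact: image_space_second_countable.
- move=> o; have [p po] := to_image_surj o; have [c cc dp] := cM p.
  have nd : nbhs p (chart_dom c) by have [_ _ lM _] := pM; exact: (chart_dom_near (lM _ cc) dp).
  have [U [SU Up Uc]] := sheet_around nd.
  by exists (orbit_chart c U); [exists c, U|exists p].
- by move=> _ [c [U [cc SU Uc ->]]]; exact: orbit_chart_laws.
- move=> _ _ [c [U [cc SU Uc ->]]] [d [V [cd SV Vd ->]]].
  exact: orbit_chart_change.
Qed.

Definition orbit_manifold : manifold R n := Manifold orbit_is_manifold.
Notation OM := orbit_manifold.
Let pO := premanifold_manifold orbit_manifold.

Lemma smooth_at_pi p : smooth_at (M := M) (N := OM) pi p.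
Proof.
have [_ cM lM _] := pM; have [c cc dp] := cM p.
have [U [SU Up Uc]] := sheet_around (chart_dom_near (lM _ cc) dp).
have cd : charts (orbit_chart c U : chart _ OM) by exists c, U.
apply: (@smooth_at_chart _ _ _ M OM pM pO pi p c (orbit_chart c U) cc cd dp).
- by exists p.
- exact: to_image_continuous.
have := Cinf_at_id (chart_map c p); apply: Cinf_at_eq.
have nU : nbhs p U by apply: open_nbhs_nbhs; split=> //; exact: SU.1.
apply: (filterS2 _ _ (chart_nbhs (lM _ cc) dp nU) (chart_image_near (lM _ cc) dp)).
by move=> z Uz [dz zE]; rewrite /= sectK.
Qed.

Lemma smooth_pi : @smooth R _ _ M OM pi.
Proof. by apply/(smoothP pM pO) => p; exact: smooth_at_pi. Qed.

Lemma smooth_at_sect U x : is_sheet U -> U x -> smooth_at (M := OM) (N := M) (sect U) (pi x).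
Proof.
move=> SU Ux; have [_ cM lM _] := pM; have [c cc dx] := cM x.
pose V := U `&` chart_dom c; have [oc _ cK mc ic] := lM _ cc.
have SV : is_sheet V.
  split; first by apply: openI => //; exact: SU.1.
  by move=> y z [Uy _] [Uz _]; exact: SU.2.
have cd : charts (orbit_chart c V : chart _ OM) by exists c, V; split=> // y [].
have Vx : V x by [].
have e : {near pi x, sect V =1 sect U}.
  have nV : nbhs x V by apply: open_nbhs_nbhs; split=> //; exact: SV.1.
  have := pi_nbhs nV; apply: filterS => _ [y [Uy dy] <-].
  by rewrite (sectK SU Uy) (sectK SV (conj Uy dy)).
apply: (@smooth_at_eq _ _ _ OM M pO (sect V) (sect U) (pi x) e).
apply: (@smooth_at_chart _ _ _ OM M pO pM (sect V) (pi x) (orbit_chart c V) c cd cc).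
- by exists x.
- by rewrite sectK.
- exact: sect_continuous.
rewrite /= sectK//.
have := Cinf_at_id (chart_map c x); apply: Cinf_at_eq.
have nV : nbhs x V by apply: open_nbhs_nbhs; split=> //; exact: SV.1.
apply: (filterS2 _ _ (chart_nbhs (lM _ cc) dx nV) (chart_image_near (lM _ cc) dx)).
by move=> z Vz [dz zE]; rewrite /= sectK.
Qed.

Lemma smooth_at_descend (W : normedModType R) (N : charted W) (F : O -> N) x :
  smooth_at (F \o pi) x -> smooth_at (M := OM) F (pi x).
Proof.
move=> SF; have [U [SU Ux _]] := sheet_around (filterT : nbhs x setT).
have e : {near pi x, (F \o pi) \o sect U =1 F}.
  have nU : nbhs x U by apply: open_nbhs_nbhs; split=> //; exact: SU.1.
  by have := pi_nbhs nU; apply: filterS => _ [y Uy <-]; rewrite /= sectK.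
apply: (@smooth_at_eq _ _ _ OM N pO _ _ (pi x) e).
apply: (@smooth_at_comp _ _ _ _ OM M N (sect U) (F \o pi) (pi x) pO pM).
  by rewrite sectK.
exact: smooth_at_sect.
Qed.

End orbit.

(** * The symplectic form of the orbit and the covering map *)

Section covering.
Context {R : realType} {k n : nat} {G : lie_group R k} {M : manifold R n}.
Notation "g ** h" := (@lie_mul R k G g h) (at level 40, left associativity).
Notation inv := (@lie_inv R k G).
Notation one := (lie_one G).
Variable act : G -> M -> M.
Variable w : M -> vec M -> vec M -> R.
Variable theta : M -> (field G -> R).
Variable p0 : M.
Hypotheses (Aact : lie_action act) (trans : forall x y, exists g, act g x = y).
Hypotheses (Sw : symplectic w) (Iw : form_invariant act w).
Hypothesis Stheta : forall Z, smooth_fun (fun p => theta p Z).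
Hypothesis theta_act : forall g p, theta (act g p) = coAd g (theta p).
Hypothesis theta_inj : forall p, exists2 U, open_nbhs p U &
  forall x y, U x -> U y -> theta x = theta y -> x = y.
Hypothesis theta_imm : forall p v, tangent p v ->
  (forall Z, lie_algebra Z -> v (fun q => theta q Z) = 0) -> v = fun=> 0.
Hypothesis theta_bracket : forall p X Y, lie_algebra X -> lie_algebra Y ->
  theta p (bracket X Y) = w p (fund act (X one) p) (fund act (Y one) p).
Hypothesis theta_dual : forall p, lie_dual (theta p).

Notation O := (orbit_manifold p0 Aact trans Stheta theta_act theta_inj).
Let pM := premanifold_manifold M.
Let pG := premanifold_manifold G.
Let pO := premanifold_manifold O.
Let Tw : two_form w. Proof. by case: Sw. Qed.

Definition orbit_proj : M -> O := to_image theta.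
Notation pi := orbit_proj.
Notation dpi := (differential pi).

Let Spi : smooth pi. Proof. exact: smooth_pi. Qed.

Let descend (f : O -> R) : smooth_fun (f \o pi) -> smooth_fun f.
Proof.
move=> Sf; apply: rsm_sf => o; have [p <-] := to_image_surj o.
by apply: smooth_at_descend; exact: sf_rsm.
Qed.

Lemma dpi_inj p u v : tangent p u -> tangent p v -> dpi u = dpi v -> u = v.
Proof.
move=> Tu Tv e; apply/eqP; rewrite -subr_eq0; apply/eqP.
apply: (theta_imm (tangent_subv Tu Tv)) => Z LZ.
have SF : smooth_fun (fun o : O => sval o Z) by apply: descend; exact: Stheta.
have := congr1 (fun t : vec O => t (fun o => sval o Z)) e.
by rewrite !differentialE//= => e'; apply/eqP; rewrite subr_eq0; apply/eqP.
Qed.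

Lemma dpi_surj p t : tangent (pi p) t -> exists v, tangent p v /\ dpi v = t.
Proof.
move=> Tt; have [_ cM lM _] := pM; have [c cc dp] := cM p.
have [U [SU Up Uc]] := sheet_around theta_inj (chart_dom_near (lM _ cc) dp).
have cd : charts (orbit_chart theta p0 c U : chart _ O) by exists c, U.
have dd : chart_dom (orbit_chart theta p0 c U : chart _ O) (pi p) by exists p.
have [e ->] := tangent_cvecP cd dd Tt.
have Tc := tangent_cvec e cc dp; exists (cvec c p e); split=> //.
apply: (tangent_ext (p := pi p)) => [||f Sf].
- exact: differential_tangent.
- exact: tangent_cvec.
rewrite differentialE// !cvecE//; last exact: sf_pull.
by rewrite /= sectK.
Qed.

(* Junk value 0 off the tangent space at [pi p]. *)
Definition lift p (t : vec O) : vec M :=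
  if pselect (exists v, tangent p v /\ dpi v = t) is left e then projT1 (cid e) else fun=> 0.

Lemma liftP p t : tangent (pi p) t -> tangent p (lift p t) /\ dpi (lift p t) = t.
Proof.
by move=> /dpi_surj e; rewrite /lift; case: pselect => // e'; exact: (projT2 (cid e')).
Qed.

Lemma lift_unique p t v : tangent p v -> dpi v = t -> lift p t = v.
Proof.
move=> Tv e; have Tt : tangent (pi p) t by rewrite -e; exact: differential_tangent.
by have [h1 h2] := liftP Tt; apply: (dpi_inj h1 Tv); rewrite h2.
Qed.

Definition rep (o : O) : M := projT1 (cid (to_image_surj o)).

Lemma repK o : pi (rep o) = o.
Proof. exact: (projT2 (cid (to_image_surj o))). Qed.

Definition orbit_form (o : O) (s t : vec O) : R := w (rep o) (lift (rep o) s) (lift (rep o) t).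
Notation Omega := orbit_form.

Lemma dpi_fund p q (a : vec G) : pi p = pi q -> dpi (fund act a p) = dpi (fund act a q).
Proof.
move=> e; rewrite /fund -!differential_comp//; congr (differential _ a).
by apply/funext => g /=; exact: pi_act.
Qed.

(** [orbit_form] is read at an arbitrary point of the fibre. On fundamental vectors [w] is theta of
    a bracket, hence depends on theta only and not on the point; and all tangent vectors are
    fundamental. *)
Lemma orbit_formE p u v : tangent p u -> tangent p v -> w p u v = Omega (pi p) (dpi u) (dpi v).
Proof.
move=> Tu Tv; have [a Ta ->] := tangent_fund Aact trans Tu.
have [b Tb ->] := tangent_fund Aact trans Tv.
have [La Lb] := (lie_algebra_linv Ta, lie_algebra_linv Tb).
have e := repK (pi p); set q := rep (pi p) in e.
have [Taq Tbq] := (vf_tangent q (vf_fund Aact Ta), vf_tangent q (vf_fund Aact Tb)).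
rewrite /Omega -/q (lift_unique Taq) ?(lift_unique Tbq); try exact: dpi_fund.
have := theta_bracket p La Lb; have := theta_bracket q La Lb.
by rewrite !linv_one// => <- <-; move/to_imageP: e => ->.
Qed.

Lemma vf_lift (X : field O) : vector_field X -> vector_field (fun p => lift p (X (pi p))).
Proof.
move=> vX; have Tl p := (liftP (vf_tangent (pi p) vX)).
split=> [p|f Sf]; first exact: (Tl p).1.
apply: rsm_sf => p.
have [U [SU Up _]] := sheet_around theta_inj (filterT : nbhs p setT).
have nU : nbhs p U by apply: open_nbhs_nbhs; split=> //; exact: SU.1.
(* Near [p] the function [f] descends to the sheet as [f \o sect p0 U]. Once this is extended to a
   global [F], the lift of [X] applied to [f] is [X F] composed with the projection. *)
have : \forall o \near (pi p : O), rsm (M := O) (f \o sect p0 U) o.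
  have := pi_nbhs Aact trans theta_act nU; apply: filterS => _ [x Ux <-].
  apply: (@smooth_at_comp _ _ _ _ O M (real_line R) (sect p0 U) f (pi x) pO pM).
    exact: sf_rsm.
  exact: smooth_at_sect.
move=> /smooth_extend[F [SF Ff]].
apply: (@rsm_eq _ _ M pM (fun q => X (pi q) F)); last first.
  by apply: sf_rsm; exact: (sf_pull (f := fun o : O => X o F) Spi (vf_sf vX SF)).
have n1 : \forall q \near p, F (pi q) = f q.
  have cpi : {for p, continuous pi} by exact: to_image_continuous.
  have nF : \forall o \near pi p, F o = (f \o sect p0 U) o by [].
  have := near_comp cpi nF.
  by apply: filterS2 nU => q Uq ->; rewrite /= sectK.
have := near_join n1; apply: filterS => q fq.
have [TL DL] := Tl q; rewrite -[in LHS]DL differentialE//.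
by apply: (tangent_local TL) => //; exact: sf_pull.
Qed.

Lemma two_form_orbit : two_form Omega.
Proof.
split=> [y a u v z Tu Tv Tz|y u v Tu Tv|X Y vX vY].
- rewrite -(repK y) in Tu Tv Tz; rewrite /Omega.
  have [Lu Du] := liftP Tu; have [Lv Dv] := liftP Tv; have [Lz Dz] := liftP Tz.
  have [lw _ _] := Tw; rewrite -lw//; congr (w _ _ _).
  by apply: lift_unique; [exact: tangent_comb|rewrite differential_comb Du Dv].
- rewrite -(repK y) in Tu Tv; rewrite /Omega.
  by have [[Lu _] [Lv _]] := (liftP Tu, liftP Tv); exact: formC.
- apply: descend; have [_ _ Sf] := Tw.
  have := Sf _ _ (vf_lift vX) (vf_lift vY); congr smooth_fun; apply/funext => p /=.
  have [[LX DX] [LY DY]] := (liftP (vf_tangent (pi p) vX), liftP (vf_tangent (pi p) vY)).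
  by rewrite orbit_formE// DX DY.
Qed.

Definition orbit_act (g : G) (o : O) : O := pi (act g (rep o)).

Lemma orbit_act_pi g p : orbit_act g (pi p) = pi (act g p).
Proof. by apply: pi_act => //; exact: repK. Qed.

Lemma smooth_orbit_act g : smooth (orbit_act g).
Proof.
apply/(smoothP pO pO) => o; have [p <-] := to_image_surj o.
apply: smooth_at_descend.
have -> : orbit_act g \o to_image theta = pi \o act g.
  by apply/funext => q; exact: orbit_act_pi.
apply: (@smooth_at_comp _ _ _ _ M M O (act g) pi p pM pM); apply: smooth_smooth_at => //.
exact: smooth_act.
Qed.

Lemma orbit_map_pi p : (fun g => orbit_act g (pi p)) = pi \o act^~ p.
Proof. by apply/funext => g; exact: orbit_act_pi. Qed.

Lemma orbit_coadjoint : coadjoint_orbit (fun o : O => sval o) orbit_act.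
Proof.
split.
- by move=> o o'; exact: image_spaceP.
- exists (theta p0); first exact: theta_dual.
  apply/seteqP; split=> [_ [y _ <-]|_ [g _ <-]].
    have [p <-] := to_image_surj y; have [g <-] := trans p0 p.
    by exists g => //=; rewrite theta_act.
  by exists (pi (act g p0)) => //=; rewrite theta_act.
- by move=> g o; rewrite -[in RHS](repK o) /= theta_act.
- move=> o; have [p <-] := to_image_surj o; rewrite -/(pi p) orbit_map_pi.
  have So : smooth (act^~ p : G -> M) by exact: smooth_orbit.
  split.
    apply/(smoothP pG pO) => g.
    by apply: (@smooth_at_comp _ _ _ _ G M O (act^~ p) pi g pG pM); apply: smooth_smooth_at.
  move=> g t Tt; have [v [Tv <-]] := dpi_surj Tt.
  have [a Ta vE] := tangent_fund Aact trans Tv.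
  have AL := @lie_mul_action R k G.
  (* Transitivity yields a vector [a] at the unit for the point [act g p]; right translation by [g]
     brings it to the tangent space at [g]. *)
  exists (differential (fun h => h ** g) a).
    by have := differential_tangent (smooth_orbit AL g) Ta; rewrite lie_mul1.
  rewrite differential_comp//; congr (differential pi _).
  rewrite vE /fund -differential_comp//.
  by congr (differential _ a); apply/funext => h /=; rewrite (actM Aact).
Qed.

Lemma orbit_kks : kks_form (fun o : O => sval o) orbit_act Omega.
Proof.
split; first exact: two_form_orbit.
- move=> g o u v; have [p <-] := to_image_surj o; rewrite -/(pi p) => Tu Tv.
  have [u' [Tu' <-]] := dpi_surj Tu; have [v' [Tv' <-]] := dpi_surj Tv.
  have Sg := smooth_act Aact g; have SO := smooth_orbit_act g.
  have e t : differential (orbit_act g) (dpi t) = dpi (differential (act g) t).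
    rewrite -!differential_comp//; congr (differential _ t).
    by apply/funext => q; exact: orbit_act_pi.
  rewrite !e orbit_act_pi -!orbit_formE//; first exact: Iw.
    exact: differential_tangent.
  exact: differential_tangent.
- move=> o X Y LX LY; have [p <-] := to_image_surj o; rewrite -/(pi p) orbit_map_pi.
  rewrite !differential_comp// -orbit_formE.
  + by rewrite -theta_bracket.
  + exact: vf_tangent p (vf_fund Aact (lie_algebra_tangent LX)).
  + exact: vf_tangent p (vf_fund Aact (lie_algebra_tangent LY)).
Qed.

(** A single sheet [U] around [p], on which a local section [s] is defined, evenly covers its image.
    The sheets are indexed by the points [q] of the fibre of [o]: the one of [q] consists of the
    [act (s x) q] with [x] in [U]. *)
Lemma orbit_covering : smooth_covering pi.
Proof.
split=> //; first by apply/seteqP; split=> // o _; have [p <-] := to_image_surj o; exists p.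
move=> o; have [p po] := to_image_surj o.
have [s [s1 sp]] := local_section Aact trans p.
have [U [SU Up Us]] := sheet_around theta_inj sp.
have oU := SU.1.
have Ss x : U x -> smooth_at s x by move=> /Us[].
have sE x : U x -> act (s x) p = x by move=> /Us[].
have piU : open (pi @` U) by exact: (pi_open Aact trans theta_act).
exists (pi @` U); split=> //; first by rewrite -po; exists p.
pose sg q (z : O) := act (s (sect p0 U z)) q.
have sgp q z : pi q = o -> (pi @` U) z -> pi (sg q z) = z.
  move=> qo /(@sect_in _ _ _ _ _ theta p0)[h1 h2].
  rewrite /sg -[RHS]h2 -[in RHS](sE _ h1); apply: pi_act => //.
  by rewrite -[LHS]/(pi q) qo -po.
have Ssg q z : (pi @` U) z -> smooth_at (M := O) (N := M) (sg q) z.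
  move=> [x Ux <-].
  apply: (@smooth_at_comp _ _ _ _ O M M (sect p0 U) (fun x => act (s x) q) (pi x) pO pM).
    by rewrite sectK//; apply: smooth_section_act => //; exact: Ss.
  exact: smooth_at_sect.
exists {q : M | pi q = o}, (fun q => sg (sval q) @` (pi @` U)), (fun q => sg (sval q)); split.
- move=> [q qo] [q' qo'] _ _ [_ [[z zU <-] [z' z'U /= e]]].
  have zz' : z' = z by rewrite -(sgp _ _ qo' z'U) e sgp.
  have qq : q = q'.
    by rewrite -(actK Aact (s (sect p0 U z)) q) -[act _ q]/(sg q z) -e zz' /sg (actK Aact).
  by apply: eq_exist.
- apply/seteqP; split=> [m [x Ux xm]|m [[q qo] _ [z zU <-]]]; last first.
    by rewrite /preimage/= sgp.
  have qo : pi (act (inv (s x)) m) = o.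
    rewrite -po -[in RHS](actK Aact (s x) p) sE//.
    by apply: pi_act => //; rewrite -xm.
  exists (exist (fun q => pi q = o) _ qo) => //; exists (pi x); first by exists x.
  by rewrite /sg /= sectK// (actKV Aact).
- move=> [q qo]; rewrite openE => m [_ [x Ux <-] mE].
  have pim : pi m = pi x by rewrite -mE sgp//; exists x.
  have cpi : {for m, continuous pi} by exact: to_image_continuous.
  have nU : nbhs m (pi @^-1` (pi @` U)).
    by apply: cpi; rewrite pim; apply: open_nbhs_nbhs; split=> //; exists x.
  (* [q'] retracts a point to the fibre of [o]. It is continuous and equals [q] at [m]; since theta
     is injective near [q], it is constant near [m], which keeps the nearby points in the sheet of
     [q]. *)
  pose q' m' := act (inv (s (sect p0 U (pi m')))) m'.
  have q'm : q' m = q by rewrite /q' pim sectK// -mE /sg/= sectK// (actK Aact).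
  have cq' : {for m, continuous q'}.
    apply: smooth_at_continuous.
    have pGM := premanifold_prod pG pM.
    apply: (@smooth_at_comp _ _ _ _ M (prod_charted G M) M
      (fun m' => (inv (s (sect p0 U (pi m'))), m')) (fun gp => act gp.1 gp.2) m pM pGM).
      exact: smooth_at_act.
    apply: smooth_at_pair; last exact: smooth_at_id.
    apply: (@smooth_at_comp _ _ _ _ M G G (s \o (sect p0 U \o pi)) inv m pM pG).
      exact: smooth_smooth_at (@lie_inv_smooth R k G).
    apply: (@smooth_at_comp _ _ _ _ M M G (sect p0 U \o pi) s m pM pM).
      by rewrite /= pim sectK//; exact: Ss.
    exact: (sect_pi_smooth p0 Aact trans theta_act SU Ux pim).
  have [V [oV Vq] Vinj] := theta_inj q.
  have nV : nbhs (q' m) V by rewrite q'm; exact: open_nbhs_nbhs.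
  have := near_comp cq' nV; apply: filterS2 nU => m' m'U Vq'.
  have [h1 h2] := sect_in p0 m'U.
  exists (pi m') => //=; rewrite /sg.
  have <- : q' m' = q.
    apply: Vinj => //; apply/to_imageP; rewrite -[RHS]/(pi q) qo -po.
    rewrite -[in RHS](actK Aact (s (sect p0 U (pi m'))) p) sE//.
    by apply: pi_act => //; rewrite h2.
  by rewrite /q' (actKV Aact).
- move=> [q qo]; apply/(smooth_onP pO pM _ piU) => z zU; exact: Ssg.
- move=> [q qo]; split=> [_ [z zU <-]|z zU] /=; first by rewrite sgp.
  by split; [exists z|rewrite sgp].
Qed.

End covering.

Theorem theorem2 (R : realType) (n : nat) (M : manifold R n)
    (w : M -> vec M -> vec M -> R) (J : M -> vec M -> vec M)
    (rho : M -> vec M -> vec M -> R) (lambda : R)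
    (w_symplectic : symplectic w)
    (J_compatible : compatible_acs w J)
    (J_homogeneous : homogeneous w J)
    (rho_chern_ricci : chern_ricci_form w J rho)
    (lambda_neq0 : lambda <> 0)
    (rhoE : forall p u v, tangent p u -> tangent p v ->
       rho p u v = lambda * w p u v) :
  exists (k m : nat) (G : lie_group R k) (O : manifold R m)
      (iota : O -> (field G -> R)) (act : G -> O -> O)
      (Omega : O -> vec O -> vec O -> R) (pi : M -> O),
    [/\ connected [set: G],
        coadjoint_orbit iota act,
        kks_form iota act Omega,
        smooth_covering pi &
        forall p u v, tangent p u -> tangent p v ->
          w p u v = Omega (pi p) (differential pi u) (differential pi v)].
Proof.
have [[p0 _] _ [k [G [act [cG [Aact _] trans Iw IJ]]]]] := J_homogeneous.
have [_ [nabla Cn rho_trace]] := rho_chern_ricci.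
pose theta := moment act J lambda nabla.
have Stheta Z : smooth_fun (fun p => theta p Z).
  exact: (sf_moment lambda Aact J_compatible Cn Z).
have theta_act g p : theta (act g p) = coAd g (theta p).
  exact: (moment_equivariant lambda Aact w_symplectic J_compatible Iw IJ Cn g p).
have theta_bracket p X Y : lie_algebra X -> lie_algebra Y ->
    theta p (bracket X Y) = w p (fund act (X (lie_one G)) p) (fund act (Y (lie_one G)) p).
  exact: (moment_bracket Aact w_symplectic J_compatible Iw IJ Cn rho_trace lambda_neq0 rhoE p).
have theta_derive Y Z p : lie_algebra Y -> lie_algebra Z ->
    fund act (Y (lie_one G)) p (fun q => theta q Z) =
    w p (fund act (Z (lie_one G)) p) (fund act (Y (lie_one G)) p).
  exact: (moment_derive Aact w_symplectic J_compatible Iw IJ Cn rho_trace lambda_neq0 rhoE p).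
have theta_imm p v := @moment_immersion _ _ _ _ _ _ _ _ Aact trans w_symplectic theta_derive p v.
have theta_inj p := moment_locally_injective Aact trans w_symplectic Stheta theta_derive p.
have theta_dual p : lie_dual (theta p) by exact: (moment_lie_dual lambda Aact J_compatible Cn p).
(* The orbit is that of [theta p0] under the given group, of the same dimension as [M] because theta
   is an immersion. *)
exists k, n, G, (orbit_manifold p0 Aact trans Stheta theta_act theta_inj), (fun o => sval o),
  (@orbit_act _ _ _ _ _ _ _ p0 Aact trans Stheta theta_act theta_inj),
  (@orbit_form _ _ _ _ _ _ w _ p0 Aact trans Stheta theta_act theta_inj),
  (orbit_proj p0 Aact trans Stheta theta_act theta_inj).
split=> //.
- exact: orbit_coadjoint.
- exact: orbit_kks.
- exact: orbit_covering.
- by move=> p u v; exact: orbit_formE.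
Qed.
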